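(* Let (H1)-(H5) (listed in the context) hold and suppose that the control $u^*=\{u^*(k),k\in\mathcal T\}\in\mathcal U$ and $\lambda^*\in\Lambda^{u^*}$ satisfy, for every $k\in\mathcal T$, $$\int_\Gamma\big\langle\partial_u\mathscr H_\gamma(k,x^*_\gamma(k),u^*(k),P_\gamma(k),Q_\gamma(k)),\,u-u^*(k)\big\rangle\,\lambda^*(d\gamma)\ \ge\ 0,\qquad \forall u\in U_k,\ \mathbb P\text{-a.s.},$$ where $x^*_\gamma$ is the trajectory corresponding to $u^*$ and $(P_\gamma,Q_\gamma)$ is the solution of the adjoint equation (given in the context). Assume further that for any $\gamma\in\Gamma$: (H6) the function $\phi_\gamma$ is convex in $x$, and the Hamiltonian $\mathscr H_\gamma$ is convex with respect to $(x,u)$. Then $u^*$ is an optimal control, i.e. it minimizes $J$ over $\mathcal U$.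
   Context: Probabilistic setting. $N>0$ is a fixed integer, $\mathcal T=\{0,\dots,N-1\}$. On a complete probability space $(\Omega,\mathcal F,\mathbb P)$, $B(1),\dots,B(N)$ are independent $\mathbb R^d$-valued random variables (components $B^i(k)$) with $\mathbb E[|B(k)|^p]\le C(p)<\infty$ for some $p\ge2$. $\mathcal F_0=\{\emptyset,\Omega\}$, $\mathcal F_k=\sigma(B(1),\dots,B(k))$. $U_0,\dots,U_{N-1}$ are nonempty convex subsets of $\mathbb R^m$. An admissible control is $u=\{u(k)\}_{k\in\mathcal T}$ with $u(k)$ $\mathcal F_k$-measurable, $U_k$-valued, and $\mathbb E[\sum_{k=0}^{N-1}|u(k)|^q]<\infty$ with some (fixed) $q>2$; $\mathcal U$ is the set of admissible controls. Model uncertainty. $\Gamma$ is a locally compact Polish space with distance $\widetilde d$ and Borel $\sigma$-field $\mathcal B(\Gamma)$; $\Lambda$ is a set of probability measures on $(\Gamma,\mathcal B(\Gamma))$. For each $\gamma\in\Gamma$, $k\in\mathcal T$: $b_\gamma(k,\cdot,\cdot):\mathbb R^n\times U_k\to\mathbb R^n$, $\sigma_\gamma(k,\cdot,\cdot):\mathbb R^n\times U_k\to\mathbb R^{n\times d}$ (columns $\sigma^i_\gamma$), $f_\gamma(k,\cdot,\cdot):\mathbb R^n\times U_k\to\mathbb R$, $\phi_\gamma:\mathbb R^n\to\mathbb R$ are given continuous functions. $\partial_x,\partial_u$ denote Jacobians (row vectors for scalar functions; inside an inner product, $\partial_u\mathscr H$ is read as a vector in $\mathbb R^m$). State and cost.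 For $u\in\mathcal U$ and fixed $x_0\in\mathbb R^n$: $x_\gamma(0)=x_0$ and $$x_\gamma(k+1)=b_\gamma(k,x_\gamma(k),u(k))+\sigma_\gamma(k,x_\gamma(k),u(k))B(k+1),\quad k\in\mathcal T;$$ $y_\gamma(0)=\mathbb E\big[\sum_{k=0}^{N-1}f_\gamma(k,x_\gamma(k),u(k))+\phi_\gamma(x_\gamma(N))\big]$ and $J(u)=\sup_{\lambda\in\Lambda}\int_\Gamma y_\gamma(0)\,\lambda(d\gamma)$. Let $x^*_\gamma$, $y^*_\gamma(0)$ be the state and value associated with $u^*$. $\Lambda^{u^*}=\{\lambda\in\Lambda: J(u^* )=\int_\Gamma y^*_\gamma(0)\lambda(d\gamma)\}$. Assumptions. A modulus of continuity is a continuous, semiadditive (i.e. subadditive), nondecreasing $\psi:[0,\infty)\to[0,\infty)$ with $\psi(0)=0$. (H1) There is a constant $L>0$ such that for each $k\in\mathcal T$, $\gamma\in\Gamma$: $|b_\gamma(k,0,0)|+|\sigma_\gamma(k,0,0)|\le L$, and $b_\gamma(k,x,u),\sigma_\gamma(k,x,u)$ are continuously differentiable in $(x,u)$ with derivatives bounded by $L$. (H2) For each $k\in\mathcal T$, $\gamma\in\Gamma$: $f_\gamma(k,x,u),\phi_\gamma(x)$ are continuously differentiable in $(x,u)$ with derivatives bounded by $L(1+|x|+|u|)$, and $|f_\gamma(k,0,0)|\le L$. (H3) There is a modulus of continuity $\psi$ with $|\chi_\gamma(k,x,u)-\chi_\gamma(k,x',u')|\le\psi(|x-x'|+|u-u'|)$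 for all $k\in\mathcal T$, $x,x'\in\mathbb R^n$, $u,u'\in U_k$, $\gamma\in\Gamma$, where $\chi_\gamma$ is any of the derivatives in (H1), (H2). (H4) For each $R>0$ there is a modulus of continuity $\psi_R$ with $|\chi_\gamma(k,x,u)-\chi_{\gamma'}(k,x,u)|\le\psi_R(\widetilde d(\gamma,\gamma'))$ for all $k\in\mathcal T$, $|x|,|u|\le R$, $\gamma,\gamma'\in\Gamma$, where $\chi_\gamma$ is any of $b_\gamma,\sigma_\gamma,f_\gamma,\phi_\gamma$ and their derivatives in $(x,u)$. (H5) $\Lambda$ is a weakly compact and convex set of probability measures on $(\Gamma,\mathcal B(\Gamma))$. Adjoint equation. A superscript $*$ on a coefficient denotes evaluation along $u^*$: $b^*_\gamma(k)=b_\gamma(k,x^*_\gamma(k),u^*(k))$, $\phi^*_\gamma(N)=\phi_\gamma(x^*_\gamma(N))$, etc., similarly for derivatives. For each $\gamma$, $P_\gamma(k)\in\mathbb R^n$ and $Q_\gamma(k)\in\mathbb R^{n\times d}$ (columns $Q^i_\gamma(k)$), $k\in\mathcal T$, satisfy $$P_\gamma(N-1)=\mathbb E[(\partial_x\phi^*_\gamma(N))^\top\mid\mathcal F_{N-1}],\quad Q_\gamma(N-1)=\mathbb E[(\partial_x\phi^*_\gamma(N))^\top B(N)^\top\mid\mathcal F_{N-1}],$$ and for $k=0,\dots,N-2$, with $Z_\gamma(k+1)=(\partial_xb^*_\gamma(k+1))^\top P_\gamma(k+1)+\sum_{i=1}^d(\partial_x\sigma^{*,i}_\gamma(k+1))^\top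 Q^i_\gamma(k+1)+(\partial_xf^*_\gamma(k+1))^\top$, $$P_\gamma(k)=\mathbb E[Z_\gamma(k+1)\mid\mathcal F_k],\qquad Q_\gamma(k)=\mathbb E[Z_\gamma(k+1)B(k+1)^\top\mid\mathcal F_k].$$ Hamiltonian: for $k\in\mathcal T$, $$\mathscr H_\gamma(k,x,u,P_\gamma,Q_\gamma)=f_\gamma(k,x,u)+\langle P_\gamma,b_\gamma(k,x,u)\rangle+\sum_{i=1}^d\langle Q^i_\gamma,\sigma^i_\gamma(k,x,u)\rangle.$$ *)

(* Defs.v *)
From HB Require Import structures.
From mathcomp Require Import all_boot all_order all_algebra.
From mathcomp Require Import all_classical all_reals all_analysis.
From mathcomp Require Import ring.

Set Implicit Arguments.
Unset Strict Implicit.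
Unset Printing Implicit Defensive.

Import Order.TTheory GRing.Theory Num.Theory.
Import numFieldNormedType.Exports.

Local Open Scope classical_set_scope.
Local Open Scope ring_scope.

Section Euclidean.
Context {R : realType}.

(* The library norm on matrices is the maximum norm; this is the Euclidean
   (Frobenius) one. *)
Definition enorm {a b : nat} (A : 'M[R]_(a, b)) : R :=
  Num.sqrt (\sum_i \sum_j A i j ^+ 2).

Definition dot {a : nat} (x y : 'cV[R]_a) : R := \sum_i x i 0 * y i 0.

(* Borel measurability, stated entrywise. *)
Definition mx_measurable {dT : measure_display} (T : measurableType dT)
    {a b : nat} (X : T -> 'M[R]_(a, b)) : Prop :=
  forall i j, measurable_fun [set: T] (fun w => X w i j).

End Euclidean.

#[short(type="pmetricType")]
HB.structure Definition PointedMetric (R : numDomainType) :=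
  { T of Metric R T & Pointed T }.

Section ParameterSpace.
Context {R : realType}.

(* The topology is only required to be induced by some complete metric, which
   need not be the given distance [mdist]. *)
Definition polish (T : metricType R) : Prop :=
  (exists2 D : set T, countable D & dense D) /\
  (exists rho : T -> T -> R,
    [/\ forall x y, rho x y = 0 <-> x = y,
        forall x y, rho x y = rho y x,
        forall x y z, rho x z <= rho x y + rho y z,
        forall (x : T) (A : set T), nbhs x A <->
          exists2 e : R, 0 < e & [set y | rho x y < e] `<=` A &
        forall s : nat -> T,
          (forall e : R, 0 < e -> exists K : nat, forall i j,
            (K <= i)%N -> (K <= j)%N -> rho (s i) (s j) < e) ->
          exists l : T, s @ \oo --> l]).

Definition borel (T : pmetricType R) := g_sigma_algebraType (@open T).

Definition bounded_continuous (T : pmetricType R) (f : T -> R) : Prop :=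
  continuous f /\ exists M : R, forall x, `|f x| <= M.

Definition weak_eval (T : pmetricType R) (mu : probability (borel T) R) :
    {ptws {f : T -> R | bounded_continuous f} -> R} :=
  fun f => \int[mu]_x (sval f x).

(* The weak topology is the coarsest one making all the integrals of bounded
   continuous functions continuous. *)
Definition weakly_compact (T : pmetricType R)
    (Lam : set (probability (borel T) R)) : Prop :=
  compact (Lam : set (initial_topology (@weak_eval T))).

(* A library measure also takes (irrelevant) values on nonmeasurable sets, so
   the mixture is only identified on measurable sets. *)
Definition convex_probabilities {dT : measure_display} (T : measurableType dT)
    (Lam : set (probability T R)) : Prop :=
  forall (mu nu : probability T R) (t : R), Lam mu -> Lam nu -> 0 <= t <= 1 ->
    exists2 la : probability T R, Lam la & forall A : set T, measurable A ->
      la A = (t%:E * mu A + (1 - t)%:E * nu A)%E.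

End ParameterSpace.

Section Noise.
Context {R : realType} {dO : measure_display} {Omega : measurableType dO}.
Variable P : probability Omega R.

Definition coord_events {d : nat} (X : Omega -> 'cV[R]_d) : set (set Omega) :=
  \bigcup_(i in [set: 'I_d]) g_sigma_algebra_preimage (fun w => X w i 0).

(* A family generating F_k = sigma(B(1), ..., B(k)); it is empty for k = 0, so
   that F_0 is trivial. *)
Definition past {d : nat} (B : nat -> Omega -> 'cV[R]_d) (k : nat) :
    set (set Omega) :=
  \bigcup_(j in [set j | (1 <= j <= k)%N]) coord_events (B j).

Definition independent_noise {d : nat} (N : nat)
    (B : nat -> Omega -> 'cV[R]_d) : Prop :=
  forall (s : seq nat) (A : nat -> set Omega), uniq s ->
    (forall j, j \in s -> (1 <= j <= N)%N /\ <<s coord_events (B j) >> (A j)) ->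
    P (\big[setI/setT]_(j <- s) A j) = (\prod_(j <- s) P (A j))%E.

Definition noise {d : nat} (N : nat) (B : nat -> Omega -> 'cV[R]_d) : Prop :=
  [/\ forall k, (1 <= k <= N)%N -> mx_measurable (B k),
      independent_noise N B &
      exists p C : R, 2 <= p /\ forall k, (1 <= k <= N)%N ->
        ('E_P[fun w => (enorm (B k w) `^ p)%R] <= C%:E)%E].

(* [Y] is a version of the conditional expectation of [X] given the
   sigma-algebra generated by [G]. *)
Definition is_condexp (G : set (set Omega)) (X Y : Omega -> R) : Prop :=
  [/\ P.-integrable [set: Omega] (EFin \o X),
      P.-integrable [set: Omega] (EFin \o Y),
      measurable_fun [set: g_sigma_algebraType G]
        (Y : g_sigma_algebraType G -> R) &
      forall A, <<s G >> A ->
        (\int[P]_(w in A) (X w)%:E = \int[P]_(w in A) (Y w)%:E)%E].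

Definition is_condexp_mx {a b : nat} (G : set (set Omega))
    (X Y : Omega -> 'M[R]_(a, b)) : Prop :=
  forall i j, is_condexp G (fun w => X w i j) (fun w => Y w i j).

End Noise.

(* The coefficients for one parameter, with their Jacobians. The functions are
   total, but only the values for times k < N and controls in U_k are ever
   used. The Jacobians are part of the data because U_k may have empty
   interior, in which case the partial Jacobian in u relative to U_k is not
   determined by the function. *)
Record coeffs (R : realType) (n m d : nat) := Coeffs {
  cb : nat -> 'cV[R]_n -> 'cV[R]_m -> 'cV[R]_n;
  csigma : nat -> 'cV[R]_n -> 'cV[R]_m -> 'M[R]_(n, d);
  cf : nat -> 'cV[R]_n -> 'cV[R]_m -> R;
  cphi : 'cV[R]_n -> R;
  dxb : nat -> 'cV[R]_n -> 'cV[R]_m -> 'M[R]_(n, n);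
  dub : nat -> 'cV[R]_n -> 'cV[R]_m -> 'M[R]_(n, m);
  dxsigma : 'I_d -> nat -> 'cV[R]_n -> 'cV[R]_m -> 'M[R]_(n, n);
  dusigma : 'I_d -> nat -> 'cV[R]_n -> 'cV[R]_m -> 'M[R]_(n, m);
  dxf : nat -> 'cV[R]_n -> 'cV[R]_m -> 'rV[R]_n;
  duf : nat -> 'cV[R]_n -> 'cV[R]_m -> 'rV[R]_m;
  dxphi : 'cV[R]_n -> 'rV[R]_n
}.

Section Assumptions.
Context {R : realType} {n m d : nat}.

Definition dom (V : set 'cV[R]_m) : set ('cV[R]_n * 'cV[R]_m) :=
  [set z | V z.2].

(* [g] is continuously differentiable on R^n x V, with Jacobians [gx], [gu]
   (Frechet derivative relative to R^n x V). *)
Definition C1_on {l : nat} (V : set 'cV[R]_m)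
    (g : 'cV[R]_n -> 'cV[R]_m -> 'cV[R]_l)
    (gx : 'cV[R]_n -> 'cV[R]_m -> 'M[R]_(l, n))
    (gu : 'cV[R]_n -> 'cV[R]_m -> 'M[R]_(l, m)) : Prop :=
  [/\ forall z0 : 'cV[R]_n * 'cV[R]_m, dom V z0 ->
        forall eps : R, 0 < eps -> \forall z \near within (dom V) (nbhs z0),
          `|g z.1 z.2 - g z0.1 z0.2
            - (gx z0.1 z0.2 *m (z - z0).1 + gu z0.1 z0.2 *m (z - z0).2)|
          <= eps * `|z - z0|,
      {within dom V, continuous (fun z => gx z.1 z.2)} &
      {within dom V, continuous (fun z => gu z.1 z.2)}].

Definition modulus (psi : R -> R) : Prop :=
  [/\ {within [set t : R | 0 <= t], continuous psi},
      psi 0 = 0,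
      forall t, 0 <= t -> 0 <= psi t,
      forall s t, 0 <= s -> s <= t -> psi s <= psi t &
      forall s t, 0 <= s -> 0 <= t -> psi (s + t) <= psi s + psi t].

Definition modulus_xu {a b : nat} (V : set 'cV[R]_m) (psi : R -> R)
    (chi : 'cV[R]_n -> 'cV[R]_m -> 'M[R]_(a, b)) : Prop :=
  forall x x' u u', V u -> V u' ->
    enorm (chi x u - chi x' u') <= psi (enorm (x - x') + enorm (u - u')).

Variables (N : nat) (U : nat -> set 'cV[R]_m).
Variables (Gamma : pmetricType R) (c : Gamma -> coeffs R n m d).

(* A bound on the coefficients at (0, 0) only makes sense if 0 is in U_k. To
   cover the other case, the bound is required at (0, v) for some v in U_k; for
   v = 0 it reads |b(k,0,0)| + |sigma(k,0,0)| <= L. Same convention in [H2]. *)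
Definition H1 (L : R) : Prop := forall k, (k < N)%N ->
  (exists2 v, U k v & forall g,
     enorm (cb (c g) k 0 v) + enorm (csigma (c g) k 0 v)
       <= L * (1 + enorm v)) /\
  forall g,
    [/\ C1_on (U k) (cb (c g) k) (dxb (c g) k) (dub (c g) k),
        forall i, C1_on (U k) (fun x u => col i (csigma (c g) k x u))
                    (dxsigma (c g) i k) (dusigma (c g) i k),
        forall x u, U k u ->
          enorm (dxb (c g) k x u) <= L /\ enorm (dub (c g) k x u) <= L &
        forall i x u, U k u ->
          enorm (dxsigma (c g) i k x u) <= L /\
          enorm (dusigma (c g) i k x u) <= L].

Definition H2 (L : R) : Prop :=
  (forall k, (k < N)%N ->
    (exists2 v, U k v & forall g,
       `|cf (c g) k 0 v| <= L * (1 + enorm v) ^+ 2) /\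
    forall g,
      C1_on (U k) (fun x u => (cf (c g) k x u)%:M : 'cV[R]_1)
        (dxf (c g) k) (duf (c g) k) /\
      forall x u, U k u ->
        enorm (dxf (c g) k x u) <= L * (1 + enorm x + enorm u) /\
        enorm (duf (c g) k x u) <= L * (1 + enorm x + enorm u)) /\
  (forall g,
    [/\ forall x, is_diff x (cphi (c g)) (fun h => (dxphi (c g) x *m h) 0 0),
        continuous (dxphi (c g)) &
        forall x, enorm (dxphi (c g) x) <= L * (1 + enorm x)]).

Definition H3 : Prop := exists psi : R -> R, modulus psi /\
  (forall k g, (k < N)%N ->
    [/\ modulus_xu (U k) psi (dxb (c g) k),
        modulus_xu (U k) psi (dub (c g) k),
        forall i, modulus_xu (U k) psi (dxsigma (c g) i k) /\
                  modulus_xu (U k) psi (dusigma (c g) i k),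
        modulus_xu (U k) psi (dxf (c g) k) &
        modulus_xu (U k) psi (duf (c g) k)]) /\
  (forall g x x',
    enorm (dxphi (c g) x - dxphi (c g) x') <= psi (enorm (x - x'))).

Definition modulus_param {a b : nat} (V : set 'cV[R]_m) (r : R) (psi : R -> R)
    (chi : coeffs R n m d -> 'cV[R]_n -> 'cV[R]_m -> 'M[R]_(a, b)) : Prop :=
  forall g g' x u, V u -> enorm x <= r -> enorm u <= r ->
    enorm (chi (c g) x u - chi (c g') x u) <= psi (mdist g g').

Definition H4 : Prop := forall r : R, 0 < r ->
  exists psi : R -> R, modulus psi /\
  (forall k, (k < N)%N ->
    [/\ modulus_param (U k) r psi (fun e => cb e k),
        modulus_param (U k) r psi (fun e => csigma e k) &
        modulus_param (U k) r psi (fun e x u => (cf e k x u)%:M : 'M[R]_1)] /\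
    [/\ modulus_param (U k) r psi (fun e => dxb e k),
        modulus_param (U k) r psi (fun e => dub e k),
        forall i, modulus_param (U k) r psi (fun e => dxsigma e i k) /\
                  modulus_param (U k) r psi (fun e => dusigma e i k),
        modulus_param (U k) r psi (fun e => dxf e k) &
        modulus_param (U k) r psi (fun e => duf e k)]) /\
  (forall g g' x, enorm x <= r ->
    `|cphi (c g) x - cphi (c g') x| <= psi (mdist g g') /\
    enorm (dxphi (c g) x - dxphi (c g') x) <= psi (mdist g g')).

Definition H5 (Lam : set (probability (borel Gamma) R)) : Prop :=
  weakly_compact Lam /\ convex_probabilities Lam.

End Assumptions.

Section Hamiltonian.
Context {R : realType} {n m d : nat}.
Variable e : coeffs R n m d.

Definition hamiltonian (k : nat) (x : 'cV[R]_n) (u : 'cV[R]_m)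
    (p : 'cV[R]_n) (q : 'M[R]_(n, d)) : R :=
  cf e k x u + dot p (cb e k x u)
    + \sum_(i < d) dot (col i q) (col i (csigma e k x u)).

(* The gradients of the Hamiltonian in x and u; see [C1_on_hamiltonian]. *)
Definition dx_hamiltonian (k : nat) (x : 'cV[R]_n) (u : 'cV[R]_m)
    (p : 'cV[R]_n) (q : 'M[R]_(n, d)) : 'cV[R]_n :=
  (dxb e k x u)^T *m p + \sum_(i < d) (dxsigma e i k x u)^T *m col i q
    + (dxf e k x u)^T.

Definition du_hamiltonian (k : nat) (x : 'cV[R]_n) (u : 'cV[R]_m)
    (p : 'cV[R]_n) (q : 'M[R]_(n, d)) : 'cV[R]_m :=
  (dub e k x u)^T *m p + \sum_(i < d) (dusigma e i k x u)^T *m col i q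
    + (duf e k x u)^T.

End Hamiltonian.

Section HamiltonianC1.
Context {R : realType} {n m d : nat}.

Lemma mulmx_bounded {a b l : nat} (A : 'M[R]_(a, b)) :
  exists2 K : R, 0 < K & forall X : 'M[R]_(b, l), `|A *m X| <= K * `|X|.
Proof.
exists (1 + \sum_i \sum_j `|A i j|).
  by rewrite ltr_pwDl// sumr_ge0// => i _; rewrite sumr_ge0.
move=> X; have K0 : 0 <= 1 + \sum_i \sum_j `|A i j|.
  by rewrite addr_ge0// sumr_ge0// => i _; rewrite sumr_ge0.
rewrite [leLHS]mx_normrE; apply: bigmax_le => [|[i k] _ /=].
  by rewrite mulr_ge0.
rewrite mxE (le_trans (ler_norm_sum _ _ _))//.
apply: (@le_trans _ _ ((\sum_j `|A i j|) * `|X|)).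
  rewrite mulr_suml; apply: ler_sum => j _; rewrite normrM ler_wpM2l//.
  rewrite [leRHS]mx_normrE.
  exact: (@le_bigmax _ _ _ _ (fun ij : 'I_b * 'I_l => `|X ij.1 ij.2|) (j, k)).
rewrite ler_wpM2r// (bigD1 i)//= addrCA lerDl addr_ge0// sumr_ge0// => ? _.
by rewrite sumr_ge0.
Qed.

Lemma mulmx_continuous {a b l : nat} (A : 'M[R]_(a, b)) :
  continuous (fun X : 'M[R]_(b, l) => A *m X).
Proof.
have [K K0 AK] := @mulmx_bounded a b l A.
move=> X; apply/(@cvgrPdist_le _ _ _ _ (nbhs_filter X)) => e e0; near=> Y.
rewrite -mulmxBr (le_trans (AK _))// mulrC -ler_pdivlMr//.
near: Y; have eK : 0 < e / K by exact: divr_gt0.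
by apply: filterS (nbhsx_ballx X _ eK) => Y; rewrite -ball_normE => /ltW.
Unshelve. all: by end_near. Qed.

Variable V : set 'cV[R]_m.

Lemma C1_on_ext {l : nat} (g g' : _ -> _ -> 'cV[R]_l) gx gx' gu gu' :
  (forall x u, g x u = g' x u) -> (forall x u, gx x u = gx' x u) ->
  (forall x u, gu x u = gu' x u) ->
  @C1_on R n m l V g gx gu -> @C1_on R n m l V g' gx' gu'.
Proof.
move=> e1 e2 e3.
have -> : g' = g by apply/funext => x; apply/funext => u.
have -> : gx' = gx by apply/funext => x; apply/funext => u.
by have -> : gu' = gu by apply/funext => x; apply/funext => u.
Qed.

Lemma C1_on_mulmxl {l l' : nat} (A : 'M[R]_(l', l)) (g : _ -> _ -> 'cV[R]_l)
    gx gu : @C1_on R n m l V g gx gu ->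
  C1_on V (fun x u => A *m g x u) (fun x u => A *m gx x u)
    (fun x u => A *m gu x u).
Proof.
move=> [gd gxc guc]; split.
- move=> z0 Vz0 e e0; have [K K0 AK] := @mulmx_bounded l' l 1 A.
  have := gd z0 Vz0 (e / K) (divr_gt0 e0 K0); apply: filterS => z zP.
  rewrite -!mulmxA -!mulmxDr -!mulmxBr (le_trans (AK _))//.
  by rewrite mulrC -ler_pdivlMr// mulrAC.
- by move=> z; apply: (continuous_comp (gxc z)); exact: mulmx_continuous.
- by move=> z; apply: (continuous_comp (guc z)); exact: mulmx_continuous.
Qed.

Lemma C1_onD {l : nat} (g h : _ -> _ -> 'cV[R]_l) gx gu hx hu :
  @C1_on R n m l V g gx gu -> @C1_on R n m l V h hx hu ->
  C1_on V (fun x u => g x u + h x u) (fun x u => gx x u + hx x u)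
    (fun x u => gu x u + hu x u).
Proof.
move=> [gd gxc guc] [hd hxc huc]; split.
- move=> z0 Vz0 e e0; have e20 : 0 < e / 2 by rewrite divr_gt0.
  have := hd z0 Vz0 _ e20; have := gd z0 Vz0 _ e20.
  apply: filterS2 => z gz hz.
  rewrite [e]splitr mulrDl; apply: le_trans (lerD gz hz).
  apply: le_trans (ler_normD _ _); rewrite !mulmxDl le_eqVlt; apply/orP; left.
  apply/eqP; congr `|_|; apply/matrixP => i j; rewrite !mxE; ring.
- by move=> z; apply: cvgD; [exact: gxc | exact: hxc].
- by move=> z; apply: cvgD; [exact: guc | exact: huc].
Qed.

Lemma C1_on0 {l : nat} : @C1_on R n m l V (fun _ _ => 0) (fun _ _ => 0)
  (fun _ _ => 0).
Proof.
split=> [z0 _ e e0|z|z]; [|exact: cvg_cst|exact: cvg_cst].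
by apply: nearW => z; rewrite !mul0mx addr0 !subr0 normr0 mulr_ge0// ltW.
Qed.

Lemma C1_on_sum {l : nat} (I : Type) (s : seq I)
    (g : I -> _ -> _ -> 'cV[R]_l) gx gu :
  (forall i, @C1_on R n m l V (g i) (gx i) (gu i)) ->
  C1_on V (fun x u => \sum_(i <- s) g i x u) (fun x u => \sum_(i <- s) gx i x u)
    (fun x u => \sum_(i <- s) gu i x u).
Proof.
move=> gC; elim: s => [|i s ih].
  under eq_fun do under eq_fun do rewrite big_nil.
  under [X in C1_on _ _ X]eq_fun do under eq_fun do rewrite big_nil.
  under [X in C1_on _ _ _ X]eq_fun do under eq_fun do rewrite big_nil.
  exact: C1_on0.
under eq_fun do under eq_fun do rewrite big_cons.
under [X in C1_on _ _ X]eq_fun do under eq_fun do rewrite big_cons.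
under [X in C1_on _ _ _ X]eq_fun do under eq_fun do rewrite big_cons.
exact: C1_onD.
Qed.

Lemma dotE {a : nat} (x y : 'cV[R]_a) : (dot x y)%:M = x^T *m y.
Proof.
apply/matrixP => i j; rewrite !ord1 !mxE eqxx mulr1n.
by apply: eq_bigr => k _; rewrite mxE.
Qed.

Lemma C1_on_hamiltonian (e : coeffs R n m d) k p q :
  C1_on V (cb e k) (dxb e k) (dub e k) ->
  (forall i, C1_on V (fun x u => col i (csigma e k x u))
               (dxsigma e i k) (dusigma e i k)) ->
  C1_on V (fun x u => (cf e k x u)%:M : 'cV[R]_1) (dxf e k) (duf e k) ->
  C1_on V (fun x u => (hamiltonian e k x u p q)%:M : 'cV[R]_1)
    (fun x u => (dx_hamiltonian e k x u p q)^T)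
    (fun x u => (du_hamiltonian e k x u p q)^T).
Proof.
move=> Cb Cs Cf.
apply: (C1_on_ext _ _ _ (C1_onD Cf (C1_onD (C1_on_mulmxl p^T Cb)
  (C1_on_sum (index_enum 'I_d)
    (fun i => C1_on_mulmxl (col i q)^T (Cs i)))))) => x u.
- rewrite /hamiltonian -dotE; under eq_bigr => i _ do rewrite -dotE.
  by rewrite -(raddf_sum (@scalar_mx R 1)) -!(raddfD (@scalar_mx R 1)) addrA.
- rewrite /dx_hamiltonian !raddfD /= raddf_sum /= trmxK trmx_mul trmxK.
  rewrite addrC; congr (_ + _ + _).
  by apply: eq_bigr => i _; rewrite trmx_mul trmxK.
- rewrite /du_hamiltonian !raddfD /= raddf_sum /= trmxK trmx_mul trmxK.
  rewrite addrC; congr (_ + _ + _).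
  by apply: eq_bigr => i _; rewrite trmx_mul trmxK.
Qed.

End HamiltonianC1.

Section Control.
Context {R : realType} {dO : measure_display} {Omega : measurableType dO}.
Variables (P : probability Omega R) (N n m d : nat).
Variables (B : nat -> Omega -> 'cV[R]_d) (U : nat -> set 'cV[R]_m) (q : R).

Definition admissible (u : nat -> Omega -> 'cV[R]_m) : Prop :=
  [/\ forall k, (k < N)%N ->
        @mx_measurable R _ (g_sigma_algebraType (past B k)) _ _ (u k),
      forall k w, (k < N)%N -> U k (u k w) &
      ('E_P[fun w => (\sum_(k < N) enorm (u k w) `^ q)%R] < +oo)%E].

Fixpoint state (e : coeffs R n m d) (x0 : 'cV[R]_n)
    (u : nat -> Omega -> 'cV[R]_m) (k : nat) (w : Omega) : 'cV[R]_n :=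
  if k is j.+1 then
    let x := state e x0 u j w in
    cb e j x (u j w) + csigma e j x (u j w) *m B j.+1 w
  else x0.

Definition value (e : coeffs R n m d) (x0 : 'cV[R]_n)
    (u : nat -> Omega -> 'cV[R]_m) : \bar R :=
  ('E_P[fun w => (\sum_(k < N) cf e k (state e x0 u k w) (u k w)
                  + cphi e (state e x0 u N w))%R])%E.

Definition is_adjoint (e : coeffs R n m d) (x0 : 'cV[R]_n)
    (u : nat -> Omega -> 'cV[R]_m)
    (p : nat -> Omega -> 'cV[R]_n) (r : nat -> Omega -> 'M[R]_(n, d)) : Prop :=
  let x := state e x0 u in
  let terminal w := (dxphi e (x N w))^T in
  let Z k w := dx_hamiltonian e k (x k w) (u k w) (p k w) (r k w) in
  [/\ is_condexp_mx P (past B N.-1) terminal (p N.-1),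
      is_condexp_mx P (past B N.-1) (fun w => terminal w *m (B N w)^T)
        (r N.-1),
      forall k, (k.+1 < N)%N ->
        is_condexp_mx P (past B k) (Z k.+1) (p k) &
      forall k, (k.+1 < N)%N ->
        is_condexp_mx P (past B k) (fun w => Z k.+1 w *m (B k.+1 w)^T) (r k)].

Variables (Gamma : pmetricType R) (c : Gamma -> coeffs R n m d).
Variable Lam : set (probability (borel Gamma) R).

(* No integrability of the values in the parameter is assumed: the integral is
   the extended-real one of the library (positive part minus negative part). *)
Definition robust_value (x0 : 'cV[R]_n) (u : nat -> Omega -> 'cV[R]_m)
    (la : probability (borel Gamma) R) : \bar R :=
  (\int[la]_g value (c g) x0 u)%E.

Definition cost (x0 : 'cV[R]_n) (u : nat -> Omega -> 'cV[R]_m) : \bar R :=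
  ereal_sup [set robust_value x0 u la | la in Lam].

Definition worst_case (x0 : 'cV[R]_n) (u : nat -> Omega -> 'cV[R]_m) :
    set (probability (borel Gamma) R) :=
  [set la | Lam la /\ cost x0 u = robust_value x0 u la].

Definition optimal (x0 : 'cV[R]_n) (u : nat -> Omega -> 'cV[R]_m) : Prop :=
  admissible u /\ forall v, admissible v -> (cost x0 u <= cost x0 v)%E.

Definition H6 (p : Gamma -> nat -> Omega -> 'cV[R]_n)
    (r : Gamma -> nat -> Omega -> 'M[R]_(n, d)) : Prop :=
  forall g, convex_function [set: 'cV[R]_n] (cphi (c g)) /\
    forall k, (k < N)%N -> {ae P, forall w,
      convex_function (dom (U k))
        (fun z => hamiltonian (c g) k z.1 z.2 (p g k w) (r g k w))}.

End Control.

(* Main.v *)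
Require Import Defs.
From mathcomp Require Import all_boot all_order all_algebra.
From mathcomp Require Import all_classical all_reals all_analysis.
From mathcomp Require Import measurable_realfun.
From mathcomp Require Import ring lra zify.

(** Write x and x' for the states driven by the candidate u and by a
    competitor v, and y_g and y'_g for the corresponding values. The theorem
    follows from a lower bound of the cost gap that holds for every single
    parameter g, [value_gap]:

      y'_g - y_g >= sum_k E <d_u H_g(k), v(k) - u(k)>.

    To get it, let the costate Z(k) be the x-gradient of the Hamiltonian along
    u for k < N, and the gradient of the terminal cost for k = N. The adjoint
    equation says that P(k) and Q(k) are the conditional expectations of
    Z(k+1) and of Z(k+1) B(k+1)^T given F_k. The increments of b and sigma at
    time k are F_k-measurable, so they can be pulled out of the conditional
    expectation ([Rintegral_duality]): E <Z(k+1), x'(k+1) - x(k+1)> is the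
    mean increment of the part <P,b> + sum_i <Q^i,sigma^i> of the Hamiltonian.
    Adding the increment of f completes the Hamiltonian, and convexity bounds
    its increment below by <Z(k), x' - x> + <d_u H(k), v - u>. Summing over k
    telescopes the terms in Z; the first one vanishes since both states start
    at x_0, and the last one is below the terminal cost increment because phi_g
    is convex.

    It remains to see that the right-hand side has a nonnegative lamstar-mean.
    By Fubini it is the mean over Omega of <G(k), v(k) - u(k)>, where G(k) is
    the lamstar-mean of d_u H(k). The exceptional null set in the hypothesis
    depends on the test point; taking a countable dense set of test points
    gives one null set off which the inequality holds on all of U_k, hence for
    the random point v(k) ([variational_inequality_selection]). Then
    J(v) >= int y' dlamstar >= int y dlamstar = J(u).

    Two things make this rigorous. The first is integrability: the noise has
    only second moments, but B(k+1) is independent of F_k, so that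
    E [phi B(k+1)^2] <= C E [phi] for nonnegative F_k-measurable phi
    ([noise_L2_factor]). This keeps the states in L2 and, by duality, also
    makes E [X B(k+1) | F_k] square integrable as soon as X is
    ([condexp_L2]); hence P_g, Q_g and d_u H_g are bounded in L2 uniformly in
    g. The second is joint measurability in the parameter and the noise: the
    coefficients are jointly continuous and Gamma is separable, so evaluating
    them along measurable maps is measurable
    ([jointly_continuous_measurable]). The costs y_g themselves need not be
    lamstar-integrable, and [integral_le_gap] compares their extended
    integrals using only that the gap is integrable. *)

Set Implicit Arguments.
Unset Strict Implicit.
Unset Printing Implicit Defensive.

Import Order.TTheory GRing.Theory Num.Theory.
Import numFieldNormedType.Exports.

Local Open Scope classical_set_scope.
Local Open Scope ring_scope.

(** * Integration against a sub-sigma-algebra *)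

Section SubSigmaAlgebra.
Context {R : realType} {dO : measure_display} {Omega : measurableType dO}.
Variables (P : {measure set Omega -> \bar R}) (G : set (set Omega)).
Hypothesis Gm : G `<=` measurable.

Lemma sub_sigma_measurable A : <<s G >> A -> measurable A.
Proof.
by move=> GA; apply: (smallest_sub _ Gm) GA; exact: sigma_algebra_measurable.
Qed.

Lemma sub_sigma_measurable_fun {d'} {T : measurableType d'} (f : Omega -> T) :
  measurable_fun [set: g_sigma_algebraType G]
    (f : g_sigma_algebraType G -> T) ->
  measurable_fun [set: Omega] f.
Proof.
by move=> mf _ Y mY; apply: sub_sigma_measurable; exact: (mf measurableT Y mY).
Qed.

Import HBNNSimple.

(** Approximate [phi] from below by simple functions of the sub-sigma-algebra:
    on their level sets [f] and [g] have the same integrals. This is used both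
    for conditional expectations and, with a constant [g], for independence. *)
Lemma ge0_integralM_sub (f g phi : Omega -> R) :
  measurable_fun [set: Omega] f -> measurable_fun [set: Omega] g ->
  (forall w, 0 <= f w) -> (forall w, 0 <= g w) ->
  (forall A, <<s G >> A ->
    (\int[P]_(w in A) (f w)%:E = \int[P]_(w in A) (g w)%:E)%E) ->
  measurable_fun [set: g_sigma_algebraType G]
    (phi : g_sigma_algebraType G -> R) ->
  (forall w, 0 <= phi w) ->
  (\int[P]_w (f w * phi w)%:E = \int[P]_w (g w * phi w)%:E)%E.
Proof.
move=> mf mg f0 g0 fg mphi phi0.
have mphiE : measurable_fun [set: g_sigma_algebraType G]
    (fun w : g_sigma_algebraType G => (phi w)%:E).
  exact/measurable_EFinP.
pose h n : {nnsfun g_sigma_algebraType G >-> R} :=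
  nnsfun_approx measurableT mphiE n.
have hcvg w : EFin \o h ^~ w @ \oo --> (phi w)%:E.
  by apply: (cvg_nnsfun_approx measurableT mphiE) => // x _; rewrite lee_fin.
have hnd : nondecreasing_seq (fun n => h n : g_sigma_algebraType G -> R).
  exact: (nd_nnsfun_approx measurableT mphiE).
have hm n : measurable_fun [set: Omega] (h n : Omega -> R).
  by apply: (@sub_sigma_measurable_fun _ _ (h n)).
have intP (k : Omega -> R) : measurable_fun [set: Omega] k ->
    (forall w, 0 <= k w) ->
    (\int[P]_w (k w * h n w)%:E @[n --> \oo] --> \int[P]_w (k w * phi w)%:E)%E.
  move=> mk k0.
  have -> : (\int[P]_w (k w * phi w)%:E =
      \int[P]_w (limn (fun n => (k w * h n w)%:E)))%E.
    apply: eq_integral => w _; apply/esym/cvg_lim => //.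
    under eq_fun do rewrite EFinM; rewrite EFinM.
    by apply: cvgeZl => //; exact: hcvg.
  apply: (@cvg_monotone_convergence _ _ _ P setT measurableT
    (fun n w => (k w * h n w)%:E)).
  - by move=> n; apply/measurable_EFinP; exact: measurable_funM.
  - by move=> n w _; rewrite lee_fin mulr_ge0.
  - move=> w _ a b ab; rewrite lee_fin ler_wpM2l//.
    by move/hnd: ab => /lefP.
have simP n (k : Omega -> R) : measurable_fun [set: Omega] k ->
    (forall w, 0 <= k w) -> (\int[P]_w (k w * h n w)%:E =
      \sum_(y \in range (h n))
        (y%:E * \int[P]_(w in h n @^-1` [set y]) (k w)%:E))%E.
  move=> mk k0.
  have mhy y : measurable (h n @^-1` [set y] : set Omega).
    by rewrite -[X in measurable X]setTI; exact: hm.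
  transitivity (\int[P]_w \sum_(y \in range (h n))
      ((y * (k w * \1_(h n @^-1` [set y]) w))%:E))%E.
    apply: eq_integral => w _; rewrite fsumEFin//; congr EFin;
      rewrite [in LHS](fimfunE (h n)).
    rewrite fsbig_finite// mulr_sumr/= fsbig_finite//=.
    by apply: eq_bigr => y _; rewrite mulrCA.
  rewrite ge0_integral_fsum//=.
  - apply: eq_fsbigr => y; rewrite inE/= => -[w _ <-].
    under eq_integral do rewrite EFinM.
    rewrite ge0_integralZl//=; last 3 first.
    + apply/measurable_EFinP; apply: measurable_funM => //.
    + by move=> x _; rewrite lee_fin mulr_ge0.
    + by rewrite lee_fin.
    congr (_ * _)%E; rewrite [RHS]integral_mkcond; apply: eq_integral => x _.
    by rewrite patchE indicE; case: ifPn => _; rewrite ?mulr1 ?mulr0.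
  - move=> y; apply/measurable_EFinP; apply: measurable_funM => //.
    apply: measurable_funM => //.
  - move=> y w _; rewrite lee_fin; rewrite indicE; case: (boolP (w \in _)).
      by rewrite inE/= => <-; rewrite mulr1 mulr_ge0.
    by rewrite !mulr0.
have eqn n : (\int[P]_w (f w * h n w)%:E = \int[P]_w (g w * h n w)%:E)%E.
  rewrite !simP//; apply: eq_fsbigr => y _; congr (_ * _)%E; apply: fg.
  by rewrite -[X in <<s G >> X]setTI; exact: (@measurable_funP _ _ _ _ _ (h n)).
have cf := intP f mf f0; rewrite (funext eqn) in cf.
exact: (cvg_unique _ cf (intP g mg g0)).
Qed.

End SubSigmaAlgebra.

(** * Real-valued integrable functions *)

Section RealIntegrals.
Context {R : realType} {dT : measure_display} {T : measurableType dT}.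
Variable mu : {measure set T -> \bar R}.

Notation rintegrable f := (mu.-integrable [set: T] (EFin \o f)).

Lemma rintegrable_measurable (f : T -> R) : rintegrable f ->
  measurable_fun [set: T] f.
Proof. by move=> /measurable_int/measurable_EFinP. Qed.

Lemma rintegrable_dom (f g : T -> R) : measurable_fun [set: T] f ->
  rintegrable g ->
  (forall w, `|f w| <= g w) -> rintegrable f.
Proof.
move=> mf ig fg; apply: (le_integrable measurableT _ _ ig).
  exact/measurable_EFinP.
by move=> w _ /=; rewrite lee_fin (le_trans (fg w)) ?ler_norm.
Qed.

Lemma rintegrableD (f g : T -> R) : rintegrable f -> rintegrable g ->
  rintegrable (fun w => f w + g w).
Proof. by move=> mf mg; exact: (integrableD measurableT mf mg). Qed.

Lemma rintegrableB (f g : T -> R) : rintegrable f -> rintegrable g ->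
  rintegrable (fun w => f w - g w).
Proof. by move=> mf mg; exact: (integrableB measurableT mf mg). Qed.

Lemma rintegrableZ (k : R) (f : T -> R) : rintegrable f ->
  rintegrable (fun w => k * f w).
Proof. by move=> mf; exact: (integrableZl measurableT k mf). Qed.

Lemma rintegrable_abs (f : T -> R) : rintegrable f ->
  rintegrable (fun w => `|f w|).
Proof. by move=> mf; exact: (integrable_norm mf). Qed.

Lemma rintegrable0 : rintegrable (fun=> 0).
Proof. exact: integrable0. Qed.

Lemma rintegrable_sum (I : Type) (s : seq I) (f : I -> T -> R) :
  (forall i, rintegrable (f i)) -> rintegrable (fun w => \sum_(i <- s) f i w).
Proof.
move=> intf; elim: s => [|i s ih].
  by under eq_fun do rewrite big_nil; exact: rintegrable0.
by under eq_fun do rewrite big_cons; exact: rintegrableD.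
Qed.

Lemma EFin_Rintegral (f : T -> R) : rintegrable f ->
  (\int[mu]_w (f w)%:E = (\int[mu]_w f w)%:E)%E.
Proof. by move=> intf; rewrite /Rintegral fineK//;
  exact: integrable_fin_num. Qed.

Lemma Rintegral_sum (I : Type) (s : seq I) (f : I -> T -> R) :
  (forall i, rintegrable (f i)) ->
  \int[mu]_w (\sum_(i <- s) f i w) = \sum_(i <- s) \int[mu]_w f i w.
Proof.
move=> intf; elim: s => [|i s ih].
  under eq_Rintegral do rewrite big_nil.
  by rewrite big_nil /Rintegral integral0.
under eq_Rintegral do rewrite big_cons.
by rewrite big_cons RintegralD// ?ih//; exact: rintegrable_sum.
Qed.

Lemma le_Rintegral_ae (f g : T -> R) : rintegrable f -> rintegrable g ->
  {ae mu, forall w, f w <= g w} -> \int[mu]_w f w <= \int[mu]_w g w.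
Proof.
move=> intf intg fg.
have intd := rintegrableB intg intf.
have -> : \int[mu]_w g w = \int[mu]_w f w + \int[mu]_w `|g w - f w|.
  rewrite -RintegralD//; last exact: rintegrable_abs.
  congr fine; apply: ae_eq_integral => //.
  - exact: measurable_int intg.
  - exact: measurable_int (rintegrableD intf (rintegrable_abs intd)).
  - apply: filterS fg => w fgw _ /=.
    by rewrite ger0_norm ?subr_ge0// addrC subrK.
by rewrite lerDl Rintegral_ge0.
Qed.

End RealIntegrals.

(** * Conditional expectations *)

Section CondExp.
Context {R : realType} {dO : measure_display} {Omega : measurableType dO}.
Variables (P : probability Omega R) (G : set (set Omega)).
Hypothesis Gm : G `<=` measurable.

Notation rintegrable f := (P.-integrable [set: Omega] (EFin \o f)).
Notation Gmeas f := (measurable_fun [set: g_sigma_algebraType G]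
  (f : g_sigma_algebraType G -> R)).

(** The integrability of the product is all that is assumed on [Y], which may
    be unbounded. Splitting [W] and [Y] into nonnegative parts reduces this to
    [ge0_integralM_sub]. *)
Lemma Rintegral_orthogonal (W Y : Omega -> R) : rintegrable W ->
  (forall A, <<s G >> A -> (\int[P]_(w in A) (W w)%:E = 0)%E) ->
  Gmeas Y -> rintegrable (fun w => W w * Y w) -> \int[P]_w (W w * Y w) = 0.
Proof.
move=> iW W0 mY iWY.
have mW := rintegrable_measurable iW.
have mY' : measurable_fun [set: Omega] Y := sub_sigma_measurable_fun Gm mY.
(* Twice the positive and negative parts of [W]. *)
pose f w : R := `|W w| + W w; pose g w : R := `|W w| - W w.
have f0 w : 0 <= f w.
  by have := ler_norm (- W w); rewrite /f normrN; lra.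
have g0 w : 0 <= g w by rewrite /g subr_ge0; exact: ler_norm.
have iA := rintegrable_abs iW.
have iF : rintegrable f := rintegrableD iA iW.
have iG : rintegrable g := rintegrableB iA iW.
have fg A : <<s G >> A ->
    (\int[P]_(w in A) (f w)%:E = \int[P]_(w in A) (g w)%:E)%E.
  move=> GA; have mA := sub_sigma_measurable Gm GA.
  have rA (h : Omega -> R) : rintegrable h -> P.-integrable A (EFin \o h).
    exact: integrableS.
  rewrite /f /g; under eq_integral do rewrite EFinD.
  under [RHS]eq_integral do rewrite EFinB.
  rewrite (integralD mA (rA _ iA) (rA _ iW)) (integralB mA (rA _ iA) (rA _ iW)).
  by rewrite /= W0// adde0 sube0.
have key (h : Omega -> R) : Gmeas h -> (forall w, 0 <= h w) ->
    (forall w, `|h w| <= 2 * `|Y w|) ->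
    [/\ rintegrable (fun w => f w * h w), rintegrable (fun w => g w * h w) &
    \int[P]_w (f w * h w) = \int[P]_w (g w * h w)].
  move=> mh h0 hY; have mh' := sub_sigma_measurable_fun Gm mh.
  have i4 := rintegrableZ 4 (rintegrable_abs iWY).
  split.
  - apply: (rintegrable_dom _ i4).
      by apply: measurable_funM => //; exact: rintegrable_measurable iF.
    move=> w; rewrite !normrM.
    apply: (@le_trans _ _ (2 * `|W w| * (2 * `|Y w|))); last first.
      by rewrite mulrACA -natrM.
    apply: ler_pM => //;
      rewrite /f (le_trans (ler_normD _ _))// normr_id -mulr2n mulr_natl lexx//.
  - apply: (rintegrable_dom _ i4).
      by apply: measurable_funM => //; exact: rintegrable_measurable iG.
    move=> w; rewrite !normrM.
    apply: (@le_trans _ _ (2 * `|W w| * (2 * `|Y w|))); last first.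
      by rewrite mulrACA -natrM.
    apply: ler_pM => //;
      rewrite /g (le_trans (ler_normB _ _))// normr_id -mulr2n mulr_natl lexx//.
  - congr fine; apply: (ge0_integralM_sub Gm) => //;
      [exact: rintegrable_measurable iF|exact: rintegrable_measurable iG].
have mYa : Gmeas (fun w => `|Y w|) by exact: measurableT_comp.
have [|w|w|i1 i2 e1] := key (fun w => `|Y w| + Y w).
- exact: measurable_funD.
- by have := ler_norm (- Y w); rewrite normrN; lra.
- by rewrite (le_trans (ler_normD _ _))// normr_id -mulr2n mulr_natl lexx//.
have [|w|w|i3 i4 e2] := key (fun w => `|Y w| - Y w).
- exact: measurable_funB.
- by rewrite subr_ge0; exact: ler_norm.
- by rewrite (le_trans (ler_normB _ _))// normr_id -mulr2n mulr_natl lexx//.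
have : \int[P]_w (4 * (W w * Y w)) = 0.
  transitivity (\int[P]_w ((f w * (`|Y w| + Y w) - g w * (`|Y w| + Y w))
     - (f w * (`|Y w| - Y w) - g w * (`|Y w| - Y w)))).
    by apply: eq_Rintegral => w _; rewrite /f /g; ring.
  rewrite RintegralB//; [|exact: rintegrableB|exact: rintegrableB].
  by rewrite !RintegralB// e1 e2 !subrr.
by rewrite RintegralZl// => /eqP; rewrite mulf_eq0 pnatr_eq0 /= => /eqP.
Qed.

Lemma condexp_pull_out (X Z Y : Omega -> R) : is_condexp P G X Z -> Gmeas Y ->
  rintegrable (fun w => X w * Y w) -> rintegrable (fun w => Z w * Y w) ->
  \int[P]_w (X w * Y w) = \int[P]_w (Z w * Y w).
Proof.
move=> [iX iZ mZ XZ] mY iXY iZY; apply/eqP; rewrite -subr_eq0; apply/eqP.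
rewrite -RintegralB//.
under eq_Rintegral do rewrite -mulrBl.
apply: Rintegral_orthogonal => //.
- exact: rintegrableB.
- move=> A GA; have mA := sub_sigma_measurable Gm GA.
  have rA (h : Omega -> R) : rintegrable h -> P.-integrable A (EFin \o h).
    exact: integrableS.
  under eq_integral do rewrite EFinB.
  rewrite (integralB mA (rA _ iX) (rA _ iZ)) /= XZ// subee//.
  exact: integrable_fin_num (rA _ iZ).
- by under eq_fun do rewrite mulrBl; exact: rintegrableB.
Qed.

(** The only consequence of independence that is used below: a square
    integrable [b] independent of [G] satisfies this with [C] its second
    moment. The constant 1 satisfies it too, so that statements on
    conditional expectations of [X * b] cover those of [X]. *)
Definition L2_factor (b : Omega -> R) (C : R) :=
  measurable_fun [set: Omega] b /\
  forall phi : Omega -> R, Gmeas phi -> (forall w, 0 <= phi w) ->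
    (\int[P]_w (phi w * b w ^+ 2)%:E <= C%:E * \int[P]_w (phi w)%:E)%E.

Lemma L2_factor1 : L2_factor (fun=> 1) 1.
Proof.
split=> // phi _ _; rewrite mul1e; under eq_integral do rewrite expr1n mulr1.
exact: lexx.
Qed.

(** A conditional Cauchy-Schwarz inequality, obtained by duality. Testing [Y]
    against its own truncation [h n] gives E [h^2] = E [X b h], and
    2 X b h <= C X^2 + C^-1 b^2 h^2, where the factor property bounds the mean
    of the last term by E [h^2]. *)
Lemma condexp_L2 (X Y b : Omega -> R) (C K : R) : 0 < C ->
  measurable_fun [set: Omega] X ->
  (\int[P]_w (X w ^+ 2)%:E <= K%:E)%E -> L2_factor b C ->
  is_condexp P G (fun w => X w * b w) Y ->
  (\int[P]_w (Y w ^+ 2)%:E <= (C * K)%:E)%E.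
Proof.
move=> C0 mX XK [mb bC] cY.
have [iXb iY mY _] := cY.
have mY' : measurable_fun [set: Omega] Y := sub_sigma_measurable_fun Gm mY.
pose A n : set Omega := [set w | `|Y w| <= n%:R].
have mA n : <<s G >> (A n).
  have mYa : Gmeas (fun w => `|Y w|) by exact: measurableT_comp.
  have -> : A n = (fun w => `|Y w|) @^-1` [set` `]-oo, n%:R]].
    by apply/seteqP; split=> w /=; rewrite in_itv.
  rewrite -[X in <<s G >> X]setTI.
  exact: (mYa measurableT _ (measurable_itv _)).
pose h n w := Y w * \1_(A n) w.
have mh n : Gmeas (h n).
  by apply: measurable_funM => //; apply: measurable_indic; exact: mA.
have hn n w : `|h n w| <= n%:R.
  rewrite /h indicE; case: (boolP (w \in _)); first by rewrite inE /= mulr1.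
  by rewrite mulr0 normr0.
have mh' n := sub_sigma_measurable_fun Gm (mh n).
have hY n w : Y w * h n w = h n w ^+ 2.
  by rewrite /h indicE; case: (w \in _); rewrite ?mulr1 ?mulr0 -?expr2 ?expr0n.
have iYh n : rintegrable (fun w => Y w * h n w).
  apply: (rintegrable_dom _ (rintegrableZ n%:R (rintegrable_abs iY)));
    first exact: measurable_funM.
  by move=> w; rewrite normrM mulrC ler_wpM2r.
have iXh n : rintegrable (fun w => X w * b w * h n w).
  apply: (rintegrable_dom _ (rintegrableZ n%:R (rintegrable_abs iXb))).
    by apply: measurable_funM => //; exact: rintegrable_measurable iXb.
  by move=> w; rewrite normrM mulrC ler_wpM2r.
have iX2 : rintegrable (fun w => X w ^+ 2).
  apply/integrableP; split.
    by apply/measurable_EFinP; exact: measurable_funX.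
  apply: le_lt_trans (ltry K); apply: le_trans XK.
  apply: ge0_le_integral => //.
  - by apply: measurableT_comp => //; apply/measurable_EFinP;
      exact: measurable_funX.
  - by apply/measurable_EFinP; exact: measurable_funX.
  - by move=> w _; rewrite lee_fin ger0_norm// sqr_ge0.
have ih2 n : rintegrable (fun w => h n w ^+ 2).
  by have := iYh n; under eq_fun do rewrite hY.
have hb n : (\int[P]_w (h n w ^+ 2 * b w ^+ 2)%:E
    <= (C * \int[P]_w (h n w ^+ 2))%:E)%E.
  apply: le_trans (bC _ _ _) _; first exact: measurable_funX.
    by move=> w; rewrite sqr_ge0.
  by rewrite EFin_Rintegral.
have ihb n : rintegrable (fun w => h n w ^+ 2 * b w ^+ 2).
  have mm : measurable_fun [set: Omega] (fun w => h n w ^+ 2 * b w ^+ 2).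
    by apply: measurable_funM; exact: measurable_funX.
  apply/integrableP; split; first exact/measurable_EFinP.
  apply: le_lt_trans (ltry _); apply: le_trans (hb n).
  apply: ge0_le_integral => //.
  - by apply: measurableT_comp => //; exact/measurable_EFinP.
  - exact/measurable_EFinP.
  - by move=> w _; rewrite lee_fin ger0_norm// mulr_ge0 ?sqr_ge0.
have hK n : \int[P]_w (h n w ^+ 2) <= C * K.
  have XK' : \int[P]_w (X w ^+ 2) <= K by rewrite -lee_fin -EFin_Rintegral.
  have {}hb : \int[P]_w (h n w ^+ 2 * b w ^+ 2) <= C * \int[P]_w (h n w ^+ 2).
    by rewrite -lee_fin -EFin_Rintegral.
  have e1 : \int[P]_w (h n w ^+ 2) = \int[P]_w (X w * b w * h n w).
    rewrite (condexp_pull_out cY (mh n) (iXh n) (iYh n)).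
    by apply: eq_Rintegral => w _; rewrite hY.
  have : \int[P]_w (2 * (X w * b w * h n w)) <=
      \int[P]_w (C * X w ^+ 2 + C^-1 * (h n w ^+ 2 * b w ^+ 2)).
    apply: le_Rintegral => //.
    - exact: rintegrableZ.
    - by apply: rintegrableD; exact: rintegrableZ.
    - move=> w _; rewrite -subr_ge0.
      suff -> : C * X w ^+ 2 + C^-1 * (h n w ^+ 2 * b w ^+ 2)
          - 2 * (X w * b w * h n w) = C^-1 * (C * X w - b w * h n w) ^+ 2.
        by rewrite mulr_ge0 ?sqr_ge0// invr_ge0 ltW.
      by field; rewrite gt_eqF.
  rewrite RintegralD//; [|exact: rintegrableZ|exact: rintegrableZ].
  rewrite !RintegralZl// -e1 => le2.
  have : C^-1 * \int[P]_w (h n w ^+ 2 * b w ^+ 2) <= \int[P]_w (h n w ^+ 2).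
    by rewrite ler_pdivrMl.
  have : C * \int[P]_w (X w ^+ 2) <= C * K by rewrite ler_pM2l.
  lra.
have := @cvg_monotone_convergence _ _ _ P setT measurableT
  (fun n w => (h n w ^+ 2)%:E).
move=> /(_ _ _ _)/wrap[].
- by move=> n; apply/measurable_EFinP; exact: measurable_funX.
- by move=> n w _; rewrite lee_fin sqr_ge0.
- move=> w _ a c ac; rewrite lee_fin -!hY /h !indicE.
  case: (boolP (w \in A a)); last first.
    by rewrite !mulr0 mulrA -expr2 mulr_ge0 ?sqr_ge0.
  rewrite inE => wa; rewrite (_ : w \in A c)//.
  by rewrite inE; apply: le_trans wa _; rewrite ler_nat.
have -> : (\int[P]_w (limn (fun n => (h n w ^+ 2)%:E)) =
    \int[P]_w (Y w ^+ 2)%:E)%E.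
  apply: eq_integral => w _; apply: cvg_lim => //.
  apply: cvg_near_cst; near=> n; congr EFin; congr (_ ^+ 2).
  rewrite /h indicE (_ : w \in A n) ?mulr1//; rewrite inE /A /=.
  near: n; exact: nbhs_infty_ger.
move=> hc; apply: (cvge_le _ hc) => //.
by apply: nearW => n; rewrite EFin_Rintegral// lee_fin.
Unshelve. all: by end_near. Qed.

End CondExp.

(** * Independence of the noise from the past *)

Section NoiseFactor.
Context {R : realType} {dO : measure_display} {Omega : measurableType dO}.
Variables (P : probability Omega R) (N d : nat) (B : nat -> Omega -> 'cV[R]_d).

Lemma coord_events_sub (X : Omega -> 'cV[R]_d) : mx_measurable X ->
  coord_events X `<=` measurable.
Proof.
by move=> mX _ [i _ [Y mY <-]]; exact: (mX i 0 measurableT Y mY).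
Qed.

Lemma coord_events_measurable (X : Omega -> 'cV[R]_d) i :
  measurable_fun [set: g_sigma_algebraType (coord_events X)]
    ((fun w => X w i 0) : g_sigma_algebraType (coord_events X) -> R).
Proof. by move=> _ Y mY; apply: sub_sigma_algebra; exists i => //;
  exists Y. Qed.

Lemma past_mx_measurable j k : (1 <= j <= k)%N ->
  @mx_measurable R _ (g_sigma_algebraType (past B k)) _ _ (B j).
Proof.
move=> jk i l _ Y mY; rewrite (ord1 l); apply: sub_sigma_algebra.
by exists j => //; exists i => //; exists Y.
Qed.

Lemma past_mono j k : (j <= k)%N -> past B j `<=` past B k.
Proof.
move=> jk A [l /= /andP[l1 lj] Al]; exists l => //=.
by rewrite l1 (leq_trans lj).
Qed.

Lemma past_measurable_fun_mono j k (f : Omega -> R) : (j <= k)%N ->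
  measurable_fun [set: g_sigma_algebraType (past B j)]
    (f : g_sigma_algebraType (past B j) -> R) ->
  measurable_fun [set: g_sigma_algebraType (past B k)]
    (f : g_sigma_algebraType (past B k) -> R).
Proof.
move=> jk mf _ Y mY; have := mf measurableT Y mY.
by apply: sub_smallest2r; [exact: smallest_sigma_algebra|exact: past_mono].
Qed.

Hypothesis hB : noise P N B.

Lemma noise_mx_measurable k : (1 <= k <= N)%N -> mx_measurable (B k).
Proof. by have [+ _ _] := hB; apply. Qed.

Lemma past_sub k : (k <= N)%N -> past B k `<=` measurable.
Proof.
move=> kN A [j /= /andP[j1 jk]]; apply: coord_events_sub.
by apply: noise_mx_measurable; rewrite j1 (leq_trans jk).
Qed.

(** A pi-lambda argument: the finite intersections of events of the single
    noise variables generate the past, and for them the product rule is the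
    definition of independent noise. *)
Lemma past_indep k A C : (k < N)%N -> <<s past B k >> A ->
  <<s coord_events (B k.+1) >> C -> P (A `&` C) = (P A * P C)%E.
Proof.
move=> kN sA sC; have [mB indB _] := hB.
have mSj j X : (1 <= j <= N)%N -> <<s coord_events (B j) >> X -> measurable X.
  by move=> jN; apply: sub_sigma_measurable; apply: coord_events_sub; exact: mB.
have mC : measurable C by apply: (mSj k.+1).
pose s := iota 1 k.
have sN j : j \in s -> (1 <= j <= N)%N /\ j != k.+1.
  rewrite mem_iota add1n => /andP[j1 jk]; rewrite j1/=; split;
    last by rewrite ltn_eqF.
  by rewrite (leq_trans (ltnW jk)).
pose H : set (set Omega) := [set A | exists F : nat -> set Omega,
  (forall j, j \in s -> <<s coord_events (B j) >> (F j)) /\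
  A = \big[setI/setT]_(j <- s) F j].
have HT X : [set Y | H Y /\ Y `<=` setT] X <-> H X by split=> [[]//|HX]; split.
have mH X : H X -> measurable X.
  move=> [F [sF ->]]; rewrite big_seq; apply: big_ind => //.
    by move=> *; exact: measurableI.
  by move=> j js; have [jN _] := sN _ js; apply: mSj jN (sF _ js).
have PC0 : (0 <= fine (P C))%R by rewrite fine_ge0.
pose r := NngNum PC0.
have : mrestr P mC A = mscale r P A.
  apply: (g_sigma_algebra_measure_unique_trace H setT measurableT).
  - by move=> X /HT/mH.
  - move=> X Y /HT[F [sF ->]] /HT[F' [sF' ->]]; apply/HT.
    exists (fun j => F j `&` F' j); rewrite big_split; split=> // j js.
    by apply: (@measurableI _ (g_sigma_algebraType (coord_events (B j))));
      [exact: sF|exact: sF'].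
  - change (P (setT `&` C) = (fine (P C))%:E * P setT)%E.
    by rewrite setTI probability_setT mule1 fineK// fin_num_measure.
  - move=> X /HT[F [sF XE]]; 
    change (P (X `&` C) = (fine (P C))%:E * P X)%E.
    rewrite fineK ?fin_num_measure//.
    (* The events of the past together with [C] form one family of events of
       distinct noise variables, indexed by [k.+1 :: s]. *)
    pose F' j := if j == k.+1 then C else F j.
    have -> : X `&` C = \big[setI/setT]_(j <- k.+1 :: s) F' j.
      rewrite big_cons /F' eqxx setIC XE; congr (_ `&` _).
      by apply: eq_big_seq => j /sN[_ /negbTE ->].
    rewrite indB.
    + rewrite big_cons /F' eqxx; congr (_ * _)%E; rewrite XE.
      rewrite indB; first by apply: eq_big_seq => j /sN[_ /negbTE ->].
        exact: iota_uniq.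
      by move=> j js; have [jN _] := sN _ js; split=> //; exact: sF.
    + by rewrite /= iota_uniq andbT; apply/negP => /sN[_]; rewrite eqxx.
    + move=> j; rewrite inE => /orP[/eqP ->|js].
        by rewrite /F' eqxx.
      by have [jN /negbTE jk] := sN _ js; split=> //; rewrite /F' jk; exact: sF.
  - change (P (setT `&` C) < +oo)%E.
    by rewrite setTI -ge0_fin_numE// fin_num_measure.
  - by [].
  - have -> : [set X | H X /\ X `<=` [set: Omega]] = H.
      by apply/seteqP; split => X /HT.
    apply: sub_smallest2r sA; first exact: smallest_sigma_algebra.
    move=> X [j /= jk Xj].
    exists (fun l => if l == j then X else setT); split.
      move=> l _; case: eqVneq => [->|_]; first exact: sub_sigma_algebra.
      exact: (@measurableT _ (g_sigma_algebraType (coord_events (B l)))).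
    rewrite (bigD1_seq j) ?iota_uniq//=; last by rewrite mem_iota add1n ltnS.
    by rewrite eqxx big1 ?setIT// => l /negbTE ->.
by rewrite /mrestr /mscale /= fineK ?fin_num_measure// muleC.
Qed.

(** Used to get second moments from moments of order [p >= 2]. *)
Lemma sqr_le_powR (p x y : R) : 2 <= p -> 0 <= x -> x <= y ->
  x ^+ 2 <= 1 + y `^ p.
Proof.
move=> p2 x0 xy; have [x1|x1] := leP x 1.
  rewrite -[leLHS]addr0 lerD ?powR_ge0//.
  by rewrite expr_le1.
apply: (@le_trans _ _ (x `^ p)).
  rewrite -powR_mulrn//; apply: ler_powR => //; exact: ltW.
rewrite -[leLHS]add0r lerD//; apply: ge0_ler_powR; rewrite ?nnegrE//.
- exact: le_trans p2.
- exact: le_trans xy.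
Qed.

Lemma measurable_enorm_powR {a b : nat} (X : Omega -> 'M[R]_(a, b)) (p : R) :
  mx_measurable X -> measurable_fun [set: Omega] (fun w => enorm (X w) `^ p).
Proof.
move=> mX; apply: (@measurableT_comp _ _ _ _ _ _ (fun x : R => x `^ p)).
  exact: measurable_powR.
rewrite /enorm; apply: (@measurableT_comp _ _ _ _ _ _ (@Num.sqrt R)).
  by apply: continuous_measurable_fun; exact: sqrt_continuous.
apply: measurable_sum => i; apply: measurable_sum => j.
by apply: measurable_funX; exact: mX.
Qed.

Lemma entry_le_enorm a b (A : 'M[R]_(a, b)) i j : `|A i j| <= enorm A.
Proof.
rewrite /enorm -sqrtr_sqr ler_wsqrtr// (bigD1 i)//= (bigD1 j)//= -addrA lerDl.
by rewrite addr_ge0// sumr_ge0// => *; rewrite ?sqr_ge0// sumr_ge0// => *;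
  exact: sqr_ge0.
Qed.

Lemma noise_L2 k i : (1 <= k <= N)%N ->
  (\int[P]_w (B k w i 0 ^+ 2)%:E < +oo)%E.
Proof.
move=> kN; have [mB _ [p [C [p2 BC]]]] := hB.
have mBi : measurable_fun [set: Omega] (fun w => B k w i 0) by exact: mB.
have mpow : measurable_fun [set: Omega] (fun w => enorm (B k w) `^ p).
  by apply: measurable_enorm_powR; exact: mB.
apply: (@le_lt_trans _ _ (\int[P]_w ((1 + enorm (B k w) `^ p)%:E))%E).
  apply: ge0_le_integral => //.
  - by move=> w _; rewrite lee_fin sqr_ge0.
  - by apply/measurable_EFinP; exact: measurable_funX.
  - by apply/measurable_EFinP; exact: measurable_funD.
  - move=> w _; rewrite lee_fin -real_normK ?num_real//.
    by apply: sqr_le_powR => //; exact: entry_le_enorm.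
under eq_integral do rewrite EFinD.
rewrite ge0_integralD//; last 2 first.
- by move=> w _; rewrite lee_fin powR_ge0.
- exact/measurable_EFinP.
rewrite integral_cst//; apply: lte_add_pinfty;
  first by rewrite mul1e fin_num_fun_lty.
by apply: le_lt_trans (ltry C); have := BC k kN; rewrite unlock.
Qed.

(** Apply [ge0_integralM_sub] twice: over the sigma-algebra of the noise
    variable, to integrate B^2 over an event of the past, and then over the
    past itself. The constant is made positive because it is divided by
    later. *)
Lemma noise_L2_factor k i : (k < N)%N ->
  exists2 C : R, 0 < C & L2_factor P (past B k) (fun w => B k.+1 w i 0) C.
Proof.
move=> kN; have mB : mx_measurable (B k.+1) by exact: noise_mx_measurable.
have mBi : measurable_fun [set: Omega] (fun w => B k.+1 w i 0) by exact: mB.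
have mB2 : measurable_fun [set: Omega] (fun w => B k.+1 w i 0 ^+ 2).
  exact: measurable_funX.
set c := fine (\int[P]_w (B k.+1 w i 0 ^+ 2)%:E)%E.
have cE : (\int[P]_w (B k.+1 w i 0 ^+ 2)%:E)%E = c%:E.
  rewrite fineK// ge0_fin_numE; first exact: noise_L2.
  by apply: integral_ge0 => w _; rewrite lee_fin sqr_ge0.
have c0 : 0 <= c.
  by rewrite fine_ge0// integral_ge0// => w _; rewrite lee_fin sqr_ge0.
exists (c + 1); first by rewrite ltr_wpDl.
split=> // phi mphi phi0.
have mphi' := sub_sigma_measurable_fun (past_sub (ltnW kN)) mphi.
have -> : (\int[P]_w (phi w * B k.+1 w i 0 ^+ 2)%:E =
    c%:E * \int[P]_w (phi w)%:E)%E.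
  transitivity (\int[P]_w (B k.+1 w i 0 ^+ 2 * phi w)%:E)%E.
    by apply: eq_integral => w _; rewrite mulrC.
  rewrite (@ge0_integralM_sub _ _ _ P _ (past_sub (ltnW kN)) _ (fun=> c))//.
  - under eq_integral do rewrite EFinM.
    apply: ge0_integralZl => //; first exact/measurable_EFinP.
    by move=> w _; rewrite lee_fin.
  - by move=> w; exact: sqr_ge0.
  - move=> A sA; have mA := sub_sigma_measurable (past_sub (ltnW kN)) sA.
    rewrite integral_cst// integral_mkcond.
    transitivity (\int[P]_w (\1_A w * B k.+1 w i 0 ^+ 2)%:E)%E.
      apply: eq_integral => w _; rewrite patchE indicE.
      by case: (w \in A); rewrite ?mul1r ?mul0r.
    rewrite (@ge0_integralM_sub _ _ _ P _ (coord_events_sub mB) _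
       (fun=> fine (P A)))//.
    + under eq_integral do rewrite EFinM.
      rewrite ge0_integralZl//.
      * by rewrite cE fineK ?fin_num_measure// muleC.
      * exact/measurable_EFinP.
      * by move=> w _; rewrite lee_fin sqr_ge0.
      * by rewrite lee_fin fine_ge0.
    + by move=> w; rewrite fine_ge0.
    + move=> C sC; have mC := sub_sigma_measurable (coord_events_sub mB) sC.
      rewrite integral_indic// integral_cst//= (past_indep kN)//.
      by rewrite fineK// fin_num_measure.
    + by apply: measurable_funX; exact: coord_events_measurable.
    + by move=> w; exact: sqr_ge0.
by rewrite lee_wpmul2r ?lee_fin ?lerDl// integral_ge0// => w _; rewrite lee_fin.
Qed.

End NoiseFactor.

(** * Measurability of jointly continuous functions *)

Section JointMeasurability.
Context {R : realType} {n m : nat} {Gamma : pmetricType R}.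

(** The balls are replaced by their interiors because the Borel sets are
    generated by the open ones. *)
Lemma dense_sequence : (exists2 D : set Gamma, countable D & dense D) ->
  exists s : nat -> Gamma, forall (g : Gamma) (e : R), 0 < e ->
    exists i, (ball (s i) e)^° g.
Proof.
move=> [D /countable_injP[f injf] dD].
exists (fun i => if pselect (exists g, D g /\ f g = i) is left H
  then sval (cid H) else point) => g e e0.
have e20 : 0 < e / 2 by rewrite divr_gt0.
have [||y [yg Dy]] := dD (ball g (e / 2))^°.
- by exists g; apply: nbhsx_ballx.
- exact: open_interior.
exists (f y); case: pselect => [H|]; last by case; exists y.
have [Ds fs] := svalP (cid H).
have -> : sval (cid H) = y by apply: injf => //; rewrite inE.
have yg' := interior_subset yg.
apply: filterS (nbhsx_ballx g _ e20) => z gz.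
by rewrite [e]splitr; apply: ball_triangle gz; exact: ball_sym.
Qed.

Lemma mx_ballP {a b : nat} (x y : 'M[R]_(a, b)) (e : R) : 0 < e ->
  ball x e y <-> forall i j, `|x i j - y i j| < e.
Proof. by move=> e0; split=> [[_ H] i j|H]; [exact: H|split]. Qed.

Lemma rat_vector_ball {a : nat} (x : 'cV[R]_a) (e : R) : 0 < e ->
  exists r : 'cV[rat]_a, ball (map_mx ratr r : 'cV[R]_a) e x.
Proof.
move=> e0.
have /choice[q qx] i : exists q : rat, `|ratr q - x i 0| < e.
  have [|q] := @rat_in_itvoo R (x i 0) (x i 0 + e); first by rewrite ltrDl.
  rewrite in_itv /= => /andP[q1 q2]; exists q.
  by rewrite ger0_norm ?subr_ge0 ?ltW// ltrBlDl.
exists (\col_i q i); apply/mx_ballP => // i j.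
by rewrite (ord1 j) !mxE.
Qed.

(** Continuity on Gamma x R^n x V, relative to this set. *)
Definition jointly_continuous (V : set 'cV[R]_m)
    (h : Gamma -> 'cV[R]_n -> 'cV[R]_m -> R) :=
  forall g x u, V u -> forall e : R, 0 < e -> exists2 delta : R, 0 < delta &
    forall g' x' u', V u' -> ball g delta g' -> ball x delta x' ->
      ball u delta u' -> `|h g' x' u' - h g x u| < e.

Lemma measurable_mx_ball {dT : measure_display} {T : measurableType dT}
    {a b : nat} (X : T -> 'M[R]_(a, b)) (r : 'M[R]_(a, b)) (e : R) : 0 < e ->
  mx_measurable X -> measurable [set t | ball r e (X t)].
Proof.
move=> e0 mX.
have -> : [set t | ball r e (X t)] =
    \bigcap_(ij in [set: 'I_a * 'I_b])
      [set t | `|r ij.1 ij.2 - X t ij.1 ij.2| < e].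
  apply/seteqP; split=> t /= => [/(mx_ballP _ _ e0) H [i j] _ /=//|H].
  by apply/mx_ballP => // i j; exact: (H (i, j)).
apply: fin_bigcap_measurable; first exact: finite_finset.
move=> [i j] _ /=.
have mf : measurable_fun [set: T] (fun t => `|r i j - X t i j|).
  by apply: measurableT_comp => //; apply: measurable_funB => //; exact: mX.
have -> : [set t | `|r i j - X t i j| < e] =
    [set: T] `&` (fun t => `|r i j - X t i j|) @^-1` [set` `]-oo, e[].
  by rewrite setTI; apply/seteqP; split=> t /=; rewrite in_itv.
exact: mf.
Qed.

(** The set where the composition exceeds [a] is the union, over countably
    many product balls with dense centres in which [h] exceeds [a] for all
    controls in [V], of the events that the argument falls in the ball. The
    centres of the control balls may lie outside [V]. *)
Lemma jointly_continuous_measurable {dT : measure_display}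
    {T : measurableType dT} (V : set 'cV[R]_m) h (g : T -> borel Gamma)
    (X : T -> 'cV[R]_n) (u : T -> 'cV[R]_m) :
  (exists2 D : set Gamma, countable D & dense D) ->
  jointly_continuous V h -> measurable_fun [set: T] g ->
  mx_measurable X -> mx_measurable u -> (forall t, V (u t)) ->
  measurable_fun [set: T] (fun t => h (g t) (X t) (u t)).
Proof.
move=> /dense_sequence[s sD] hc mg mX mu Vu.
apply: (measurability _ (RGenOInfty.measurableE R)) => _ [_ [a ->] <-].
rewrite setTI.
pose I := (nat * 'cV[rat]_n * 'cV[rat]_m * nat)%type.
pose F (i : I) : set T := [set t |
  [/\ (ball (s i.1.1.1) i.2.+1%:R^-1)^° (g t : Gamma),
      ball (map_mx ratr i.1.1.2 : 'cV[R]_n) i.2.+1%:R^-1 (X t) &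
      ball (map_mx ratr i.1.2 : 'cV[R]_m) i.2.+1%:R^-1 (u t)] /\
  (forall g' x' u', V u' -> ball (s i.1.1.1) i.2.+1%:R^-1 g' ->
     ball (map_mx ratr i.1.1.2 : 'cV[R]_n) i.2.+1%:R^-1 x' ->
     ball (map_mx ratr i.1.2 : 'cV[R]_m) i.2.+1%:R^-1 u' -> a < h g' x' u')].
have -> : (fun t => h (g t) (X t) (u t)) @^-1` [set x | x \in `]a, +oo[] =
    \bigcup_i F i.
  apply/seteqP; split=> t; rewrite /= in_itv /= andbT; last first.
    by move=> [i _ [[gi xi ui]]]; apply => //; exact: interior_subset gi.
  move=> at_; have hp : 0 < h (g t) (X t) (u t) - a by rewrite subr_gt0.
  have [delta d0 hd] := hc (g t) (X t) (u t) (Vu t) _ hp.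
  have d20 : 0 < delta / 2 by rewrite divr_gt0.
  have [k kd] : exists k : nat, k.+1%:R^-1 < delta / 2.
    by have [k _ H] := near_infty_natSinv_lt (PosNum d20); exists k; apply: H =>
      /=.
  have k0 : 0 < k.+1%:R^-1 :> R by rewrite invr_gt0.
  have [i gi] := sD (g t) _ k0.
  have [r xr] := rat_vector_ball (X t) k0.
  have [q uq] := rat_vector_ball (u t) k0.
  exists (i, r, q, k) => //; split=> //= g' x' u' Vu' g'i x'r u'q.
  have dd : k.+1%:R^-1 + k.+1%:R^-1 <= delta.
    by rewrite [delta]splitr lerD// ltW.
  have := hd g' x' u' Vu' _ _ _.
  rewrite ltr_norml => /(_ _ _ _)/wrap[].
  - apply: le_ball dd _ _; apply: ball_triangle g'i; apply: ball_sym.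
    exact: interior_subset gi.
  - by apply: le_ball dd _ _; apply: ball_triangle x'r; exact: ball_sym.
  - by apply: le_ball dd _ _; apply: ball_triangle u'q; exact: ball_sym.
  by move=> /andP[+ _]; lra.
apply: countable_bigcupT_measurable; first exact: countableP.
move=> [[[i r] q] k]; rewrite /F /=.
set Q := forall g', _.
have k0 : 0 < k.+1%:R^-1 :> R by rewrite invr_gt0.
have [HQ|nQ] := pselect Q; last first.
  rewrite [X in measurable X](_ : _ = set0)//.
  by apply/seteqP; split=> t //= [].
rewrite [X in measurable X](_ : _ = (g @^-1` (ball (s i) k.+1%:R^-1)^°) `&`
  ([set t | ball (map_mx ratr r : 'cV[R]_n) k.+1%:R^-1 (X t)] `&`
   [set t | ball (map_mx ratr q : 'cV[R]_m) k.+1%:R^-1 (u t)])); last first.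
  by apply/seteqP; split=> t /= => [[[]]|[? []]].
apply: measurableI; last by apply: measurableI; exact: measurable_mx_ball.
rewrite -[X in measurable X]setTI; apply: mg => //.
by apply: sub_sigma_algebra; exact: open_interior.
Qed.

End JointMeasurability.

(** * Relative derivatives on convex sets *)

Section Calculus.
Context {R : realType} {n m : nat}.
Variable V : set 'cV[R]_m.

Definition convex_controls := forall u0 u1 t, V u0 -> V u1 -> 0 <= t <= 1 ->
  V (u0 + t *: (u1 - u0)).

Lemma convex_set_segment : convex_set V -> convex_controls.
Proof.
move=> cV u0 u1 t V0 V1 /andP[t0 t1].
have : t *: u1 + (1 - t) *: u0 \in V.
  by apply: (cV u1 u0 (Itv01 t0 t1)); rewrite inE.
by rewrite inE scalerBl scale1r scalerBr addrCA.
Qed.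

Lemma mulmx_addl_entry {a : nat} (A : 'M[R]_(a, n)) (C : 'M[R]_(a, m))
  (x : 'cV_n) (u : 'cV_m) i s :
  (A *m (s *: x) + C *m (s *: u)) i 0 = s * (A *m x + C *m u) i 0.
Proof. by rewrite -!scalemxAr -scalerDr mxE. Qed.

Lemma entry_le_norm {a b : nat} (A : 'M[R]_(a, b)) i j : `|A i j| <= `|A|.
Proof.
rewrite [leRHS]mx_normrE.
exact: (@le_bigmax _ _ _ _ (fun ij : 'I_a * 'I_b => `|A ij.1 ij.2|) (i, j)).
Qed.

(** The derivative along a segment, in the form of a one-dimensional
    first-order expansion; only the points of the segment with controls in
    [V] are seen. *)
Lemma C1_on_line {l : nat} (g : _ -> _ -> 'cV[R]_l) gx gu x u dx du i (e : R) :
  @C1_on R n m l V g gx gu -> V u -> 0 < e ->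
  exists2 delta : R, 0 < delta & forall s, `|s| < delta -> V (u + s *: du) ->
    `|g (x + s *: dx) (u + s *: du) i 0 - g x u i 0
      - s * (gx x u *m dx + gu x u *m du) i 0| <= e * `|s|.
Proof.
move=> [gd _ _] Vu e0; pose M : R := 1 + `|dx| + `|du|.
have M0 : 0 < M by rewrite /M -addrA ltr_pwDl// addr_ge0.
have eM : 0 < e / M by exact: divr_gt0.
have := gd (x, u) Vu _ eM; rewrite near_withinE => /nbhs_ballP[delta d0 H].
exists (delta / M); first exact: divr_gt0.
move=> s sd Vs.
have sM : `|s| * M < delta by rewrite -ltr_pdivlMr.
have nx : `|s *: dx| <= `|s| * M.
  by rewrite normrZ ler_wpM2l// /M addrAC lerDr addr_ge0.
have nu : `|s *: du| <= `|s| * M.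
  by rewrite normrZ ler_wpM2l// /M lerDr addr_ge0.
have /H /(_ Vs) : ball (x, u) delta (x + s *: dx, u + s *: du).
  split; rewrite -ball_normE /ball_ /= opprD addrA subrr sub0r normrN.
    exact: le_lt_trans sM.
  exact: le_lt_trans sM.
have -> : (x + s *: dx, u + s *: du) - (x, u) = (s *: dx, s *: du).
  by congr pair => /=; rewrite addrAC subrr add0r.
move=> /= {}H.
rewrite -mulmx_addl_entry.
apply: (@le_trans _ _ (e / M * `|(s *: dx, s *: du)|)).
  apply: le_trans H; apply: le_trans (entry_le_norm _ i 0).
  by rewrite !mxE.
rewrite prod_normE /= -mulrA; apply: ler_wpM2l; first exact: ltW.
by rewrite ler_pdivrMl// mulrC ge_max nx nu.
Qed.

(** The mean value theorem on the segment. The relative derivative determines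
    a genuine one at inner points, since the segment stays in [V]. *)
Lemma C1_on_mean_value {l : nat} (g : _ -> _ -> 'cV[R]_l) gx gu x0 u0 x1 u1 i :
  convex_controls -> @C1_on R n m l V g gx gu -> V u0 -> V u1 ->
  exists2 t : R, 0 <= t <= 1 &
    let x := x0 + t *: (x1 - x0) in let u := u0 + t *: (u1 - u0) in
    g x1 u1 i 0 - g x0 u0 i 0 =
      (gx x u *m (x1 - x0) + gu x u *m (u1 - u0)) i 0.
Proof.
move=> cV gC V0 V1; set dx := x1 - x0; set du := u1 - u0.
pose xt t := x0 + t *: dx; pose ut t := u0 + t *: du.
have Vt t : 0 <= t <= 1 -> V (ut t) by exact: cV.
pose F t := g (xt t) (ut t) i 0.
pose dF t := (gx (xt t) (ut t) *m dx + gu (xt t) (ut t) *m du) i 0.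
have key t e : 0 <= t <= 1 -> 0 < e -> exists2 delta : R, 0 < delta &
    forall s, `|s| < delta -> 0 <= t + s <= 1 ->
      `|F (t + s) - F t - s * dF t| <= e * `|s|.
  move=> t01 e0.
  have [delta d0 H] := C1_on_line (xt t) dx du i gC (Vt t t01) e0.
  exists delta => // s sd ts; have := H s sd.
  rewrite /F /dF /xt /ut !scalerDl !addrA; apply.
  by have := Vt _ ts; rewrite /ut scalerDl addrA.
have := @MVT R F dF 0 1 ltr01.
have -> : F 1 - F 0 = g x1 u1 i 0 - g x0 u0 i 0.
  by rewrite /F /xt /ut !scale1r !scale0r !addr0 /dx /du !subrKC.
case.
- move=> t; rewrite in_itv /= => /andP[t0 t1].
  have t01 : 0 <= t <= 1 by rewrite !ltW.
  suff H : h^-1 *: ((F \o shift t) (h *: (1 : R)) - F t) @[h --> 0^'] --> dF t.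
    by apply: DeriveDef; [apply/cvg_ex; exists (dF t)|apply: cvg_lim].
  apply/cvgrPdist_le => e e0; have [delta d0 H] := key t e t01 e0.
  have m0 : 0 < Num.min delta (Num.min t (1 - t)).
    by rewrite !lt_min d0 t0 subr_gt0.
  near=> h.
  have h0 : h != 0 by near: h; exact: nbhs_dnbhs_neq.
  have : `|h| < Num.min delta (Num.min t (1 - t)) by near: h; exact: dnbhs0_lt.
  rewrite !lt_min => /and3P[hd ht h1].
  have := H h hd.
  rewrite /= [h *: 1]mulr1 [h + t]addrC /GRing.scale /=.
  have -> : 0 <= t + h <= 1.
    by move: ht h1; rewrite !ltr_norml => /andP[? ?] /andP[? ?]; apply/andP;
      lra.
  move=> /(_ isT) Hh.
  rewrite -(ler_pM2r (_ : 0 < `|h|)) ?normr_gt0// -normrM.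
  rewrite distrC in Hh; apply: le_trans Hh; rewrite le_eqVlt; apply/orP; left.
  by apply/eqP; congr `|_|; field.
- apply/subspace_continuousP => t /=; rewrite in_itv /= => t01.
  apply/cvgrPdist_le => e e0.
  have [delta d0 H] := key t 1 t01 ltr01.
  (* The expansion with error constant 1 makes [F] Lipschitz at [t], with
     constant 1 + |dF t|. *)
  pose r := Num.min delta (e / (1 + `|dF t|)).
  have D0 : 0 < 1 + `|dF t| by rewrite ltr_pwDl.
  have r0 : 0 < r by rewrite lt_min d0 divr_gt0.
  rewrite near_withinE; near=> s => /=; rewrite in_itv /= => s01.
  have : `|s - t| < r.
    rewrite distrC; near: s.
    by have := nbhsx_ballx t _ r0; rewrite -ball_normE.
  rewrite lt_min => /andP[sd se].
  have := H (s - t) sd; rewrite addrC subrK => /(_ s01).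
  rewrite mul1r => Hs; rewrite distrC.
  have -> : F s - F t = (F s - F t - (s - t) * dF t) + (s - t) * dF t.
    by rewrite subrK.
  apply: le_trans (ler_normD _ _) _; rewrite normrM.
  apply: (@le_trans _ _ (`|s - t| * (1 + `|dF t|))).
    by rewrite mulrDr mulr1 lerD.
  by rewrite -ler_pdivlMr// ltW.
move=> t; rewrite in_itv /= subr0 mulr1 => /andP[t0 t1] ->.
by exists t => //; rewrite !ltW.
Unshelve. all: by end_near. Qed.

(** Convexity bounds the difference quotient at step [s] by the increment over
    the whole segment; let [s] tend to 0. *)
Lemma convex_gradient_le (f : 'cV[R]_n -> 'cV[R]_m -> R) fx fu x0 u0 x1 u1 :
  convex_controls -> @C1_on R n m 1 V (fun x u => (f x u)%:M) fx fu ->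
  convex_function (dom V) (fun z : 'cV[R]_n * 'cV[R]_m => f z.1 z.2) ->
  V u0 -> V u1 ->
  (fx x0 u0 *m (x1 - x0) + fu x0 u0 *m (u1 - u0)) 0 0 <= f x1 u1 - f x0 u0.
Proof.
move=> cV fC fconv V0 V1; set D := (X in X <= _).
apply/ler_addgt0Pr => e e0.
have [delta d0 H] := C1_on_line x0 (x1 - x0) (u1 - u0) 0 fC V0 e0.
pose s : R := Num.min (delta / 2) 1.
have d20 : 0 < delta / 2 by rewrite divr_gt0.
have s0 : 0 < s by rewrite lt_min d20 ltr01.
have s1 : s <= 1 by rewrite ge_min lexx orbT.
have sd : s < delta.
  rewrite (@le_lt_trans _ _ (delta / 2))// ?ge_min ?lexx//; lra.
have := H s; rewrite gtr0_norm// => /(_ sd).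
have Vs : V (u0 + s *: (u1 - u0)) by apply: cV => //; rewrite ltW.
move=> /(_ Vs); rewrite -/D !mxE eqxx !mulr1n => {}H.
have e1 (a : nat) (y0 y1 : 'cV[R]_a) :
    s *: y1 + (1 - s) *: y0 = y0 + s *: (y1 - y0).
  by rewrite scalerBl scale1r scalerBr addrCA.
have : f (s *: x1 + (1 - s) *: x0) (s *: u1 + (1 - s) *: u0)
    <= s * f x1 u1 + (1 - s) * f x0 u0.
  by apply: (fconv (Itv01 (ltW s0) s1) (x1, u1) (x0, u0)); rewrite inE.
rewrite !e1 => fs.
have : s * D <= s * (f x1 u1 - f x0 u0 + e).
  by move: H; rewrite ler_norml => /andP[]; lra.
by rewrite ler_pM2l.
Qed.

(** A function of the state alone is treated as a function of state and
    control, so that the results on relative derivatives apply to the terminal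
    cost. *)
Lemma C1_on_state (f : 'cV[R]_n -> R) (fx : 'cV[R]_n -> 'rV[R]_n) :
  (forall x, is_diff x f (fun h => (fx x *m h) 0 0)) -> continuous fx ->
  @C1_on R n m 1 setT (fun x _ => (f x)%:M) (fun x _ => fx x) (fun _ _ => 0).
Proof.
move=> df cfx; split.
- move=> [x0 u0] _ e e0 /=.
  have [dfx Dfx] := df x0.
  have := diff_locally dfx => /eqaddoP /(_ e e0).
  rewrite near_withinE => /nbhs_ballP[delta /= d0 H].
  apply/nbhs_ballP; exists delta => //= -[x u] [/= xb _] _.
  have /H : ball (0 : 'cV[R]_n) delta (x - x0).
    by move: xb; rewrite -!ball_normE /ball_ /= sub0r normrN distrC.
  rewrite /= -[(_ - (_ : _ -> _)) _]/(f (x - x0 + x0) -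
    (f x0 + 'd f x0 (x - x0))).
  rewrite subrK Dfx => {}H.
  rewrite mul0mx addr0 prod_normE /=.
  apply: (@le_trans _ _ (e * `|x - x0|)).
    apply: le_trans H; rewrite opprD addrA.
    rewrite [leLHS]mx_normrE; apply: bigmax_le => // -[i j] _.
    by rewrite !ord1 !mxE eqxx !mulr1n.
  by apply: ler_wpM2l; [exact: ltW|rewrite le_max lexx].
- apply: continuous_subspaceT => z.
  by apply: (@continuous_comp _ _ _ fst fx); [exact: cvg_fst|exact: cfx].
- by move=> z; exact: cvg_cst.
Qed.

End Calculus.

(** * The l1 norm of vectors *)

Section L1Norm.
Context {R : realType}.

(** An entry of [A *m x] is at most [enorm A * l1 x], and sums of absolute
    values of entries are easy to bound in L2. *)
Definition l1 {a : nat} (x : 'cV[R]_a) : R := \sum_i `|x i 0|.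

Lemma l1_ge0 {a : nat} (x : 'cV[R]_a) : 0 <= l1 x.
Proof. by rewrite /l1 sumr_ge0. Qed.

Lemma l1D {a : nat} (x y : 'cV[R]_a) : l1 (x + y) <= l1 x + l1 y.
Proof.
rewrite /l1 -big_split /=; apply: ler_sum => i _.
by rewrite mxE ler_normD.
Qed.

Lemma l1N {a : nat} (x : 'cV[R]_a) : l1 (- x) = l1 x.
Proof. by apply: eq_bigr => i _; rewrite mxE normrN. Qed.

Lemma l1Z_le {a : nat} (t : R) (x : 'cV[R]_a) : 0 <= t <= 1 ->
  l1 (t *: x) <= l1 x.
Proof.
move=> /andP[t0 t1]; rewrite /l1; apply: ler_sum => i _.
by rewrite mxE normrM ger0_norm// ler_piMl.
Qed.

Lemma enorm_le_l1 {a : nat} (x : 'cV[R]_a) : enorm x <= l1 x.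
Proof.
rewrite /enorm -[leRHS]ger0_norm ?l1_ge0// -sqrtr_sqr ler_wsqrtr//.
rewrite expr2 [in leRHS]/l1 mulr_suml; apply: ler_sum => i _.
rewrite big_ord1 -real_normK ?num_real// expr2 ler_wpM2l//.
by rewrite /l1 (bigD1 i)//= lerDl sumr_ge0.
Qed.

Lemma mulmx_entry_le {a b : nat} (A : 'M[R]_(a, b)) (x : 'cV[R]_b) i :
  `|(A *m x) i 0| <= enorm A * l1 x.
Proof.
rewrite mxE (le_trans (ler_norm_sum _ _ _))// /l1 mulr_sumr.
by apply: ler_sum => j _; rewrite normrM ler_wpM2r// entry_le_enorm.
Qed.

End L1Norm.

(** * Growth and joint continuity of the coefficients *)

Section Coefficients.
Context {R : realType} {n m : nat}.

(** The bound [K] is only asked for on the segment, because the gradients of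
    the costs grow linearly. *)
Lemma C1_on_lipschitz {l : nat} (V : set 'cV[R]_m) (g : _ -> _ -> 'cV[R]_l)
    gx gu (x0 : 'cV[R]_n) (u0 : 'cV[R]_m) (x1 : 'cV[R]_n) (u1 : 'cV[R]_m) i
    (K : R) :
  convex_controls V -> @C1_on R n m l V g gx gu -> V u0 -> V u1 ->
  (forall t : R, 0 <= t <= 1 ->
     enorm (gx (x0 + t *: (x1 - x0)) (u0 + t *: (u1 - u0))) <= K /\
     enorm (gu (x0 + t *: (x1 - x0)) (u0 + t *: (u1 - u0))) <= K) ->
  `|g x1 u1 i 0 - g x0 u0 i 0| <= K * (l1 (x1 - x0) + l1 (u1 - u0)).
Proof.
move=> cV gC V0 V1 HK.
have [t t01 /= ->] := C1_on_mean_value x0 x1 i cV gC V0 V1.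
have [K1 K2] := HK t t01.
rewrite mxE (le_trans (ler_normD _ _))// mulrDr lerD//.
  by rewrite (le_trans (mulmx_entry_le _ _ _))// ler_wpM2r// l1_ge0.
by rewrite (le_trans (mulmx_entry_le _ _ _))// ler_wpM2r// l1_ge0.
Qed.

Lemma C1_on_continuous {l : nat} (V : set 'cV[R]_m) (g : _ -> _ -> 'cV[R]_l)
    gx gu : @C1_on R n m l V g gx gu ->
  {within dom V, continuous (fun z => g z.1 z.2)}.
Proof.
move=> [gd _ _]; apply/subspace_continuousP => z0 Vz0.
have [K1 K10 HK1] := @mulmx_bounded R _ _ 1 (gx z0.1 z0.2).
have [K2 K20 HK2] := @mulmx_bounded R _ _ 1 (gu z0.1 z0.2).
apply/cvgrPdist_le => e e0; rewrite near_withinE.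
have := gd z0 Vz0 1 ltr01; rewrite near_withinE => H.
have K0 : 0 < 1 + (K1 + K2) by rewrite ltr_pwDl// addr_ge0 ?ltW.
have Hb := nbhsx_ballx z0 _ (divr_gt0 e0 K0).
apply: filterS2 H Hb => z H; rewrite -ball_normE /ball_ /= distrC => /ltW zz Vz.
have {H} := H Vz; rewrite mul1r.
move=> Hz; rewrite distrC.
set D := gx z0.1 z0.2 *m _ + _ in Hz.
rewrite -[X in `|X|](subrK D); apply: le_trans (ler_normD _ _) _.
have HD : `|D| <= (K1 + K2) * `|z - z0|.
  rewrite mulrDl (le_trans (ler_normD _ _))// lerD//.
    apply: le_trans (HK1 _) _; apply: ler_wpM2l; first exact: ltW.
    by rewrite prod_normE le_max lexx.
  apply: le_trans (HK2 _) _; apply: ler_wpM2l; first exact: ltW.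
  by rewrite prod_normE le_max lexx orbT.
apply: le_trans (lerD Hz HD) _.
by rewrite -[X in X + _]mul1r -mulrDl mulrC -ler_pdivlMr.
Qed.

Context {Gamma : pmetricType R}.

(** Continuity in (x, u) for each parameter and a modulus in the parameter
    that is uniform for bounded (x, u) give joint continuity; the bound on
    (x, u) is chosen to cover the unit ball around the point. *)
Lemma jointly_continuous_intro (V : set 'cV[R]_m)
    (h : Gamma -> 'cV[R]_n -> 'cV[R]_m -> R) :
  (forall g, {within dom V, continuous (fun z => h g z.1 z.2)}) ->
  (forall r : R, 0 < r -> exists psi : R -> R, modulus psi /\
    forall g g' x u, V u -> enorm x <= r -> enorm u <= r ->
      `|h g x u - h g' x u| <= psi (mdist g g')) ->
  jointly_continuous V h.
Proof.
move=> hc hmod g x u Vu e e0; have e20 : 0 < e / 2 by rewrite divr_gt0.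
(* On a unit ball for the maximum norm, [l1] varies by at most the dimension. *)
pose r : R := 1 + ((l1 x + n%:R) + (l1 u + m%:R)).
have r0 : 0 < r by rewrite ltr_pwDl// !addr_ge0// l1_ge0.
have near_l1 a (y y' : 'cV[R]_a) d : ball y d y' -> d <= 1 ->
    enorm y' <= l1 y + a%:R.
  move=> yy d1; apply: le_trans (enorm_le_l1 _) _.
  rewrite -[y'](subrK y) addrC (le_trans (l1D _ _))// lerD//.
  rewrite /l1 (le_trans (ler_sum _ (G := fun=> 1) _)) //.
    move=> i _; rewrite !mxE distrC; case: yy => _ /(_ i 0).
    by rewrite -ball_normE /= => /ltW /le_trans; apply.
  by rewrite sumr_const card_ord.
have [psi [[psic psi0 _ _ _] Hpsi]] := hmod r r0.
have : psi t @[t --> within [set t : R | 0 <= t] (nbhs 0)] --> psi 0.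
  by have /subspace_continuousP := psic; apply; rewrite /= lexx.
rewrite psi0 => /cvgrPdist_lt/(_ _ e20).
rewrite near_withinE => /nbhs_ballP[d1 /= d10 H1].
have /subspace_continuousP/(_ (x, u) Vu)/cvgrPdist_lt/(_ _ e20) := hc g.
rewrite near_withinE => /nbhs_ballP[d2 /= d20 H2].
pose d := Num.min 1 (Num.min d1 d2).
have d0 : 0 < d by rewrite !lt_min ltr01 d10 d20.
have dle1 : d <= 1 by rewrite ge_min lexx.
have dle2 : d <= d1 by rewrite !ge_min lexx !orbT.
have dle3 : d <= d2 by rewrite !ge_min lexx !orbT.
exists d => // g' x' u' Vu' gg xx uu.
have hr1 : enorm x' <= r.
  rewrite (le_trans (near_l1 _ _ _ _ xx dle1))// /r addrCA lerDl.
  by rewrite !addr_ge0// l1_ge0.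
have hr2 : enorm u' <= r.
  rewrite (le_trans (near_l1 _ _ _ _ uu dle1))// /r addrA lerDr.
  by rewrite !addr_ge0// l1_ge0.
have p1 : `|h g' x' u' - h g x' u'| < e / 2.
  rewrite distrC; apply: le_lt_trans (Hpsi g g' x' u' Vu' hr1 hr2) _.
  have gd : mdist g g' < d1.
    apply: lt_le_trans dle2; move: gg; rewrite ballEmdist.
    exact.
  have /H1 : ball (0 : R) d1 (mdist g g').
    by rewrite -ball_normE /ball_ /= sub0r normrN ger0_norm ?mdist_ge0.
  move=> /(_ (mdist_ge0 _ _)); rewrite sub0r normrN; apply: le_lt_trans.
  exact: ler_norm.
have p2 : `|h g x' u' - h g x u| < e / 2.
  rewrite distrC; apply: (H2 (x', u')) => //.
  by split => /=; [apply: le_ball xx|apply: le_ball uu].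
rewrite -(subrK (h g x' u') (h g' x' u')) -addrA [e]splitr.
by rewrite (le_lt_trans (ler_normD _ _))// ltrD.
Qed.

Lemma within_continuous_entry {a b : nat} (V : set 'cV[R]_m)
    (h : 'cV[R]_n -> 'cV[R]_m -> 'M[R]_(a, b)) i j :
  {within dom V, continuous (fun z => h z.1 z.2)} ->
  {within dom V, continuous (fun z => h z.1 z.2 i j)}.
Proof.
move=> hc z.
apply: (continuous_comp (g := fun M : 'M[R]_(a, b) => M i j) (hc z)).
exact: coord_continuous.
Qed.

Context {d : nat}.
Variable c : Gamma -> coeffs R n m d.

Lemma jointly_continuous_entry {a b : nat} (V : set 'cV[R]_m)
    (chi : coeffs R n m d -> 'cV[R]_n -> 'cV[R]_m -> 'M[R]_(a, b)) i j :
  (forall g, {within dom V, continuous (fun z => chi (c g) z.1 z.2)}) ->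
  (forall r : R, 0 < r -> exists psi : R -> R, modulus psi /\
    modulus_param c V r psi chi) ->
  jointly_continuous V (fun g x u => chi (c g) x u i j).
Proof.
move=> hc hmod; apply: jointly_continuous_intro.
  by move=> g; exact: (within_continuous_entry (hc g)).
move=> r r0; have [psi [mpsi H]] := hmod r r0; exists psi; split=> //.
move=> g g' x u Vu xr ur; apply: le_trans (H g g' x u Vu xr ur).
by apply: le_trans (entry_le_enorm _ i j); rewrite !mxE.
Qed.

Variables (N : nat) (U : nat -> set 'cV[R]_m) (L : R).
Hypothesis hU : forall k, (k < N)%N -> convex_controls (U k).
Hypothesis hL : 0 < L.
Hypotheses (h1 : H1 N U c L) (h2 : H2 N U c L) (h4 : H4 N U c).

Let L0 : 0 <= L. Proof. exact: ltW. Qed.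

Section FixedTime.
Variable k : nat.
Hypothesis kN : (k < N)%N.

Lemma jointly_continuous_b i : jointly_continuous (U k)
  (fun g x u => cb (c g) k x u i 0).
Proof.
apply: (@jointly_continuous_entry _ _ (U k) (fun e => cb e k)).
  by move=> g; have [_ /(_ g)[+ _ _ _]] := h1 kN; exact: C1_on_continuous.
move=> r r0; have [psi [mpsi [H _]]] := h4 r0; exists psi; split=> //.
by have [[? ? ?] [? ? ? ? ?]] := H k kN.
Qed.

Lemma jointly_continuous_sigma i j :
  jointly_continuous (U k) (fun g x u => csigma (c g) k x u i j).
Proof.
apply: jointly_continuous_intro.
  move=> g; have [_ /(_ g)[_ /(_ j) /C1_on_continuous H _ _]] := h1 kN.
  have := within_continuous_entry (h := fun x u => col j (csigma (c g) k x u))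
    (i := i) (j := 0) H.
  by under eq_fun do rewrite mxE.
move=> r r0; have [psi [mpsi [H _]]] := h4 r0; exists psi; split=> //.
move=> g g' x u Vu xr ur; have [[_ H' _] _] := H k kN.
apply: le_trans (H' g g' x u Vu xr ur).
by apply: le_trans (entry_le_enorm _ i j); rewrite !mxE.
Qed.

Lemma jointly_continuous_f : jointly_continuous (U k)
  (fun g x u => cf (c g) k x u).
Proof.
have -> : (fun g x u => cf (c g) k x u) =
    (fun g x u => ((cf (c g) k x u)%:M : 'M[R]_1) 0 0).
  by do 3 (apply/funext => ?); rewrite mxE eqxx mulr1n.
apply: (@jointly_continuous_entry _ _ (U k)
  (fun e x u => (cf e k x u)%:M : 'M[R]_1)).
  by move=> g; have [/(_ k kN)[_ /(_ g)[+ _]] _] := h2; exact: C1_on_continuous.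
move=> r r0; have [psi [mpsi [H _]]] := h4 r0; exists psi; split=> //.
by have [[? ? ?] [? ? ? ? ?]] := H k kN.
Qed.

Lemma jointly_continuous_dxb i j : jointly_continuous (U k)
  (fun g x u => dxb (c g) k x u i j).
Proof.
apply: (@jointly_continuous_entry _ _ (U k) (fun e => dxb e k)).
  by move=> g; have [_ /(_ g)[[_ + _] _ _ _]] := h1 kN.
move=> r r0; have [psi [mpsi [H _]]] := h4 r0; exists psi; split=> //.
by have [[? ? ?] [? ? ? ? ?]] := H k kN.
Qed.

Lemma jointly_continuous_dub i j : jointly_continuous (U k)
  (fun g x u => dub (c g) k x u i j).
Proof.
apply: (@jointly_continuous_entry _ _ (U k) (fun e => dub e k)).
  by move=> g; have [_ /(_ g)[[_ _ +] _ _ _]] := h1 kN.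
move=> r r0; have [psi [mpsi [H _]]] := h4 r0; exists psi; split=> //.
by have [[? ? ?] [? ? ? ? ?]] := H k kN.
Qed.

Lemma jointly_continuous_dxsigma l i j :
  jointly_continuous (U k) (fun g x u => dxsigma (c g) l k x u i j).
Proof.
apply: (@jointly_continuous_entry _ _ (U k) (fun e => dxsigma e l k)).
  by move=> g; have [_ /(_ g)[_ /(_ l)[_ + _] _ _]] := h1 kN.
move=> r r0; have [psi [mpsi [H _]]] := h4 r0; exists psi; split=> //.
by have [_ [_ _ /(_ l)[]]] := H k kN.
Qed.

Lemma jointly_continuous_dusigma l i j :
  jointly_continuous (U k) (fun g x u => dusigma (c g) l k x u i j).
Proof.
apply: (@jointly_continuous_entry _ _ (U k) (fun e => dusigma e l k)).
  by move=> g; have [_ /(_ g)[_ /(_ l)[_ _ +] _ _]] := h1 kN.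
move=> r r0; have [psi [mpsi [H _]]] := h4 r0; exists psi; split=> //.
by have [_ [_ _ /(_ l)[]]] := H k kN.
Qed.

Lemma jointly_continuous_dxf i j : jointly_continuous (U k)
  (fun g x u => dxf (c g) k x u i j).
Proof.
apply: (@jointly_continuous_entry _ _ (U k) (fun e => dxf e k)).
  by move=> g; have [/(_ k kN)[_ /(_ g)[[_ + _] _]] _] := h2.
move=> r r0; have [psi [mpsi [H _]]] := h4 r0; exists psi; split=> //.
by have [[? ? ?] [? ? ? ? ?]] := H k kN.
Qed.

Lemma jointly_continuous_duf i j : jointly_continuous (U k)
  (fun g x u => duf (c g) k x u i j).
Proof.
apply: (@jointly_continuous_entry _ _ (U k) (fun e => duf e k)).
  by move=> g; have [/(_ k kN)[_ /(_ g)[[_ _ +] _]] _] := h2.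
move=> r r0; have [psi [mpsi [H _]]] := h4 r0; exists psi; split=> //.
by have [[? ? ?] [? ? ? ? ?]] := H k kN.
Qed.

(** The constant is uniform in the parameter: it depends on [L] and on the
    reference control [v] at which the coefficients are bounded. *)
Lemma growth_state_coefficients : exists2 K : R, 0 <= K & forall g x u, U k u ->
  (forall i, `|cb (c g) k x u i 0| <= K * (1 + l1 x + l1 u)) /\
  (forall i j, `|csigma (c g) k x u i j| <= K * (1 + l1 x + l1 u)).
Proof.
have [[v Uv bv] HC] := h1 kN.
exists (L * (1 + enorm v) + L * (1 + l1 v)).
  by rewrite addr_ge0// mulr_ge0// addr_ge0 ?sqrtr_ge0 ?l1_ge0.
move=> g x u Uu; have [Cb Cs Lb Ls] := HC g.
set S := 1 + l1 x + l1 u.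
have S1 : 1 <= S by rewrite /S -addrA lerDl addr_ge0 ?l1_ge0.
have ev0 : 0 <= enorm v by rewrite sqrtr_ge0.
have key (y y' : R) : `|y'| <= L * (1 + enorm v) ->
    `|y - y'| <= L * (l1 (x - 0) + l1 (u - v)) ->
    `|y| <= (L * (1 + enorm v) + L * (1 + l1 v)) * S.
  move=> y'L yL;
    rewrite -(subrK y' y) (le_trans (ler_normD _ _))// addrC mulrDl.
  apply: lerD; apply: (le_trans _ _).
  - exact: y'L.
  - by rewrite ler_peMr// mulr_ge0// addr_ge0.
  - exact: yL.
  - rewrite -mulrA ler_pM2l// subr0.
    have := l1D u (- v); rewrite l1N /S.
    have := l1_ge0 x; have := l1_ge0 u; have := l1_ge0 v; nra.
have en0 a b (A : 'M[R]_(a, b)) : 0 <= enorm A by rewrite sqrtr_ge0.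
split=> [i|i j].
- apply: (key _ (cb (c g) k 0 v i 0)).
    apply: le_trans (entry_le_enorm _ _ _) _; apply: le_trans (bv g).
    by rewrite lerDl.
  apply: (C1_on_lipschitz i (hU kN) Cb Uv Uu) => t t01.
  by apply: Lb; exact: (hU kN).
- apply: (key _ (csigma (c g) k 0 v i j)).
    apply: le_trans (entry_le_enorm _ _ _) _; apply: le_trans (bv g).
    by rewrite lerDr.
  have := @C1_on_lipschitz _ _ _ _ _ 0 v x u i L (hU kN) (Cs j) Uv Uu.
  by rewrite !mxE; apply => t t01; apply: Ls; exact: (hU kN).
Qed.

Lemma growth_running_cost : exists2 K : R, 0 <= K & forall g x u, U k u ->
  `|cf (c g) k x u| <= K * (1 + l1 x + l1 u) ^+ 2.
Proof.
have [/(_ k kN)[[v Uv fv] HC] _] := h2.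
exists (L * (1 + enorm v) ^+ 2 + L * (1 + 2 * l1 v) ^+ 2).
  by rewrite addr_ge0// mulr_ge0// sqr_ge0.
move=> g x u Uu; have [Cf Lf] := HC g.
have [[Sx Su] Sv] := (l1_ge0 x, l1_ge0 u, l1_ge0 v).
set S := 1 + l1 x + l1 u.
have S1 : 1 <= S by rewrite /S -addrA lerDl addr_ge0.
have S2 : 1 <= S ^+ 2 by rewrite expr_ge1// (le_trans _ S1).
have luv : l1 (u - v) <= l1 u + l1 v by rewrite -(l1N v) l1D.
(* On the segment from (0, v) to (x, u), the gradients are at most L * M. *)
pose M := (1 + 2 * l1 v) * S.
have M0 : 0 <= M by rewrite mulr_ge0 ?(le_trans _ S1)//; lra.
have := @C1_on_lipschitz _ _ _ _ _ 0 v x u 0 (L * M) (hU kN) Cf Uv Uu.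
rewrite !mxE eqxx !mulr1n => /(_ _)/wrap[].
  move=> t t01; have Ut := hU kN Uv Uu t01.
  set xt := 0 + _; set ut := v + _.
  have : 1 + enorm xt + enorm ut <= M.
    have ex : enorm xt <= l1 x.
      by rewrite /xt add0r subr0 (le_trans (enorm_le_l1 _))// l1Z_le.
    have eu : enorm ut <= l1 v + (l1 u + l1 v).
      apply: le_trans (enorm_le_l1 _) _; apply: le_trans (l1D _ _) _.
      by rewrite lerD2l; apply: le_trans (l1Z_le _ t01) luv.
    rewrite /M /S; nra.
  have [L1 L2] := Lf xt ut Ut.
  by move=> HM; split; [apply: le_trans L1 _|apply: le_trans L2 _];
    rewrite ler_pM2l.
rewrite subr0 => H.
rewrite -(subrK (cf (c g) k 0 v) (cf (c g) k x u)).
rewrite (le_trans (ler_normD _ _))// addrC mulrDl lerD//.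
  apply: le_trans (fv g) _.
  by rewrite ler_peMr// mulr_ge0// sqr_ge0.
apply: le_trans H _; rewrite -(mulrA L) -(mulrA L) ler_pM2l//.
have -> : (1 + 2 * l1 v) ^+ 2 * S ^+ 2 = M * M by rewrite /M; ring.
by apply: ler_wpM2l => //; rewrite /M /S; nra.
Qed.

End FixedTime.

Lemma jointly_continuous_phi : jointly_continuous [set: 'cV[R]_m]
  (fun (g : Gamma) x (_ : 'cV[R]_m) => cphi (c g) x).
Proof.
apply: jointly_continuous_intro.
  move=> g; have [_ /(_ g)[dphi cphi' _]] := h2.
  have := within_continuous_entry (h := fun x _ => (cphi (c g) x)%:M : 'M[R]_1)
    (i := 0) (j := 0) (C1_on_continuous (@C1_on_state R n m _ _ dphi cphi')).
  by under eq_fun do rewrite mxE eqxx mulr1n.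
move=> r r0; have [psi [mpsi [_ H]]] := h4 r0; exists psi; split=> //.
by move=> g g' x u _ xr _; have [] := H g g' x xr.
Qed.

Lemma jointly_continuous_dxphi j : jointly_continuous [set: 'cV[R]_m]
  (fun (g : Gamma) x (_ : 'cV[R]_m) => dxphi (c g) x 0 j).
Proof.
apply: jointly_continuous_intro.
  move=> g; have [_ /(_ g)[dphi cphi' _]] := h2.
  have [_ H _] := @C1_on_state R n m _ _ dphi cphi'.
  exact: (within_continuous_entry (h := fun x _ => dxphi (c g) x) H).
move=> r r0; have [psi [mpsi [_ H]]] := h4 r0; exists psi; split=> //.
move=> g g' x u _ xr _; have [_] := H g g' x xr; apply: le_trans.
by apply: le_trans (entry_le_enorm _ 0 j); rewrite !mxE.
Qed.

(** Here the constant depends on the parameter, as nothing bounds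
    [cphi (c g) 0] uniformly in [g]. *)
Lemma growth_terminal_cost g : exists2 K : R, 0 <= K & forall x,
  `|cphi (c g) x| <= K * (1 + l1 x) ^+ 2.
Proof.
have [_ /(_ g)[dphi cphi' Lphi]] := h2.
exists (`|cphi (c g) 0| + L); first by rewrite addr_ge0.
move=> x; have Sx := l1_ge0 x.
have cT : convex_controls [set: 'cV[R]_m] by [].
have := @C1_on_lipschitz _ _ _ _ _ 0 0 x 0 0 (L * (1 + l1 x)) cT
  (@C1_on_state R n m _ _ dphi cphi') I I.
rewrite !mxE eqxx !mulr1n => /(_ _)/wrap[].
  move=> t t01; split; last first.
    by rewrite /enorm big1 ?sqrtr0 ?mulr_ge0 ?addr_ge0// => i _;
      rewrite big1// => j _; rewrite mxE expr0n.
  apply: le_trans (Lphi _) _; rewrite ler_pM2l// lerD2l.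
  by rewrite add0r subr0 (le_trans (enorm_le_l1 _))// l1Z_le.
rewrite !subr0 => H.
rewrite -(subrK (cphi (c g) 0) (cphi (c g) x)) (le_trans (ler_normD _ _))//.
rewrite addrC mulrDl lerD//.
  by rewrite ler_peMr// expr_ge1// ?addr_ge0// lerDl.
apply: le_trans H _; rewrite -mulrA ler_pM2l// expr2 ler_wpM2l ?addr_ge0//.
suff -> : l1 (0 : 'cV[R]_m) = 0 by rewrite addr0 lerDr.
by rewrite /l1 big1// => i _; rewrite mxE normr0.
Qed.

End Coefficients.

(** * Measurability of the controlled dynamics *)

Section StateMeasurability.
Context {R : realType} {dO : measure_display} {Omega : measurableType dO}.
Variables (P : probability Omega R) (N n m d : nat).
Variables (B : nat -> Omega -> 'cV[R]_d) (U : nat -> set 'cV[R]_m) (q : R).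
Context {Gamma : pmetricType R}.
Variables (c : Gamma -> coeffs R n m d) (x0 : 'cV[R]_n) (L : R).
Hypothesis hB : noise P N B.
Hypothesis hsep : exists2 D : set Gamma, countable D & dense D.
Hypotheses (h1 : H1 N U c L) (h2 : H2 N U c L) (h4 : H4 N U c).

Lemma mx_measurable_mulmx {dT : measure_display} {T : measurableType dT}
    {a b l : nat} (X : T -> 'M[R]_(a, b)) (Y : T -> 'M[R]_(b, l)) :
  mx_measurable X -> mx_measurable Y -> mx_measurable (fun t => X t *m Y t).
Proof.
move=> mX mY i j; under eq_fun do rewrite mxE.
by apply: measurable_sum => o; apply: measurable_funM; [exact: mX|exact: mY].
Qed.

Lemma mx_measurableD {dT : measure_display} {T : measurableType dT}
    {a b : nat} (X Y : T -> 'M[R]_(a, b)) :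
  mx_measurable X -> mx_measurable Y -> mx_measurable (fun t => X t + Y t).
Proof.
move=> mX mY i j; under eq_fun do rewrite mxE.
by apply: measurable_funD; [exact: mX|exact: mY].
Qed.

Lemma mx_measurableT {dT : measure_display} {T : measurableType dT}
    {a b : nat} (X : T -> 'M[R]_(a, b)) :
  mx_measurable X -> mx_measurable (fun t => (X t)^T).
Proof. by move=> mX i j; under eq_fun do rewrite mxE; exact: mX. Qed.

Lemma mx_measurable_sum {dT : measure_display} {T : measurableType dT}
    {a b : nat} (I : Type) (s : seq I) (X : I -> T -> 'M[R]_(a, b)) :
  (forall i, mx_measurable (X i)) ->
  mx_measurable (fun t => \sum_(i <- s) X i t).
Proof.
move=> mX i j; under eq_fun do rewrite summxE.
by apply: measurable_sum => o; exact: mX.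
Qed.

Lemma mx_measurable_col {dT : measure_display} {T : measurableType dT}
    {a b : nat} (X : T -> 'M[R]_(a, b)) l :
  mx_measurable X -> mx_measurable (fun t => col l (X t)).
Proof. by move=> mX i j; under eq_fun do rewrite mxE; exact: mX. Qed.

(** Measurability of the state is needed in three situations: for a fixed
    parameter with respect to the past, for a fixed parameter with respect to
    all events, and jointly in parameter and noise. This record abstracts what
    they have in common: [T] observes the parameter through [g] and, through
    [o], the noise up to time [k] and the controls before time [k']. *)
Record observes {dT : measure_display} {T : measurableType dT}
    (g : T -> borel Gamma) (o : T -> Omega) (u : nat -> Omega -> 'cV[R]_m)
    (k k' : nat) : Prop := Observes {
  observes_parameter : measurable_fun [set: T] g;
  observes_noise : forall j, (1 <= j <= k)%N ->
    mx_measurable (fun t => B j (o t));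
  observes_control : forall j, (j < k')%N -> mx_measurable (fun t => u j (o t))
}.

Section Observation.
Context {dT : measure_display} {T : measurableType dT}.
Variables (g : T -> borel Gamma) (o : T -> Omega).
Variables (u : nat -> Omega -> 'cV[R]_m).
Hypothesis uU : forall k w, (k < N)%N -> U k (u k w).

Lemma mx_measurable_state k : (k <= N)%N -> observes g o u k k ->
  mx_measurable (fun t => state B (c (g t)) x0 u k (o t)).
Proof.
elim: k => [_ _ i j|k ih kN obs] /=; first exact: measurable_cst.
have [mg mB mu] := obs.
have mx : mx_measurable (fun t => state B (c (g t)) x0 u k (o t)).
  apply: ih; [exact: ltnW|split=> // j].
    by move=> /andP[j1 jk]; apply: mB; rewrite j1 (leq_trans jk).
  by move=> jk; apply: mu; exact: ltnW.
have muk : mx_measurable (fun t => u k (o t)) by apply: mu.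
have ukU t : U k (u k (o t)) by exact: uU.
apply: mx_measurableD => [i j|].
  rewrite (ord1 j).
  exact: (jointly_continuous_measurable hsep (jointly_continuous_b h1 h4 kN i)
    mg mx muk ukU).
apply: mx_measurable_mulmx => [i j|]; last by apply: mB; rewrite leqnn.
exact: (jointly_continuous_measurable hsep
  (jointly_continuous_sigma h1 h4 kN i j) mg mx muk ukU).
Qed.

Lemma measurable_eval k h : (k < N)%N -> observes g o u k k.+1 ->
  jointly_continuous (U k) h ->
  measurable_fun [set: T]
    (fun t => h (g t) (state B (c (g t)) x0 u k (o t)) (u k (o t))).
Proof.
move=> kN [mg mB mu] hc.
apply: (jointly_continuous_measurable hsep hc mg) => //.
- apply: mx_measurable_state => //; first exact: ltnW.
  by split=> // j jk; apply: mu; exact: ltnW.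
- exact: mu.
- by move=> t; exact: uU.
Qed.

Lemma measurable_eval_terminal h : observes g o u N N ->
  jointly_continuous [set: 'cV[R]_m] (fun g x (_ : 'cV[R]_m) => h g x) ->
  measurable_fun [set: T]
    (fun t => h (g t) (state B (c (g t)) x0 u N (o t))).
Proof.
move=> obs hc; have [mg _ _] := obs.
apply: (jointly_continuous_measurable (u := fun=> 0) hsep hc mg) => //.
exact: mx_measurable_state.
Qed.

Lemma measurable_total_cost : observes g o u N N ->
  measurable_fun [set: T] (fun t =>
    \sum_(k < N) cf (c (g t)) k (state B (c (g t)) x0 u k (o t)) (u k (o t))
      + cphi (c (g t)) (state B (c (g t)) x0 u N (o t))).
Proof.
move=> obs; have [mg mB mu] := obs.
apply: measurable_funD; last first.
  by apply: (measurable_eval_terminal (h := fun g => cphi (c g))) => //;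
    exact: jointly_continuous_phi h2 h4.
apply: measurable_sum => k.
apply: (measurable_eval (h := fun g x u => cf (c g) k x u)) => //.
- split=> // j.
    by move=> /andP[j1 jk]; apply: mB; rewrite j1 (leq_trans jk)// ltnW.
  by move=> jk; apply: mu; rewrite (leq_trans jk).
- exact: (jointly_continuous_f h2 h4).
Qed.

Section HamiltonianGradients.
Variables (k : nat) (p : T -> 'cV[R]_n) (r : T -> 'M[R]_(n, d)).
Hypotheses (kN : (k < N)%N) (obs : observes g o u k k.+1).
Hypotheses (mp : mx_measurable p) (mr : mx_measurable r).

Lemma mx_measurable_du_hamiltonian : mx_measurable (fun t =>
  du_hamiltonian (c (g t)) k (state B (c (g t)) x0 u k (o t)) (u k (o t))
    (p t) (r t)).
Proof.
rewrite /du_hamiltonian.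
apply: mx_measurableD; first apply: mx_measurableD.
- apply: mx_measurable_mulmx => //; apply: mx_measurableT => i j.
  apply: (measurable_eval (h := fun g x u => dub (c g) k x u i j)) => //.
  exact: (jointly_continuous_dub h1 h4 kN).
- apply: mx_measurable_sum => l.
  apply: mx_measurable_mulmx; last exact: mx_measurable_col.
  apply: mx_measurableT => i j.
  apply: (measurable_eval (h := fun g x u => dusigma (c g) l k x u i j)) => //.
  exact: (jointly_continuous_dusigma h1 h4 kN).
- apply: mx_measurableT => i j.
  apply: (measurable_eval (h := fun g x u => duf (c g) k x u i j)) => //.
  exact: (jointly_continuous_duf h2 h4 kN).
Qed.

End HamiltonianGradients.
End Observation.

Section Instances.
Variable u : nat -> Omega -> 'cV[R]_m.
Hypothesis hu : admissible P N B U q u.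

Lemma admissible_mx_measurable k : (k < N)%N -> mx_measurable (u k).
Proof.
have [mu _ _] := hu; move=> kN i j.
exact: (sub_sigma_measurable_fun (past_sub hB (ltnW kN)) (mu k kN i j)).
Qed.

Lemma observes_past k (g : Gamma) : (k < N)%N ->
  @observes _ (g_sigma_algebraType (past B k)) (fun=> g : borel Gamma) id u
    k k.+1.
Proof.
move=> kN; split; first exact: measurable_cst.
- by move=> j jk; exact: past_mx_measurable.
- move=> j jk a b; have [mu _ _] := hu.
  by apply: (past_measurable_fun_mono (j := j)) => //;
    apply: mu (leq_ltn_trans _ kN) _ _.
Qed.

Lemma observes_cst (g : Gamma) : observes (fun=> g : borel Gamma) id u N N.
Proof.
split; first exact: measurable_cst.
- by move=> j jN; exact: (noise_mx_measurable hB).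
- exact: admissible_mx_measurable.
Qed.

Lemma observes_prod :
  @observes _ (borel Gamma * Omega)%type fst snd u N N.
Proof.
split; first exact: measurable_fst.
- move=> j jN i l.
  apply: (@measurableT_comp _ _ _ _ _ _ (fun w => B j w i l) _ snd) => //.
  exact: (noise_mx_measurable hB).
- move=> j jN i l.
  apply: (@measurableT_comp _ _ _ _ _ _ (fun w => u j w i l) _ snd) => //.
  exact: admissible_mx_measurable.
Qed.

Lemma observesW {dT : measure_display} {T : measurableType dT}
    (g : T -> borel Gamma) (o : T -> Omega) k : (k < N)%N ->
  observes g o u N N -> observes g o u k k.+1.
Proof.
move=> kN [mg mB mu]; split=> // j.
  by move=> /andP[j1 jk]; apply: mB; rewrite j1 (leq_trans jk)// ltnW.
by move=> jk; apply: mu; rewrite (leq_trans jk).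
Qed.

End Instances.
End StateMeasurability.

(** * Families bounded in L2 *)

Section L2Families.
Context {R : realType} {dO : measure_display} {Omega : measurableType dO}.
Variables (P : probability Omega R) (I : Type).

Notation rintegrable f := (P.-integrable [set: Omega] (EFin \o f)).

Definition L2_bounded (X : I -> Omega -> R) : Prop := exists C : R,
  forall i, measurable_fun [set: Omega] (X i) /\
    (\int[P]_w (X i w ^+ 2)%:E <= C%:E)%E.

Lemma L2_bounded_measurable X i : L2_bounded X ->
  measurable_fun [set: Omega] (X i).
Proof. by move=> [C /(_ i)[]]. Qed.

Lemma L2_bounded_le (X Y : I -> Omega -> R) :
  (forall i, measurable_fun [set: Omega] (X i)) -> L2_bounded Y ->
  (forall i w, `|X i w| <= `|Y i w|) -> L2_bounded X.
Proof.
move=> mX [C HC] XY; exists C => i; split=> //.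
have [mY YC] := HC i; apply: le_trans YC; apply: ge0_le_integral => //.
- by move=> w _; rewrite lee_fin sqr_ge0.
- by apply/measurable_EFinP; exact: measurable_funX.
- by apply/measurable_EFinP; exact: measurable_funX.
- by move=> w _; rewrite lee_fin -[leLHS]real_normK ?num_real//
    -[leRHS]real_normK ?num_real// ler_sqr ?nnegrE.
Qed.

Lemma L2_bounded_cst (r : R) : L2_bounded (fun _ _ => r).
Proof.
exists (r ^+ 2) => i; split; first exact: measurable_cst.
rewrite integral_cst// [X in (_ * X)%E](_ : _ = 1%E) ?mule1//.
exact: probability_setT.
Qed.

Lemma L2_boundedD X Y : L2_bounded X -> L2_bounded Y ->
  L2_bounded (fun i w => X i w + Y i w).
Proof.
move=> [C1 H1] [C2 H2]; exists (2 * C1 + 2 * C2) => i.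
have [mX X1] := H1 i; have [mY Y2] := H2 i.
have mX2 : measurable_fun [set: Omega] (fun w => (X i w ^+ 2)%:E).
  by apply/measurable_EFinP; exact: measurable_funX.
have mY2 : measurable_fun [set: Omega] (fun w => (Y i w ^+ 2)%:E).
  by apply/measurable_EFinP; exact: measurable_funX.
split; first exact: measurable_funD.
apply: (@le_trans _ _ (\int[P]_w (2%:E * (X i w ^+ 2)%:E
    + 2%:E * (Y i w ^+ 2)%:E))%E).
  apply: ge0_le_integral => //.
  - by move=> w _; rewrite lee_fin sqr_ge0.
  - by apply/measurable_EFinP; apply: measurable_funX; exact: measurable_funD.
  - by apply: emeasurable_funD; exact: measurable_funeM.
  - move=> w _; rewrite -!EFinM -EFinD lee_fin.
    have := sqr_ge0 (X i w - Y i w); nra.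
rewrite ge0_integralD//; last 4 first.
- by move=> w _; rewrite mule_ge0// lee_fin sqr_ge0.
- exact: measurable_funeM.
- by move=> w _; rewrite mule_ge0// lee_fin sqr_ge0.
- exact: measurable_funeM.
rewrite !ge0_integralZl//; try by move=> w _; rewrite lee_fin sqr_ge0.
by rewrite (EFinD (2 * C1)) (EFinM 2 C1) (EFinM 2 C2) leeD// lee_wpmul2l.
Qed.

Lemma L2_bounded_bounded_mul (a X : I -> Omega -> R) (K : R) :
  (forall i, measurable_fun [set: Omega] (a i)) ->
  (forall i w, `|a i w| <= K) -> L2_bounded X ->
  L2_bounded (fun i w => a i w * X i w).
Proof.
move=> ma aK [C H]; exists (K ^+ 2 * C) => i; have [mX XC] := H i.
split; first exact: measurable_funM.
apply: (@le_trans _ _ (\int[P]_w ((K ^+ 2)%:E * (X i w ^+ 2)%:E))%E).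
  apply: ge0_le_integral => //.
  - by move=> w _; rewrite lee_fin sqr_ge0.
  - by apply/measurable_EFinP; apply: measurable_funX; exact: measurable_funM.
  - by apply: measurable_funeM; apply/measurable_EFinP; exact: measurable_funX.
  - move=> w _; rewrite -EFinM lee_fin exprMn ler_wpM2r ?sqr_ge0//.
    rewrite -[leLHS]real_normK ?num_real// ler_sqr ?nnegrE//.
    exact: le_trans (aK i w).
rewrite ge0_integralZl//.
- by rewrite (EFinM (K ^+ 2) C) lee_wpmul2l// lee_fin sqr_ge0.
- by apply/measurable_EFinP; exact: measurable_funX.
- by move=> w _; rewrite lee_fin sqr_ge0.
- by rewrite lee_fin sqr_ge0.
Qed.

Lemma L2_boundedZ (r : R) X : L2_bounded X ->
  L2_bounded (fun i w => r * X i w).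
Proof.
by apply: L2_bounded_bounded_mul => [i|i w]; [exact: measurable_cst|exact:
  lexx].
Qed.

Lemma L2_boundedB X Y : L2_bounded X -> L2_bounded Y ->
  L2_bounded (fun i w => X i w - Y i w).
Proof.
move=> bX bY; have := L2_boundedD bX (L2_boundedZ (-1) bY).
by under eq_fun do under eq_fun do rewrite mulN1r.
Qed.

Lemma L2_bounded_abs X : L2_bounded X -> L2_bounded (fun i w => `|X i w|).
Proof.
move=> bX; apply: (L2_bounded_le _ bX) => [i|i w]; last by rewrite normr_id.
by apply: measurableT_comp => //; exact: L2_bounded_measurable.
Qed.

Lemma L2_bounded_sum (J : Type) (s : seq J) (X : J -> I -> Omega -> R) :
  (forall j, L2_bounded (X j)) ->
  L2_bounded (fun i w => \sum_(j <- s) X j i w).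
Proof.
move=> bX; elim: s => [|j s ih].
  under eq_fun do under eq_fun do rewrite big_nil.
  exact: L2_bounded_cst.
under eq_fun do under eq_fun do rewrite big_cons.
exact: L2_boundedD.
Qed.

Lemma L2_bounded_rintegrable_sqr X i : L2_bounded X ->
  rintegrable (fun w => X i w ^+ 2).
Proof.
move=> [C /(_ i)[mX XC]].
have mX2 : measurable_fun [set: Omega] (fun w => X i w ^+ 2).
  exact: measurable_funX.
apply/integrableP; split; first exact/measurable_EFinP.
apply: le_lt_trans (ltry C); apply: le_trans XC; apply: ge0_le_integral => //.
- by apply: measurableT_comp => //; exact/measurable_EFinP.
- exact/measurable_EFinP.
- by move=> w _; rewrite lee_fin ger0_norm// sqr_ge0.
Qed.

Lemma L2_bounded_rintegrable_mul X Y i : L2_bounded X -> L2_bounded Y ->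
  rintegrable (fun w => X i w * Y i w).
Proof.
move=> bX bY.
apply: (rintegrable_dom _ (rintegrableD (L2_bounded_rintegrable_sqr i bX)
  (L2_bounded_rintegrable_sqr i bY))).
  by apply: measurable_funM; exact: L2_bounded_measurable.
move=> w; have := sqr_ge0 (`|X i w| - `|Y i w|).
rewrite normrM -(real_normK (num_real (X i w)))
  -(real_normK (num_real (Y i w))).
have := normr_ge0 (X i w); have := normr_ge0 (Y i w); nra.
Qed.

Lemma L2_bounded_mul_bound X Y : L2_bounded X -> L2_bounded Y ->
  exists C : R, forall i, (\int[P]_w `|(X i w * Y i w)%:E| <= C%:E)%E.
Proof.
move=> [C1 H1] [C2 H2]; exists (C1 + C2) => i.
have [mX X1] := H1 i; have [mY Y2] := H2 i.
have mX2 : measurable_fun [set: Omega] (fun w => (X i w ^+ 2)%:E).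
  by apply/measurable_EFinP; exact: measurable_funX.
have mY2 : measurable_fun [set: Omega] (fun w => (Y i w ^+ 2)%:E).
  by apply/measurable_EFinP; exact: measurable_funX.
apply: (@le_trans _ _ (\int[P]_w ((X i w ^+ 2)%:E + (Y i w ^+ 2)%:E))%E).
  apply: ge0_le_integral => //.
  - apply: measurableT_comp => //; apply/measurable_EFinP.
    exact: measurable_funM.
  - exact: emeasurable_funD.
  - move=> w _; rewrite -EFinD lee_fin normrM.
    have := sqr_ge0 (`|X i w| - `|Y i w|).
    rewrite -(real_normK (num_real (X i w))) -(real_normK (num_real (Y i w))).
    have := normr_ge0 (X i w); have := normr_ge0 (Y i w); nra.
rewrite ge0_integralD//; last 2 first.
- by move=> w _; rewrite lee_fin sqr_ge0.
- by move=> w _; rewrite lee_fin sqr_ge0.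
by rewrite EFinD leeD.
Qed.

(** This is how the state equation stays in L2 although the noise has only
    second moments. *)
Lemma L2_bounded_mul_factor (G : set (set Omega)) (X : I -> Omega -> R) b
  (C : R) :
  G `<=` measurable -> L2_factor P G b C ->
  (forall i, measurable_fun [set: g_sigma_algebraType G]
     (X i : g_sigma_algebraType G -> R)) ->
  L2_bounded X -> 0 < C -> L2_bounded (fun i w => X i w * b w).
Proof.
move=> Gm [mb bC] mX [K HK] C0; exists (C * K) => i.
have [mX' XK] := HK i.
split; first exact: measurable_funM.
under eq_integral do rewrite exprMn.
apply: le_trans (bC (fun w => X i w ^+ 2) _ _) _.
- exact: measurable_funX.
- by move=> w; exact: sqr_ge0.
- by rewrite EFinM lee_wpmul2l// lee_fin ltW.
Qed.

Lemma L2_bounded_condexp (G : set (set Omega)) (X Y : I -> Omega -> R) b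
  (C : R) :
  G `<=` measurable -> L2_factor P G b C -> 0 < C -> L2_bounded X ->
  (forall i, is_condexp P G (fun w => X i w * b w) (Y i)) -> L2_bounded Y.
Proof.
move=> Gm fb C0 [K HK] cY; exists (C * K) => i; have [mX XK] := HK i.
split; last exact: condexp_L2 C0 mX XK fb (cY i).
by have [_ /rintegrable_measurable] := cY i.
Qed.

Lemma L2_bounded_l1 {a : nat} (X : I -> Omega -> 'cV[R]_a) :
  (forall j, L2_bounded (fun i w => X i w j 0)) ->
  L2_bounded (fun i w => l1 (X i w)).
Proof. by move=> bX; apply: L2_bounded_sum => j; exact: L2_bounded_abs. Qed.

Lemma L2_bounded_growth (X : I -> Omega -> R) {a b : nat}
    (Y : I -> Omega -> 'cV[R]_a) (Z : I -> Omega -> 'cV[R]_b) (K : R) :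
  (forall i, measurable_fun [set: Omega] (X i)) ->
  (forall j, L2_bounded (fun i w => Y i w j 0)) ->
  (forall j, L2_bounded (fun i w => Z i w j 0)) ->
  (forall i w, `|X i w| <= K * (1 + l1 (Y i w) + l1 (Z i w))) ->
  L2_bounded X.
Proof.
move=> mX bY bZ XK.
apply: (L2_bounded_le mX (Y := fun i w => K * (1 + l1 (Y i w) + l1 (Z i w)))).
  apply: L2_boundedZ; apply: L2_boundedD; last exact: L2_bounded_l1.
  by apply: L2_boundedD; [exact: L2_bounded_cst|exact: L2_bounded_l1].
by move=> i w; rewrite (le_trans (XK i w))// ler_norm.
Qed.

End L2Families.

(** * L2 bounds along an admissible control *)

Section L2Dynamics.
Context {R : realType} {dO : measure_display} {Omega : measurableType dO}.
Variables (P : probability Omega R) (N n m d : nat).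
Variables (B : nat -> Omega -> 'cV[R]_d) (U : nat -> set 'cV[R]_m) (q : R).
Context {Gamma : pmetricType R}.
Variables (c : Gamma -> coeffs R n m d) (x0 : 'cV[R]_n) (L : R).
Hypothesis hB : noise P N B.
Hypothesis hsep : exists2 D : set Gamma, countable D & dense D.
Hypothesis hL : 0 < L.
Hypothesis hU : forall k, (k < N)%N -> convex_controls (U k).
Hypotheses (h1 : H1 N U c L) (h2 : H2 N U c L) (h4 : H4 N U c).
Hypothesis hq : 2 < q.

Notation rintegrable f := (P.-integrable [set: Omega] (EFin \o f)).
Notation past_meas k f := (measurable_fun [set: g_sigma_algebraType (past B k)]
  (f : g_sigma_algebraType (past B k) -> R)).

Section OneControl.
Variable u : nat -> Omega -> 'cV[R]_m.
Hypothesis hu : admissible P N B U q u.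

Let uU k w : (k < N)%N -> U k (u k w).
Proof. by have [_ + _] := hu; apply. Qed.

Lemma admissible_L2 (I : Type) k i : (k < N)%N ->
  L2_bounded P (fun (_ : I) w => u k w i 0).
Proof.
move=> kN; have [_ _ uq] := hu; rewrite unlock in uq.
have muk j : (j < N)%N -> mx_measurable (u j).
  exact: (admissible_mx_measurable hB hu).
have msum : measurable_fun [set: Omega]
    (fun w => \sum_(j < N) enorm (u j w) `^ q).
  by apply: measurable_sum => j; apply: measurable_enorm_powR; exact: muk.
have mu : measurable_fun [set: Omega] (fun w => u k w i 0) by exact: muk.
have fin : (\int[P]_w (1 + \sum_(j < N) enorm (u j w) `^ q)%:E < +oo)%E.
  under eq_integral do rewrite EFinD.
  rewrite ge0_integralD//; last 2 first.
  - by move=> w _; rewrite lee_fin sumr_ge0// => j _; exact: powR_ge0.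
  - exact/measurable_EFinP.
  rewrite integral_cst//; apply: lte_add_pinfty => //.
  by rewrite mul1e fin_num_fun_lty.
exists (fine (\int[P]_w (1 + \sum_(j < N) enorm (u j w) `^ q)%:E)) => _.
have s0 w : 0 <= \sum_(j < N) enorm (u j w) `^ q.
  by rewrite sumr_ge0// => j _; exact: powR_ge0.
split=> //; rewrite fineK; last first.
  rewrite ge0_fin_numE//; apply: integral_ge0 => w _.
  by rewrite lee_fin addr_ge0.
apply: ge0_le_integral => //.
- by move=> w _; rewrite lee_fin sqr_ge0.
- by apply/measurable_EFinP; exact: measurable_funX.
- by apply/measurable_EFinP; exact: measurable_funD.
move=> w _; rewrite lee_fin -real_normK ?num_real//.
apply: le_trans
  (sqr_le_powR (ltW hq) (normr_ge0 _) (entry_le_enorm (u k w) i 0)) _.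
rewrite lerD2l (bigD1 (Ordinal kN))//= lerDl sumr_ge0// => j _.
exact: powR_ge0.
Qed.

Lemma past_measurable_eval k h (g : Gamma) : (k < N)%N ->
  jointly_continuous (U k) h ->
  past_meas k (fun w => h g (state B (c g) x0 u k w) (u k w)).
Proof.
move=> kN hc; have := observes_past hu g kN => obs.
exact: (measurable_eval x0 hsep h1 h4 uU kN obs hc).
Qed.

Lemma measurable_eval_cst k h (g : Gamma) : (k < N)%N ->
  jointly_continuous (U k) h ->
  measurable_fun [set: Omega] (fun w => h g (state B (c g) x0 u k w) (u k w)).
Proof.
move=> kN hc.
apply: (sub_sigma_measurable_fun (past_sub hB (ltnW kN))).
exact: past_measurable_eval.
Qed.

Lemma state_L2 k i : (k <= N)%N ->
  L2_bounded P (fun g w => state B (c g) x0 u k w i 0).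
Proof.
elim: k i => [i _|k ih i kN] /=; first exact: L2_bounded_cst.
under eq_fun do under eq_fun do rewrite mxE mxE.
have bx j : L2_bounded P (fun g w => state B (c g) x0 u k w j 0).
  by apply: ih; exact: ltnW.
have bu j : L2_bounded P (fun (g : Gamma) w => u k w j 0).
  exact: admissible_L2.
have [K K0 HK] := growth_state_coefficients hU hL h1 kN.
apply: L2_boundedD.
  apply: (L2_bounded_growth (K := K) _ bx bu) => [g|g w].
    exact: (measurable_eval_cst _ kN (jointly_continuous_b h1 h4 kN i)).
  by have [+ _] := HK g (state B (c g) x0 u k w) (u k w) (uU w kN); apply.
apply: L2_bounded_sum => j.
have [C C0 HC] := noise_L2_factor hB j kN.
apply: (L2_bounded_mul_factor (past_sub hB (ltnW kN)) HC) => // [g|].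
  exact: (past_measurable_eval _ kN (jointly_continuous_sigma h1 h4 kN i j)).
apply: (L2_bounded_growth (K := K) _ bx bu) => [g|g w].
  exact: (measurable_eval_cst _ kN (jointly_continuous_sigma h1 h4 kN i j)).
by have [_] := HK g (state B (c g) x0 u k w) (u k w) (uU w kN); apply.
Qed.

Lemma coefficients_L2 k : (k < N)%N ->
  (forall i, L2_bounded P
     (fun g w => cb (c g) k (state B (c g) x0 u k w) (u k w) i 0)) /\
  (forall i j, L2_bounded P
     (fun g w => csigma (c g) k (state B (c g) x0 u k w) (u k w) i j)).
Proof.
move=> kN.
have bx j : L2_bounded P (fun g w => state B (c g) x0 u k w j 0).
  by apply: state_L2; exact: ltnW.
have bu j : L2_bounded P (fun (g : Gamma) w => u k w j 0).
  exact: admissible_L2.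
have [K K0 HK] := growth_state_coefficients hU hL h1 kN.
split=> [i|i j].
  apply: (L2_bounded_growth (K := K) _ bx bu) => [g|g w].
    exact: (measurable_eval_cst _ kN (jointly_continuous_b h1 h4 kN i)).
  by have [+ _] := HK g (state B (c g) x0 u k w) (u k w) (uU w kN); apply.
apply: (L2_bounded_growth (K := K) _ bx bu) => [g|g w].
  exact: (measurable_eval_cst _ kN (jointly_continuous_sigma h1 h4 kN i j)).
by have [_] := HK g (state B (c g) x0 u k w) (u k w) (uU w kN); apply.
Qed.

Lemma rintegrable_running_cost k g : (k < N)%N ->
  rintegrable (fun w => cf (c g) k (state B (c g) x0 u k w) (u k w)).
Proof.
move=> kN; have [K K0 HK] := growth_running_cost hU hL h2 kN.
have b : L2_bounded P
    (fun g w => 1 + l1 (state B (c g) x0 u k w) + l1 (u k w)).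
  apply: L2_boundedD; first apply: L2_boundedD; first exact: L2_bounded_cst.
    by apply: L2_bounded_l1 => j; apply: state_L2; exact: ltnW.
  by apply: L2_bounded_l1 => j; exact: admissible_L2.
apply: (rintegrable_dom _ (rintegrableZ K (L2_bounded_rintegrable_sqr g b))) =>
  [|w].
  exact: (measurable_eval_cst _ kN (jointly_continuous_f h2 h4 kN)).
by apply: HK; exact: uU.
Qed.

Lemma measurable_terminal h (g : Gamma) :
  jointly_continuous [set: 'cV[R]_m] (fun g x (_ : 'cV[R]_m) => h g x) ->
  measurable_fun [set: Omega] (fun w => h g (state B (c g) x0 u N w)).
Proof.
move=> hc.
exact: (measurable_eval_terminal x0 hsep h1 h4 uU (observes_cst hB hu g) hc).
Qed.

Lemma rintegrable_terminal_cost g :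
  rintegrable (fun w => cphi (c g) (state B (c g) x0 u N w)).
Proof.
have [K K0 HK] := growth_terminal_cost hL h2 g.
have b : L2_bounded P (fun g w => 1 + l1 (state B (c g) x0 u N w)).
  apply: L2_boundedD; first exact: L2_bounded_cst.
  by apply: L2_bounded_l1 => j; apply: state_L2.
apply: (rintegrable_dom _ (rintegrableZ K (L2_bounded_rintegrable_sqr g b))) =>
  [|w]; last exact: HK.
by apply: (measurable_terminal (h := fun g => cphi (c g)));
  exact: jointly_continuous_phi h2 h4.
Qed.

Lemma terminal_gradient_L2 i :
  L2_bounded P (fun g w => (dxphi (c g) (state B (c g) x0 u N w))^T i 0).
Proof.
under eq_fun do under eq_fun do rewrite mxE.
apply: (L2_bounded_growth (K := L) (Y := fun g w => state B (c g) x0 u N w)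
  (Z := fun _ _ => (0 : 'cV[R]_0))) => [g|j|[]//|g w].
- apply: (measurable_terminal (h := fun g x => dxphi (c g) x 0 i)).
  exact: jointly_continuous_dxphi h2 h4 i.
- exact: state_L2.
- have [_ /(_ g)[_ _ /(_ (state B (c g) x0 u N w))]] := h2.
  move=> H; apply: le_trans (entry_le_enorm _ 0 i) _; apply: le_trans H _.
  rewrite ler_pM2l// -addrA lerD2l (le_trans (enorm_le_l1 _))// lerDl.
  exact: l1_ge0.
Qed.

(** The common shape of the gradients of the Hamiltonian in [x] and in [u]. *)
Lemma gradient_L2 {a : nat} (A : Gamma -> Omega -> 'M[R]_(n, a))
    (S : 'I_d -> Gamma -> Omega -> 'M[R]_(n, a))
      (b : Gamma -> Omega -> 'rV[R]_a)
    (p : Gamma -> Omega -> 'cV[R]_n) (r : Gamma -> Omega -> 'M[R]_(n, d)) i :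
  (forall g, mx_measurable (A g)) -> (forall g w, enorm (A g w) <= L) ->
  (forall l g, mx_measurable (S l g)) -> (forall l g w, enorm (S l g w) <= L) ->
  (forall i, L2_bounded P (fun g w => b g w 0 i)) ->
  (forall j, L2_bounded P (fun g w => p g w j 0)) ->
  (forall j l, L2_bounded P (fun g w => r g w j l)) ->
  L2_bounded P (fun g w => ((A g w)^T *m p g w
    + \sum_l (S l g w)^T *m col l (r g w) + (b g w)^T) i 0).
Proof.
move=> mA AL mS SL bb bp br.
have -> : (fun g w => ((A g w)^T *m p g w
      + \sum_l (S l g w)^T *m col l (r g w) + (b g w)^T) i 0) =
    (fun g w => \sum_j A g w j i * p g w j 0
      + \sum_l \sum_j S l g w j i * r g w j l + b g w 0 i).
  apply/funext => g; apply/funext => w; rewrite !mxE summxE.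
  congr (_ + _ + _); first by apply: eq_bigr => j _; rewrite mxE.
  by apply: eq_bigr => l _; rewrite mxE; apply: eq_bigr => j _; rewrite !mxE.
apply: L2_boundedD => //; apply: L2_boundedD.
  apply: L2_bounded_sum => j; apply: L2_bounded_bounded_mul => // [g|g w].
    exact: mA.
  exact: le_trans (entry_le_enorm _ _ _) (AL g w).
apply: L2_bounded_sum => l; apply: L2_bounded_sum => j.
apply: L2_bounded_bounded_mul => // [g|g w]; first exact: mS.
exact: le_trans (entry_le_enorm _ _ _) (SL l g w).
Qed.

Section HamiltonianGradientL2.
Variables (k : nat) (p : Gamma -> Omega -> 'cV[R]_n).
Variables (r : Gamma -> Omega -> 'M[R]_(n, d)).
Hypothesis kN : (k < N)%N.
Hypothesis bp : forall j, L2_bounded P (fun g w => p g w j 0).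
Hypothesis br : forall j l, L2_bounded P (fun g w => r g w j l).

Let bx j : L2_bounded P (fun g w => state B (c g) x0 u k w j 0).
Proof. by apply: state_L2; exact: ltnW. Qed.

Let bu j : L2_bounded P (fun (g : Gamma) w => u k w j 0).
Proof. exact: admissible_L2. Qed.

Lemma dx_hamiltonian_L2 i : L2_bounded P (fun g w =>
  dx_hamiltonian (c g) k (state B (c g) x0 u k w) (u k w) (p g w) (r g w) i 0).
Proof.
have [_ HC] := h1 kN; have [/(_ k kN)[_ HF] _] := h2.
apply: gradient_L2 => //.
- move=> g a b;
    exact: (measurable_eval_cst _ kN (jointly_continuous_dxb h1 h4 kN a b)).
- by move=> g w; have [_ _ H _] := HC g; have [] := H (state B (c g) x0 u k w) _
    (uU w kN).
- move=> l g a b;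
    exact: (measurable_eval_cst _ kN (jointly_continuous_dxsigma h1 h4 kN l a
    b)).
- by move=> l g w; have [_ _ _ H] := HC g;
    have [] := H l (state B (c g) x0 u k w) _ (uU w kN).
- move=> a; apply: (L2_bounded_growth (K := L) _ bx bu) => [g|g w].
    exact: (measurable_eval_cst _ kN (jointly_continuous_dxf h2 h4 kN 0 a)).
  have [_ /(_ (state B (c g) x0 u k w) _ (uU w kN))[H _]] := HF g.
  apply: le_trans (entry_le_enorm _ _ _) _; apply: le_trans H _.
  by rewrite ler_pM2l// !lerD// enorm_le_l1.
Qed.

Lemma du_hamiltonian_L2 i : L2_bounded P (fun g w =>
  du_hamiltonian (c g) k (state B (c g) x0 u k w) (u k w) (p g w) (r g w) i 0).
Proof.
have [_ HC] := h1 kN; have [/(_ k kN)[_ HF] _] := h2.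
apply: gradient_L2 => //.
- move=> g a b;
    exact: (measurable_eval_cst _ kN (jointly_continuous_dub h1 h4 kN a b)).
- by move=> g w; have [_ _ H _] := HC g; have [] := H (state B (c g) x0 u k w) _
    (uU w kN).
- move=> l g a b;
    exact: (measurable_eval_cst _ kN (jointly_continuous_dusigma h1 h4 kN l a
    b)).
- by move=> l g w; have [_ _ _ H] := HC g;
    have [] := H l (state B (c g) x0 u k w) _ (uU w kN).
- move=> a; apply: (L2_bounded_growth (K := L) _ bx bu) => [g|g w].
    exact: (measurable_eval_cst _ kN (jointly_continuous_duf h2 h4 kN 0 a)).
  have [_ /(_ (state B (c g) x0 u k w) _ (uU w kN))[_ H]] := HF g.
  apply: le_trans (entry_le_enorm _ _ _) _; apply: le_trans H _.
  by rewrite ler_pM2l// !lerD// enorm_le_l1.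
Qed.

End HamiltonianGradientL2.

Lemma condexp_pair_L2 k (X : Gamma -> Omega -> 'cV[R]_n)
    (p : Gamma -> Omega -> 'cV[R]_n) (r : Gamma -> Omega -> 'M[R]_(n, d)) :
  (k < N)%N -> (forall i, L2_bounded P (fun g w => X g w i 0)) ->
  (forall g, is_condexp_mx P (past B k) (X g) (p g)) ->
  (forall g, is_condexp_mx P (past B k) (fun w => X g w *m (B k.+1 w)^T) (r g))
    ->
  (forall i, L2_bounded P (fun g w => p g w i 0)) /\
  (forall i j, L2_bounded P (fun g w => r g w i j)).
Proof.
move=> kN bX cp cr; have Gm := past_sub hB (ltnW kN); split=> [i|i j].
  apply: (L2_bounded_condexp Gm (L2_factor1 P (past B k)) ltr01 (bX i)) => g.
  by under eq_fun do rewrite mulr1; exact: cp.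
have [C C0 HC] := noise_L2_factor hB j kN.
apply: (L2_bounded_condexp Gm HC C0 (bX i)) => g.
have := cr g i j; congr (is_condexp _ _ _ _); apply/funext => w.
by rewrite mxE big_ord1 mxE.
Qed.

Variables (Padj : Gamma -> nat -> Omega -> 'cV[R]_n).
Variables (Qadj : Gamma -> nat -> Omega -> 'M[R]_(n, d)).
Hypothesis hadj : forall g, is_adjoint P N B (c g) x0 u (Padj g) (Qadj g).

(** The gradient of the cost-to-go along the trajectory: the terminal one at
    time [N], the state gradient of the Hamiltonian before. With it, both cases
    of the adjoint equation take the same form, [adjoint_costate]. *)
Definition costate (g : Gamma) (k : nat) (w : Omega) : 'cV[R]_n :=
  if (k < N)%N then
    dx_hamiltonian (c g) k (state B (c g) x0 u k w) (u k w)
      (Padj g k w) (Qadj g k w)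
  else (dxphi (c g) (state B (c g) x0 u N w))^T.

Lemma adjoint_costate g k : (k < N)%N ->
  is_condexp_mx P (past B k) (costate g k.+1) (Padj g k) /\
  is_condexp_mx P (past B k) (fun w => costate g k.+1 w *m (B k.+1 w)^T)
    (Qadj g k).
Proof.
move=> kN; have [T1 T2 S1 S2] := hadj g; rewrite /costate.
have [kN1|] := boolP (k.+1 < N)%N; first by split; [exact: S1|exact: S2].
rewrite -leqNgt => Nk; have NE : N = k.+1 by apply/eqP; rewrite eqn_leq Nk.
by move: T1 T2; rewrite NE /=.
Qed.

(** Backward induction: the costate at time [k.+1] is affine in the adjoint
    variables at that time, with bounded coefficients, and conditioning
    preserves L2 bounds. *)
Lemma adjoint_L2 k : (k < N)%N ->
  [/\ forall i, L2_bounded P (fun g w => costate g k.+1 w i 0),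
      forall i, L2_bounded P (fun g w => Padj g k w i 0) &
      forall i j, L2_bounded P (fun g w => Qadj g k w i j)].
Proof.
have step l : (l < N)%N ->
    (forall i, L2_bounded P (fun g w => costate g l.+1 w i 0)) ->
    [/\ forall i, L2_bounded P (fun g w => costate g l.+1 w i 0),
      forall i, L2_bounded P (fun g w => Padj g l w i 0) &
      forall i j, L2_bounded P (fun g w => Qadj g l w i j)].
  move=> lN bc.
  have [bp br] := condexp_pair_L2 lN bc (fun g => (adjoint_costate g lN).1)
    (fun g => (adjoint_costate g lN).2).
  by [].
(* Induction on the number of steps that separate [k] from the last time. *)
move=> kN; have -> : k = (N - (N - k.+1).+1)%N by lia.
have : (N - k.+1 < N)%N by lia.
elim: (N - k.+1)%N => [|j ih] jN.
  apply: step => [|i]; first by lia.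
  rewrite /costate (_ : ((N - 1).+1 < N)%N = false); last by lia.
  exact: terminal_gradient_L2.
have [_ bp br] := ih (ltnW jN).
apply: step => [|i]; first by lia.
have E : (N - j.+2).+1 = (N - j.+1)%N by lia.
rewrite /costate E (_ : (N - j.+1 < N)%N = true); last by lia.
by apply: dx_hamiltonian_L2 => //; lia.
Qed.

End OneControl.
End L2Dynamics.

(** * Duality between the state and the adjoint variables *)

Section Duality.
Context {R : realType} {dO : measure_display} {Omega : measurableType dO}.
Variables (P : probability Omega R) (G : set (set Omega)) (n d : nat).
Hypothesis Gm : G `<=` measurable.

Notation rintegrable f := (P.-integrable [set: Omega] (EFin \o f)).
Notation Gmeas f := (measurable_fun [set: g_sigma_algebraType G]
  (f : g_sigma_algebraType G -> R)).
Notation L2 f := (L2_bounded P (fun (_ : unit) w => f w)).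

Lemma L2_bounded_at (I : Type) (X : I -> Omega -> R) i : L2_bounded P X ->
  L2 (X i).
Proof. by move=> [C HC]; exists C => _; exact: HC. Qed.

Lemma L2_rintegrable_mul (f g : Omega -> R) : L2 f -> L2 g ->
  rintegrable (fun w => f w * g w).
Proof. exact: (L2_bounded_rintegrable_mul tt). Qed.

Lemma rintegrable_dot {a : nat} (X Y : Omega -> 'cV[R]_a) :
  (forall i, L2 (fun w => X w i 0)) -> (forall i, L2 (fun w => Y w i 0)) ->
  rintegrable (fun w => dot (X w) (Y w)).
Proof. by move=> bX bY; apply: rintegrable_sum => i;
  exact: L2_rintegrable_mul. Qed.

(** [p] and [r] condition [X] and [X b^T], and the increments [y] and [z] are
    known to [G]: each product of entries is an instance of
    [condexp_pull_out]. *)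
Lemma Rintegral_duality (X p : Omega -> 'cV[R]_n) (r : Omega -> 'M[R]_(n, d))
    (b : Omega -> 'cV[R]_d) (y : Omega -> 'cV[R]_n)
      (z : Omega -> 'M[R]_(n, d)) :
  (forall i, exists2 C, 0 < C & L2_factor P G (fun w => b w i 0) C) ->
  is_condexp_mx P G X p -> is_condexp_mx P G (fun w => X w *m (b w)^T) r ->
  (forall i, L2 (fun w => X w i 0)) -> (forall i, L2 (fun w => p w i 0)) ->
  (forall i j, L2 (fun w => r w i j)) ->
  (forall i, L2 (fun w => y w i 0)) -> (forall i, Gmeas (fun w => y w i 0)) ->
  (forall i j, L2 (fun w => z w i j)) ->
    (forall i j, Gmeas (fun w => z w i j)) ->
  \int[P]_w dot (X w) (y w + z w *m b w) =
  \int[P]_w (dot (p w) (y w) + \sum_(j < d) dot (col j (r w)) (col j (z w))).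
Proof.
move=> fb cp cr bX bp br by_ my bz mz.
have bzb i j : L2 (fun w => z w i j * b w j 0).
  have [C C0 HC] := fb j.
  exact: (L2_bounded_mul_factor Gm HC (fun=> mz i j) (bz i j) C0).
have cr' i j : is_condexp P G (fun w => X w i 0 * b w j 0) (fun w => r w i j).
  have := cr i j; congr (is_condexp _ _ _ _); apply/funext => w.
  by rewrite mxE big_ord1 mxE.
have i1 i j : rintegrable (fun w => X w i 0 * b w j 0 * z w i j).
  have := L2_rintegrable_mul (bX i) (bzb i j).
  by under eq_fun do rewrite (mulrC (z _ i j)) mulrA.
transitivity (\int[P]_w (\sum_i X w i 0 * y w i 0
    + \sum_(j < d) \sum_i X w i 0 * b w j 0 * z w i j)).
  apply: eq_Rintegral => w _; rewrite /dot exchange_big /= -big_split /=.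
  apply: eq_bigr => i _; rewrite !mxE mulrDr; congr (_ + _).
  by rewrite mulr_sumr; apply: eq_bigr => j _;
    rewrite -mulrA [b _ _ _ * _]mulrC.
have irz i j : rintegrable (fun w => col j (r w) i 0 * col j (z w) i 0).
  by under eq_fun do rewrite !mxE; exact: L2_rintegrable_mul.
rewrite [RHS]RintegralD//; last 2 first.
- exact: rintegrable_dot.
- by apply: rintegrable_sum => j; apply: rintegrable_sum => i; exact: irz.
rewrite RintegralD//; last 2 first.
- by apply: rintegrable_sum => i; exact: L2_rintegrable_mul.
- by apply: rintegrable_sum => j; apply: rintegrable_sum => i; exact: i1.
congr (_ + _).
  rewrite /dot !Rintegral_sum => [|i|i]; [|exact: L2_rintegrable_mul|exact:
    L2_rintegrable_mul].
  apply: eq_bigr => i _.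
  by apply: (condexp_pull_out Gm (cp i 0)) => //; exact: L2_rintegrable_mul.
rewrite /dot !Rintegral_sum => [|j|j]; first last.
- by apply: rintegrable_sum => i; exact: i1.
- by apply: rintegrable_sum => i; exact: irz.
apply: eq_bigr => j _; rewrite !Rintegral_sum => [|i|i]; [|exact: irz|exact:
  i1].
apply: eq_bigr => i _; under [RHS]eq_Rintegral do rewrite !mxE.
by apply: (condexp_pull_out Gm (cr' i j)) => //; exact: L2_rintegrable_mul.
Qed.

End Duality.

(** * The cost gap for a fixed parameter *)

Section FixedParameter.
Context {R : realType} {dO : measure_display} {Omega : measurableType dO}.
Variables (P : probability Omega R) (N n m d : nat).
Variables (B : nat -> Omega -> 'cV[R]_d) (U : nat -> set 'cV[R]_m) (q : R).
Context {Gamma : pmetricType R}.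
Variables (c : Gamma -> coeffs R n m d) (x0 : 'cV[R]_n) (L : R).
Hypothesis hB : noise P N B.
Hypothesis hsep : exists2 D : set Gamma, countable D & dense D.
Hypothesis hL : 0 < L.
Hypothesis hU : forall k, (k < N)%N -> convex_controls (U k).
Hypotheses (h1 : H1 N U c L) (h2 : H2 N U c L) (h4 : H4 N U c).
Hypothesis hq : 2 < q.
Variables ustar v : nat -> Omega -> 'cV[R]_m.
Hypotheses (hustar : admissible P N B U q ustar) (hv : admissible P N B U q v).
Variables (Padj : Gamma -> nat -> Omega -> 'cV[R]_n).
Variables (Qadj : Gamma -> nat -> Omega -> 'M[R]_(n, d)).
Hypothesis hadj : forall g, is_adjoint P N B (c g) x0 ustar (Padj g) (Qadj g).
Hypothesis h6 : H6 P N U c Padj Qadj.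

Notation rintegrable f := (P.-integrable [set: Omega] (EFin \o f)).
Notation L2 f := (L2_bounded P (fun (_ : unit) w => f w)).

Lemma dot_mulmx {a : nat} (x y : 'cV[R]_a) : (x^T *m y) 0 0 = dot x y.
Proof. by rewrite -dotE mxE eqxx mulr1n. Qed.

Lemma dotBr {a : nat} (x y z : 'cV[R]_a) : dot x (y - z) = dot x y - dot x z.
Proof. by rewrite -!dot_mulmx mulmxBr !mxE. Qed.

Definition control_gradient (g : Gamma) (k : nat) (w : Omega) : 'cV[R]_m :=
  du_hamiltonian (c g) k (state B (c g) x0 ustar k w) (ustar k w)
    (Padj g k w) (Qadj g k w).

Section Fixed.
Variable g : Gamma.

Let xs k w := state B (c g) x0 ustar k w.
Let xv k w := state B (c g) x0 v k w.
Let Z := costate N B c x0 ustar Padj Qadj g.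

Let xs_L2 k i : (k <= N)%N -> L2 (fun w => xs k w i 0).
Proof.
by move=> kN;
  exact: (L2_bounded_at g (state_L2 x0 hB hsep hL hU h1 h4 hq hustar i kN)).
Qed.

Let xv_L2 k i : (k <= N)%N -> L2 (fun w => xv k w i 0).
Proof.
by move=> kN;
  exact: (L2_bounded_at g (state_L2 x0 hB hsep hL hU h1 h4 hq hv i kN)).
Qed.

Let dx_L2 k i : (k <= N)%N -> L2 (fun w => (xv k w - xs k w) i 0).
Proof.
move=> kN; under eq_fun do under eq_fun do rewrite !mxE.
by apply: L2_boundedB; [exact: xv_L2|exact: xs_L2].
Qed.

Let du_L2 k i : (k < N)%N -> L2 (fun w => (v k w - ustar k w) i 0).
Proof.
move=> kN; under eq_fun do under eq_fun do rewrite !mxE.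
by apply: L2_boundedB;
  [exact: (admissible_L2 hB hq hv unit i kN)
  |exact: (admissible_L2 hB hq hustar unit i kN)].
Qed.

Let adj_L2 k (kN : (k < N)%N) :=
  adjoint_L2 hB hsep hL hU h1 h2 h4 hq hustar hadj kN.

Let Z_L2 k i : (k <= N)%N -> L2 (fun w => Z k w i 0).
Proof.
case: k => [_|k kN]; last by have [bz _ _] := adj_L2 kN;
  exact: (L2_bounded_at g (bz i)).
rewrite /Z /costate; have [N0|_] := boolP (0 < N)%N.
  have [_ bp br] := adj_L2 N0.
  exact: (L2_bounded_at g (dx_hamiltonian_L2 x0 hB hsep hL hU h1 h2 h4 hq hustar
    N0 bp br i)).
exact: (L2_bounded_at g (terminal_gradient_L2 x0 hB hsep hL hU h1 h2 h4 hq
  hustar i)).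
Qed.

Let G_L2 k i : (k < N)%N -> L2 (fun w => control_gradient g k w i 0).
Proof.
move=> kN; have [_ bp br] := adj_L2 kN.
exact: (L2_bounded_at g (du_hamiltonian_L2 x0 hB hsep hL hU h1 h2 h4 hq hustar
  kN bp br i)).
Qed.

(** Duality turns the last integral into the mean increment of the part of the
    Hamiltonian that is linear in the adjoint variables; adding the running
    cost gives the full Hamiltonian, whose increment dominates its gradient by
    convexity. *)
Lemma hamiltonian_step k : (k < N)%N ->
  \int[P]_w dot (Z k w) (xv k w - xs k w)
    + \int[P]_w dot (control_gradient g k w) (v k w - ustar k w) <=
  \int[P]_w (cf (c g) k (xv k w) (v k w) - cf (c g) k (xs k w) (ustar k w))
    + \int[P]_w dot (Z k.+1 w) (xv k.+1 w - xs k.+1 w).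
Proof.
move=> kN; have kN' := ltnW kN.
have [_ bp br] := adj_L2 kN.
pose db w := cb (c g) k (xv k w) (v k w) - cb (c g) k (xs k w) (ustar k w).
pose ds w := csigma (c g) k (xv k w) (v k w)
  - csigma (c g) k (xs k w) (ustar k w).
have [bv sv] := coefficients_L2 x0 hB hsep hL hU h1 h4 hq hv kN.
have [bs ss] := coefficients_L2 x0 hB hsep hL hU h1 h4 hq hustar kN.
have db_L2 i : L2 (fun w => db w i 0).
  under eq_fun do under eq_fun do rewrite !mxE.
  by apply: L2_boundedB; [exact: (L2_bounded_at g (bv i))|exact:
    (L2_bounded_at g (bs i))].
have ds_L2 i j : L2 (fun w => ds w i j).
  under eq_fun do under eq_fun do rewrite !mxE.
  by apply: L2_boundedB; [exact: (L2_bounded_at g (sv i j))|exact: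
    (L2_bounded_at g (ss i j))].
have db_meas i : measurable_fun [set: g_sigma_algebraType (past B k)]
    ((fun w => db w i 0) : g_sigma_algebraType (past B k) -> R).
  under eq_fun do rewrite !mxE; apply: measurable_funB.
    exact: (past_measurable_eval x0 hsep h1 h4 hv g kN
      (jointly_continuous_b h1 h4 kN i)).
  exact: (past_measurable_eval x0 hsep h1 h4 hustar g kN
    (jointly_continuous_b h1 h4 kN i)).
have ds_meas i j : measurable_fun [set: g_sigma_algebraType (past B k)]
    ((fun w => ds w i j) : g_sigma_algebraType (past B k) -> R).
  under eq_fun do rewrite !mxE; apply: measurable_funB.
    exact: (past_measurable_eval x0 hsep h1 h4 hv g kN
      (jointly_continuous_sigma h1 h4 kN i j)).
  exact: (past_measurable_eval x0 hsep h1 h4 hustar g kN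
    (jointly_continuous_sigma h1 h4 kN i j)).
have [cp cr] := adjoint_costate hadj g kN.
have -> : \int[P]_w dot (Z k.+1 w) (xv k.+1 w - xs k.+1 w) =
    \int[P]_w dot (Z k.+1 w) (db w + ds w *m B k.+1 w).
  by apply: eq_Rintegral => w _; rewrite /xv /xs /= opprD addrACA -mulmxBl.
rewrite (Rintegral_duality (past_sub hB kN') _ cp cr)//; last 4 first.
- move=> i; have [C C0 HC] := noise_L2_factor hB i kN.
  by exists C.
- by move=> i; exact: Z_L2.
- by move=> i; exact: (L2_bounded_at g (bp i)).
- by move=> i j; exact: (L2_bounded_at g (br i j)).
have iZ : rintegrable (fun w => dot (Z k w) (xv k w - xs k w)).
  by apply: rintegrable_dot => i; [exact: Z_L2|exact: dx_L2].
have iG : rintegrable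
  (fun w => dot (control_gradient g k w) (v k w - ustar k w)).
  by apply: rintegrable_dot => i; [exact: G_L2|exact: du_L2].
have idf : rintegrable (fun w => cf (c g) k (xv k w) (v k w)
    - cf (c g) k (xs k w) (ustar k w)).
  apply: rintegrableB.
    exact: (rintegrable_running_cost x0 hB hsep hL hU h1 h2 h4 hq hv g kN).
  exact: (rintegrable_running_cost x0 hB hsep hL hU h1 h2 h4 hq hustar g kN).
have ipq : rintegrable (fun w => dot (Padj g k w) (db w)
    + \sum_(j < d) dot (col j (Qadj g k w)) (col j (ds w))).
  apply: rintegrableD; first by apply: rintegrable_dot => i //;
    exact: (L2_bounded_at g (bp i)).
  apply: rintegrable_sum => j; apply: rintegrable_dot => i.
    by under eq_fun do under eq_fun do rewrite mxE;
      exact: (L2_bounded_at g (br i j)).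
  by under eq_fun do under eq_fun do rewrite mxE; exact: ds_L2.
rewrite -!RintegralD//.
apply: le_Rintegral_ae; [exact: rintegrableD|exact: rintegrableD|].
have [_ /(_ k kN)] := h6 g; apply: filterS => w cH.
have [_ HC] := h1 kN; have [/(_ k kN)[_ HF] _] := h2.
have [Cb Cs _ _] := HC g; have [Cf _] := HF g.
have CH := C1_on_hamiltonian (Padj g k w) (Qadj g k w) Cb Cs Cf.
have [_ Us _] := hustar; have [_ Uv _] := hv.
have := @convex_gradient_le _ _ _ (U k)
  (fun x u => hamiltonian (c g) k x u (Padj g k w) (Qadj g k w)) _ _
  (xs k w) (ustar k w) (xv k w) (v k w) (hU kN) CH cH (Us k w kN) (Uv k w kN).
rewrite mxE !dot_mulmx /Z /costate kN => /le_trans; apply.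
rewrite /hamiltonian le_eqVlt; apply/orP; left; apply/eqP.
rewrite /db dotBr.
have -> : \sum_(j < d) dot (col j (Qadj g k w)) (col j (ds w)) =
    \sum_(j < d) dot (col j (Qadj g k w))
      (col j (csigma (c g) k (xv k w) (v k w)))
    - \sum_(j < d) dot (col j (Qadj g k w))
        (col j (csigma (c g) k (xs k w) (ustar k w))).
  rewrite -sumrB; apply: eq_bigr => j _; rewrite -dotBr; congr dot.
  by rewrite /ds; apply/matrixP => i l; rewrite !mxE.
by ring.
Qed.

Lemma terminal_step :
  \int[P]_w dot (Z N w) (xv N w - xs N w) <=
  \int[P]_w (cphi (c g) (xv N w) - cphi (c g) (xs N w)).
Proof.
apply: le_Rintegral => //.
- by apply: rintegrable_dot => i; [exact: Z_L2|exact: dx_L2].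
- apply: rintegrableB.
    exact: (rintegrable_terminal_cost x0 hB hsep hL hU h1 h2 h4 hq hv g).
  exact: (rintegrable_terminal_cost x0 hB hsep hL hU h1 h2 h4 hq hustar g).
move=> w _; have [_ /(_ g)[dphi cphi' _]] := h2.
have [cvx _] := h6 g.
have cT : convex_controls [set: 'cV[R]_m] by [].
have cvx' : convex_function (dom [set: 'cV[R]_m])
    (fun z : 'cV[R]_n * 'cV[R]_m => cphi (c g) z.1).
  by move=> t x y _ _; apply: (cvx t x.1 y.1); rewrite inE.
have := @convex_gradient_le _ _ _ setT (fun x _ => cphi (c g) x) _ _
  (xs N w) 0 (xv N w) 0 cT (@C1_on_state R n m _ _ dphi cphi') cvx' I I.
by rewrite mul0mx addr0 -[dxphi _ _]trmxK dot_mulmx /Z /costate ltnn.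
Qed.

(** Telescoping [hamiltonian_step] from time 0, where the two states agree, to
    time [N], where [terminal_step] takes over. *)
Lemma value_gap : (value P N B (c g) x0 ustar
   + (\sum_(k < N) \int[P]_w dot (control_gradient g k w)
        (v k w - ustar k w))%:E <= value P N B (c g) x0 v)%E.
Proof.
have ifs (k : 'I_N) := rintegrable_running_cost x0 hB hsep hL hU h1 h2 h4 hq
  hustar g (ltn_ord k).
have ifv (k : 'I_N) := rintegrable_running_cost x0 hB hsep hL hU h1 h2 h4 hq hv
  g (ltn_ord k).
have ips := rintegrable_terminal_cost x0 hB hsep hL hU h1 h2 h4 hq hustar g.
have ipv := rintegrable_terminal_cost x0 hB hsep hL hU h1 h2 h4 hq hv g.
have sfs : rintegrable (fun w => \sum_(k < N)
    cf (c g) k (state B (c g) x0 ustar k w)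
      (ustar k w)) by exact: rintegrable_sum.
have sfv : rintegrable (fun w => \sum_(k < N)
    cf (c g) k (state B (c g) x0 v k w) (v k w)) by exact: rintegrable_sum.
rewrite /value unlock !EFin_Rintegral ?lee_fin; [|exact: rintegrableD|exact:
  rintegrableD].
rewrite !RintegralD// !Rintegral_sum//.
pose S k := \int[P]_w dot (Z k w) (xv k w - xs k w).
pose D k := \int[P]_w dot (control_gradient g k w) (v k w - ustar k w).
pose fs k := \int[P]_w cf (c g) k (xs k w) (ustar k w).
pose fv k := \int[P]_w cf (c g) k (xv k w) (v k w).
have S0 : S 0%N = 0.
  rewrite /S /xv /xs /=; under eq_Rintegral do rewrite subrr.
  rewrite (_ : (fun _ => _) = cst 0); first by rewrite Rintegral_cst// mul0r.
  by apply/funext => w; rewrite /dot big1// => i _; rewrite mxE mulr0.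
have tele k : (k <= N)%N ->
    \sum_(0 <= j < k) (fs j + D j) <= \sum_(0 <= j < k) fv j + S k.
  elim: k => [_|k ih kN]; first by rewrite !big_geq// S0 addr0.
  have := ih (ltnW kN); have := hamiltonian_step kN.
  rewrite !big_nat_recr//= -/(S k) -/(D k) -/(S k.+1) RintegralB//;
    last 2 first.
  - exact: (ifv (Ordinal kN)).
  - exact: (ifs (Ordinal kN)).
  rewrite -/(fs k) -/(fv k); lra.
have := tele N (leqnn N); rewrite big_split /= !big_mkord.
have := terminal_step; rewrite RintegralB// -/(S N) /xv /xs /fs /fv /D.
lra.
Qed.

End Fixed.
End FixedParameter.

(** * Comparison of extended integrals *)

Section IntegralComparison.
Context {R : realType} {dT : measure_display} {T : measurableType dT}.
Variable mu : {measure set T -> \bar R}.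

(** Neither [y0] nor [y1] is assumed integrable: their integrals are positive
    part minus negative part, and +oo - +oo is -oo. If the negative part of
    [y0] has infinite integral, the left side is -oo. Otherwise that of [y1]
    has a finite one, and if its positive part has infinite integral the right
    side is +oo. In the remaining case both functions are integrable. *)
Lemma integral_le_gap (y0 y1 h : T -> R) :
  measurable_fun [set: T] y0 -> measurable_fun [set: T] y1 ->
  mu.-integrable [set: T] (EFin \o h) -> (0 <= \int[mu]_x (h x)%:E)%E ->
  (forall x, y0 x + h x <= y1 x) ->
  (\int[mu]_x (y0 x)%:E <= \int[mu]_x (y1 x)%:E)%E.
Proof.
move=> m0 m1 ih h0 yh.
have mh := rintegrable_measurable ih.
have mE0 : measurable_fun [set: T] (EFin \o y0) by exact/measurable_EFinP.
have mE1 : measurable_fun [set: T] (EFin \o y1) by exact/measurable_EFinP.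
have ha : (\int[mu]_x `|(h x)%:E| < +oo)%E by have /integrableP[] := ih.
have mha : measurable_fun [set: T] (fun x => `|(h x)%:E|%E).
  by apply: measurableT_comp => //; exact/measurable_EFinP.
have bnd (f f' : T -> \bar R) : measurable_fun [set: T] f ->
    measurable_fun [set: T] f' -> (forall x, 0 <= f x)%E ->
    (forall x, 0 <= f' x)%E -> (\int[mu]_x f' x < +oo)%E ->
    (forall x, f x <= f' x + `|(h x)%:E|)%E -> (\int[mu]_x f x < +oo)%E.
  move=> mf mf' f0 f'0 f'oo ff'.
  apply: (@le_lt_trans _ _ (\int[mu]_x (f' x + `|(h x)%:E|))%E).
    by apply: ge0_le_integral => //; exact: emeasurable_funD.
  by rewrite ge0_integralD//; exact: lte_add_pinfty.
have fin_int (y : T -> R) : measurable_fun [set: T] (EFin \o y) ->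
    (\int[mu]_x (EFin \o y)^\+ x < +oo)%E ->
    (\int[mu]_x (EFin \o y)^\- x < +oo)%E -> mu.-integrable [set:
      T] (EFin \o y).
  move=> my yp yn; apply/integrableP; split=> //.
  rewrite -/(abse \o (EFin \o y)) fune_abse ge0_integralD//.
  - exact: lte_add_pinfty.
  - exact: measurable_funepos.
  - exact: measurable_funeneg.
have posE (y : T -> R) x : ((EFin \o y)^\+ x = (Num.max (y x) 0)%:E)%E.
  by rewrite funeposE /= EFin_max.
have negE (y : T -> R) x : ((EFin \o y)^\- x = (Num.max (- y x)%R 0)%:E)%E.
  by rewrite funenegE /= EFin_max.
have [n0|] := ltP (\int[mu]_x (EFin \o y0)^\- x)%E +oo%E; last first.
  rewrite leye_eq => /eqP n0.
  rewrite integralE -/(EFin \o y0) n0 addeNy; exact: leNye.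
have n1 : (\int[mu]_x (EFin \o y1)^\- x < +oo)%E.
  apply: bnd n0 _ => //; [exact: measurable_funeneg|exact: measurable_funeneg|].
  move=> x; rewrite !negE -EFinD lee_fin.
  have := yh x; have := ler_norm (- h x); rewrite normrN => ? ?.
  rewrite ge_max; apply/andP; split.
    have : - y0 x <= Num.max (- y0 x) 0 by rewrite le_max lexx.
    by lra.
  by rewrite addr_ge0// le_max lexx orbT.
have [p1|] := ltP (\int[mu]_x (EFin \o y1)^\+ x)%E +oo%E; last first.
  rewrite leye_eq => /eqP p1.
  rewrite [leRHS]integralE -/(EFin \o y1) p1 addye; first exact: leey.
  by rewrite gt_eqF// ltNye_eq; move: n1; case: (integral _ _ _).
have p0 : (\int[mu]_x (EFin \o y0)^\+ x < +oo)%E.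
  apply: bnd p1 _ => //; [exact: measurable_funepos|exact: measurable_funepos|].
  move=> x; rewrite !posE -EFinD lee_fin.
  have := yh x; have := ler_norm (- h x); rewrite normrN => ? ?.
  rewrite ge_max; apply/andP; split.
    have : y1 x <= Num.max (y1 x) 0 by rewrite le_max lexx.
    by lra.
  by rewrite addr_ge0// le_max lexx orbT.
have i0 := fin_int _ mE0 p0 n0; have i1 := fin_int _ mE1 p1 n1.
apply: (@le_trans _ _ (\int[mu]_x ((y0 x)%:E + (h x)%:E))%E).
  by rewrite (integralD measurableT i0 ih) leeDl.
apply: le_integral => //; first exact: (rintegrableD i0 ih).
by move=> x _; rewrite -EFinD lee_fin.
Qed.

End IntegralComparison.

(** * Iterated integrals over the parameter and the noise *)

Section Fubini.
Context {R : realType} {d1 d2 : measure_display}.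
Context {T1 : measurableType d1} {T2 : measurableType d2}.
Variables (la : probability T1 R) (P : probability T2 R).

(** By Tonelli on the positive and negative parts, so that integrability on
    the product is not needed: the total cost need not be integrable in the
    parameter. *)
Lemma measurable_partial_integral (F : T1 * T2 -> \bar R) :
  measurable_fun [set: T1 * T2] F ->
  measurable_fun [set: T1] (fun x => \int[P]_y F (x, y))%E.
Proof.
move=> mF.
have -> : (fun x => \int[P]_y F (x, y))%E =
    (fun x => \int[P]_y F^\+ (x, y) - \int[P]_y F^\- (x, y))%E.
  apply/funext => x; rewrite integralE; congr (_ - _)%E.
    by apply: eq_integral => y _; rewrite !funeposE.
  by apply: eq_integral => y _; rewrite !funenegE.
apply: emeasurable_funB.
  apply: (measurable_fun_fubini_tonelli_F (F^\+)%E) => //.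
  exact: measurable_funepos.
apply: (measurable_fun_fubini_tonelli_F (F^\-)%E) => //.
exact: measurable_funeneg.
Qed.

Lemma integrable_prod_bounded (F : T1 -> T2 -> R) (C : R) :
  measurable_fun [set: T1 * T2] (fun z => F z.1 z.2) ->
  (forall x, (\int[P]_y `|(F x y)%:E| <= C%:E)%E) ->
  (la \x P)%E.-integrable [set: T1 * T2] (fun z => (F z.1 z.2)%:E).
Proof.
move=> mF FC; apply/integrable12ltyP; first exact/measurable_EFinP.
have mA : measurable_fun [set: T1 * T2] (fun z => `|(F z.1 z.2)%:E|%E).
  by apply: measurableT_comp => //; exact/measurable_EFinP.
apply: (@le_lt_trans _ _ (\int[la]_x (cst C%:E) x)%E).
  apply: ge0_le_integral => //.
  - by move=> x _; exact: integral_ge0.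
  - exact: (measurable_partial_integral mA).
  - by move=> x _; exact: FC.
rewrite integral_cst// [X in (_ * X)%E](_ : _ = 1%E) ?mule1 ?ltry//.
exact: probability_setT.
Qed.

Lemma Fubini_ge0 (F : T1 -> T2 -> R) :
  (la \x P)%E.-integrable [set: T1 * T2] (fun z => (F z.1 z.2)%:E) ->
  {ae P, forall y, (0 <= \int[la]_x (F x y)%:E)%E} ->
  (0 <= \int[la]_x \int[P]_y (F x y)%:E)%E.
Proof.
move=> iF F0; have := Fubini iF => /= ->.
have mG := measurable_fubini_G iF.
have -> : (\int[P]_y \int[la]_x (F x y)%:E =
    \int[P]_y `|\int[la]_x (F x y)%:E|)%E.
  apply: ae_eq_integral => //; first exact: measurableT_comp.
  by apply: filterS F0 => y Fy _; rewrite gee0_abs.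
exact: integral_ge0.
Qed.

End Fubini.

(** * From test points to random controls *)

Section VariationalInequality.
Context {R : realType} {m : nat}.

(** Pick a point of [V] in each ball with rational centre and radius 1/(l+1)
    that meets it. *)
Lemma dense_sequence_in (V : set 'cV[R]_m) : V !=set0 ->
  exists2 s : nat -> 'cV[R]_m, forall j, V (s j) &
    forall y (e : R), V y -> 0 < e -> exists j, ball y e (s j).
Proof.
move=> [u0 Vu0].
pose W (i : 'cV[rat]_m * nat) : set 'cV[R]_m :=
  [set y | V y /\ ball (map_mx ratr i.1 : 'cV[R]_m) i.2.+1%:R^-1 y].
pose t i := if pselect (exists y, W i y) is left H then sval (cid H) else u0.
exists (fun j => if unpickle j is Some i then t i else u0) => [j|y e Vy e0].
  case: unpickle => // i; rewrite /t; case: pselect => // H.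
  by have [] := svalP (cid H).
have e20 : 0 < e / 2 by rewrite divr_gt0.
have [l le_] : exists l : nat, l.+1%:R^-1 < e / 2.
  by have [l _ H] := near_infty_natSinv_lt (PosNum e20); exists l; apply: H =>
    /=.
have l0 : 0 < l.+1%:R^-1 :> R by rewrite invr_gt0.
have [r ry] := rat_vector_ball y l0.
exists (pickle (r, l)); rewrite pickleK /t; case: pselect => [H|]; last first.
  by case; exists y.
have [_ /= rs] := svalP (cid H).
apply: (@le_ball _ _ _ (l.+1%:R^-1 + l.+1%:R^-1)).
  by rewrite [e]splitr lerD// ltW.
by apply: ball_triangle rs; exact: ball_sym.
Qed.

(** If <G, y - a> were negative, then a point of the sequence so close to [y]
    that the inner product changes by less than its size would contradict the
    hypothesis; the radius below is |<G, y - a>| / (1 + |G|_1). *)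
Lemma dot_ge0_dense (V : set 'cV[R]_m) (s : nat -> 'cV[R]_m)
  (G a y : 'cV[R]_m) :
  (forall y (e : R), V y -> 0 < e -> exists j, ball y e (s j)) -> V y ->
  (forall j, 0 <= dot G (s j - a)) -> 0 <= dot G (y - a).
Proof.
move=> sV Vy H; rewrite leNgt; apply/negP => neg.
pose M := 1 + l1 G.
have M0 : 0 < M by rewrite ltr_pwDl// l1_ge0.
have e0 : 0 < - dot G (y - a) / M by rewrite divr_gt0// oppr_gt0.
have [j Hj] := sV y _ Vy e0; have sj := (mx_ballP _ _ e0).1 Hj.
have : dot G (s j - a) - dot G (y - a) <= l1 G * (- dot G (y - a) / M).
  rewrite -dotBr opprB addrA subrK /dot /l1 mulr_suml.
  apply: ler_sum => i _; apply: le_trans (ler_norm _) _.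
  by rewrite normrM ler_wpM2l// !mxE distrC ltW.
rewrite mulrA ler_pdivlMr// => {}Hj.
have := H j; have := l1_ge0 G; move: Hj; rewrite /M => Hj ? ?; nra.
Qed.

Context {d1 d2 : measure_display}.
Context {T1 : measurableType d1} {T2 : measurableType d2}.
Variables (la : probability T1 R) (P : probability T2 R).

(** Off a null set, the inequality holds at all points of a dense sequence of
    [V] and [G ^~ w] is integrable, so that the integral is linear in the test
    point: it is the inner product with the mean [Gb] of the gradient. *)
Lemma variational_inequality_selection (V : set 'cV[R]_m)
    (G : T1 -> T2 -> 'cV[R]_m) (a v : T2 -> 'cV[R]_m) :
  V !=set0 -> (forall w, V (v w)) ->
  (forall i, (la \x P)%E.-integrable [set: T1 * T2]
     (fun z => (G z.1 z.2 i 0)%:E)) ->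
  (forall u, V u ->
    {ae P, forall w, (0 <= \int[la]_g (dot (G g w) (u - a w))%:E)%E}) ->
  {ae P, forall w, (0 <= \int[la]_g (dot (G g w) (v w - a w))%:E)%E}.
Proof.
move=> V0 Vv iG H; have [s Vs sV] := dense_sequence_in V0.
have Hs : {ae P, forall w, forall j : nat,
    (0 <= \int[la]_g (dot (G g w) (s j - a w))%:E)%E}.
  by apply: ae_foralln => j; exact: H.
have HG : {ae P, forall w, forall i,
    la.-integrable [set: T1] (fun g => (G g w i 0)%:E)}.
  by apply: filter_forall => i; exact: (ae_integrable2 (iG i)).
apply: filterS2 Hs HG => w Hs HG.
pose Gb : 'cV[R]_m := \col_i \int[la]_g G g w i 0.
have E u : (\int[la]_g (dot (G g w) (u - a w))%:E = (dot Gb (u - a w))%:E)%E.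
  have iS i : la.-integrable [set: T1]
      (EFin \o (fun g => G g w i 0 * (u - a w) i 0)).
    have := rintegrableZ ((u - a w) i 0) (HG i).
    by under eq_fun do rewrite mulrC.
  rewrite /dot EFin_Rintegral; last exact: rintegrable_sum.
  rewrite Rintegral_sum//; congr EFin; apply: eq_bigr => i _.
  by rewrite [Gb i 0]mxE RintegralZr//; exact: (HG i).
rewrite E lee_fin; apply: (dot_ge0_dense sV (Vv w)) => j.
by rewrite -lee_fin -E.
Qed.

End VariationalInequality.

(** * The value as a function of the parameter *)

Section ValueMeasurability.
Context {R : realType} {dO : measure_display} {Omega : measurableType dO}.
Variables (P : probability Omega R) (N n m d : nat).
Variables (B : nat -> Omega -> 'cV[R]_d) (U : nat -> set 'cV[R]_m) (q : R).
Context {Gamma : pmetricType R}.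
Variables (c : Gamma -> coeffs R n m d) (x0 : 'cV[R]_n) (L : R).
Hypothesis hB : noise P N B.
Hypothesis hsep : exists2 D : set Gamma, countable D & dense D.
Hypothesis hL : 0 < L.
Hypothesis hU : forall k, (k < N)%N -> convex_controls (U k).
Hypotheses (h1 : H1 N U c L) (h2 : H2 N U c L) (h4 : H4 N U c).
Hypothesis hq : 2 < q.
Variable u : nat -> Omega -> 'cV[R]_m.
Hypothesis hu : admissible P N B U q u.

Lemma value_fin_num g : value P N B (c g) x0 u \is a fin_num.
Proof.
rewrite /value unlock; apply: integrable_fin_num => //.
apply: rintegrableD; last exact:
  (rintegrable_terminal_cost x0 hB hsep hL hU h1 h2 h4 hq hu g).
apply: rintegrable_sum => k.
exact: (rintegrable_running_cost x0 hB hsep hL hU h1 h2 h4 hq hu g (ltn_ord k)).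
Qed.

Lemma measurable_value :
  measurable_fun [set: borel Gamma] (fun g => value P N B (c g) x0 u).
Proof.
have [_ uU _] := hu.
have mF := measurable_total_cost x0 hsep h1 h2 h4
  (fun k w => uU k w) (observes_prod hB hu).
rewrite /value unlock.
move/measurable_EFinP in mF.
exact: (measurable_partial_integral P mF).
Qed.

End ValueMeasurability.
Theorem theorem3p8 (R : realType) (N n m d : nat) (hN : (0 < N)%N)
  (dO : measure_display) (Omega : measurableType dO) (P : probability Omega R)
  (hP : measure_is_complete P)
  (B : nat -> Omega -> 'cV[R]_d) (hB : noise P N B)
  (U : nat -> set 'cV[R]_m)
  (hU : forall k, (k < N)%N -> U k !=set0 /\ convex_set (U k))
  (q : R) (hq : 2 < q)
  (Gamma : pmetricType R) (hpolish : polish Gamma)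
  (hloc : locally_compact [set: Gamma])
  (Lam : set (probability (borel Gamma) R))
  (c : Gamma -> coeffs R n m d) (x0 : 'cV[R]_n)
  (L : R) (hL : 0 < L)
  (h1 : H1 N U c L) (h2 : H2 N U c L) (h3 : H3 N U c) (h4 : H4 N U c)
  (h5 : H5 Lam)
  (ustar : nat -> Omega -> 'cV[R]_m) (hustar : admissible P N B U q ustar)
  (lamstar : probability (borel Gamma) R)
  (hlamstar : worst_case P N B c Lam x0 ustar lamstar)
  (Padj : Gamma -> nat -> Omega -> 'cV[R]_n)
  (Qadj : Gamma -> nat -> Omega -> 'M[R]_(n, d))
  (hadj : forall g,
     is_adjoint P N B (c g) x0 ustar (Padj g) (Qadj g))
  (hPmeas : forall k, (k < N)%N ->
     @mx_measurable R _ (borel Gamma * Omega)%type _ _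
       (fun z => Padj z.1 k z.2))
  (hQmeas : forall k, (k < N)%N ->
     @mx_measurable R _ (borel Gamma * Omega)%type _ _
       (fun z => Qadj z.1 k z.2))
  (hvar : forall k, (k < N)%N -> forall u, U k u ->
     {ae P, forall w,
       (0 <= \int[lamstar]_g
          (dot (du_hamiltonian (c g) k (state B (c g) x0 ustar k w)
                  (ustar k w) (Padj g k w) (Qadj g k w))
               (u - ustar k w))%:E)%E})
  (h6 : H6 P N U c Padj Qadj) :
  optimal P N B U q c Lam x0 ustar.
Proof.
have hsep := hpolish.1.
have hU' k : (k < N)%N -> convex_controls (U k).
  by move=> kN; apply: convex_set_segment; have [] := hU k kN.
split=> // v hv; have [Lamstar ->] := hlamstar.
apply: (@le_trans _ _ (robust_value P N B c x0 v lamstar)); last first.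
  by apply: ereal_sup_ubound; exists lamstar.
pose G := control_gradient B c x0 ustar Padj Qadj.
have [_ Uv _] := hv; have [_ Us _] := hustar.
have G_L2 k i : (k < N)%N -> L2_bounded P (fun g w => G g k w i 0).
  move=> kN; have [_ bp br] :=
    adjoint_L2 hB hsep hL hU' h1 h2 h4 hq hustar hadj kN.
  exact: (du_hamiltonian_L2 x0 hB hsep hL hU' h1 h2 h4 hq hustar kN bp br i).
have du_L2 k i : (k < N)%N ->
    L2_bounded P (fun (_ : Gamma) w => (v k w - ustar k w) i 0).
  move=> kN; under eq_fun do under eq_fun do rewrite !mxE.
  by apply: L2_boundedB; [exact: (admissible_L2 hB hq hv Gamma i kN)
    |exact: (admissible_L2 hB hq hustar Gamma i kN)].
have G_meas k : (k < N)%N -> mx_measurable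
    (fun z : borel Gamma * Omega => G z.1 k z.2).
  move=> kN; apply: (mx_measurable_du_hamiltonian x0 hsep h1 h2 h4
    (fun k w => Us k w) kN (observesW kN (observes_prod hB hustar))).
    exact: hPmeas.
  exact: hQmeas.
have u_meas (u : nat -> Omega -> 'cV[R]_m) (hu : admissible P N B U q u) k i :
    (k < N)%N -> measurable_fun [set: borel Gamma * Omega]
      (fun z : borel Gamma * Omega => u k z.2 i 0).
  by move=> kN; have [_ _ H] := observes_prod hB hu (Gamma := Gamma); exact: H.
have G_int k i : (k < N)%N -> (lamstar \x P)%E.-integrable
    [set: borel Gamma * Omega] (fun z => (G z.1 k z.2 i 0)%:E).
  move=> kN.
  have [C HC] := L2_bounded_mul_bound (G_L2 k i kN) (L2_bounded_cst P Gamma 1).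
  apply: (@integrable_prod_bounded _ _ _ _ _ lamstar P
    (fun g w => G g k w i 0) C).
    exact: G_meas.
  by move=> g; have := HC g; under eq_integral do rewrite mulr1.
pose D g k := \int[P]_w dot (G g k w) (v k w - ustar k w).
have J_int k : (k < N)%N -> (lamstar \x P)%E.-integrable
    [set: borel Gamma * Omega]
    (fun z => (dot (G z.1 k z.2) (v k z.2 - ustar k z.2))%:E).
  move=> kN; apply: (@rintegrable_sum _ _ _ (lamstar \x P)%E _ _
    (fun i z => G z.1 k z.2 i 0 * (v k z.2 - ustar k z.2) i 0)) => i.
  have [C HC] := L2_bounded_mul_bound (G_L2 k i kN) (du_L2 k i kN).
  apply: (@integrable_prod_bounded _ _ _ _ _ lamstar P
    (fun g w => G g k w i 0 * (v k w - ustar k w) i 0) C) => //.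
  apply: measurable_funM; first exact: G_meas.
  by under eq_fun do rewrite !mxE; apply: measurable_funB; exact: u_meas.
have gap_rintegrable g k : (k < N)%N -> P.-integrable [set: Omega]
    (EFin \o (fun w => dot (G g k w) (v k w - ustar k w))).
  move=> kN; apply: rintegrable_sum => i.
  exact: (L2_bounded_rintegrable_mul g (G_L2 k i kN) (du_L2 k i kN)).
have D_int k : (k < N)%N ->
    lamstar.-integrable [set: borel Gamma] (EFin \o (fun g => D g k)).
  move=> kN; have := integrable_fubini_F (J_int k kN).
  by congr (_.-integrable _ _); apply/funext => g /=;
    rewrite /fubini_F EFin_Rintegral//; exact: gap_rintegrable.
have D_ge0 k : (k < N)%N -> (0 <= \int[lamstar]_g (D g k)%:E)%E.
  move=> kN; have [V0 _] := hU k kN.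
  have := Fubini_ge0 (J_int k kN)
    (variational_inequality_selection V0 (fun w => Uv k w kN)
      (fun i => G_int k i kN) (hvar k kN)).
  by under eq_integral do rewrite EFin_Rintegral ?gap_rintegrable//.
have fE u (hu : admissible P N B U q u) g :
    ((fine (value P N B (c g) x0 u))%:E = value P N B (c g) x0 u)%E.
  by rewrite fineK//; exact: (value_fin_num x0 hB hsep hL hU' h1 h2 h4 hq hu g).
have rE u (hu : admissible P N B U q u) : (robust_value P N B c x0 u lamstar
    = \int[lamstar]_g (fine (value P N B (c g) x0 u))%:E)%E.
  by apply: eq_integral => g _; rewrite (fE u hu g).
rewrite (rE _ hustar) (rE _ hv).
have mv u (hu : admissible P N B U q u) : measurable_fun [set: borel Gamma]
    (fun g => fine (value P N B (c g) x0 u)).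
  apply/measurable_EFinP; have := measurable_value x0 hB hsep h1 h2 h4 hu.
  by congr measurable_fun; apply/funext => g; rewrite /= fE.
apply: (@integral_le_gap _ _ _ lamstar _ _ (fun g => \sum_(k < N) D g k)).
- exact: mv.
- exact: mv.
- by apply: rintegrable_sum => k; exact: D_int.
- rewrite EFin_Rintegral; last by apply: rintegrable_sum => k; exact: D_int.
  rewrite Rintegral_sum => [|k]; last exact: D_int.
  rewrite lee_fin sumr_ge0// => k _; rewrite -lee_fin -EFin_Rintegral;
    last exact: D_int.
  exact: D_ge0.
- move=> g; rewrite -lee_fin EFinD (fE _ hustar g) (fE _ hv g).
  exact: (value_gap hB hsep hL hU' h1 h2 h4 hq hustar hv hadj h6 g).
Qed.
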